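(* Suppose the set-valued map $F:[0,\infty)\times\mathbb R^n\to\mathcal P(\mathbb R^n)$ has compact values and satisfies the following: (i) $F$ is $\mathcal L[0,\infty)\otimes\mathcal B(\mathbb R^n)$ measurable; (ii) for each $R>0$ there exists $k_R\in L^1_{\mathrm{loc}}([0,\infty),\mathbb R)$ such that for any $\xi,\eta\in B(0,R)$, $$d_H(F(t,\xi),F(t,\eta))\le k_R(t)\,|\xi-\eta|\qquad\text{a.e. } t\in[0,\infty);$$ (iii) for each $R>0$ there exists $\alpha_R\in L^1_{\mathrm{loc}}([0,\infty),\mathbb R)$ such that for each $\xi\in B(0,R)$, $$\sup\{|\zeta| : \zeta\in F(t,\xi)\}\le\alpha_R(t)\qquad\text{a.e. } t\in[0,\infty).$$ Then the differential inclusion $\dot x(t)\in F(t,x(t))$ is forward complete if and only if its relaxation $\dot x(t)\in\operatorname{clco}F(t,x(t))$ is forward complete.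
   Context: $\mathcal P(\mathbb R^n)$ is the family of all nonempty closed subsets of $\mathbb R^n$, and $|\cdot|$ is the norm on $\mathbb R^n$. $\mathcal L[0,\infty)$ is the $\sigma$-field of Lebesgue measurable subsets of $[0,\infty)$ and $\mathcal B(\mathbb R^n)$ is the family of Borel subsets of $\mathbb R^n$; measurability of $F$ is meant in the usual sense for set-valued maps, i.e. $\{(t,\xi): F(t,\xi)\cap O\neq\emptyset\}\in\mathcal L[0,\infty)\otimes\mathcal B(\mathbb R^n)$ for every open $O\subseteq\mathbb R^n$. $B(0,R)=\{\eta\in\mathbb R^n: |\eta|\le R\}$ is the closed ball. For $K,L\in\mathcal P(\mathbb R^n)$, $d(\xi,K)=\inf\{|\xi-\eta|:\eta\in K\}$ and the Hausdorff distance is $d_H(K,L)=\max\{\sup_{\xi\in K}d(\xi,L),\ \sup_{\eta\in L}d(\eta,K)\}$. $\operatorname{clco}$ denotes the closed convex hull. $L^1_{\mathrm{loc}}([0,\infty),\mathbb R)$ is the space of locally integrable functions on $[0,\infty)$. For an interval $\mathcal I\subseteq[0,\infty)$, a function $x:\mathcal I\to\mathbb R^n$ is a solution of a differential inclusion $\dot x(t)\in G(t,x(t))$ if it is absolutely continuous and satisfies the inclusion for almost every $t\in\mathcal I$. A solution $x:[0,T)\to\mathbb R^n$ (where $0<T\le\infty$) is maximal if it does not have an extension which is a solution, that is, either $T=\infty$ or there does not exist a solution $y:[0,T_+]\to\mathbb R^n$ with $T_+>T$ such that $y(t)=x(t)$ for all $t\in[0,T)$. A differential inclusion is forward complete if every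 maximal solution is defined on the interval $[0,\infty)$.
   Formalization: In (ii) the exceptional null set of times is taken independent of ξ and η (for a.e. t the inequality holds for all ξ, η in B(0,R)); if the null set may depend on ξ and η, the claim is false. *)

(* Defs.v *)
(* MathComp-Analysis development over an arbitrary realType. *)
From HB Require Import structures.
From mathcomp Require Import all_boot all_order all_algebra.
From mathcomp Require Import all_classical all_reals all_analysis.

Set Implicit Arguments.
Unset Strict Implicit.
Unset Printing Implicit Defensive.

Import Order.TTheory GRing.Theory Num.Theory.
Import numFieldNormedType.Exports.

Local Open Scope classical_set_scope.
Local Open Scope ring_scope.

Section Euclidean.
Context {R : realType} {n : nat}.
Implicit Types (x xi eta zeta : 'rV[R]_n) (K L A : set 'rV[R]_n).

(* The norm `|x| of the library is the sup norm; it induces the same topology. *)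
Definition enorm x : R := Num.sqrt (\sum_(i < n) x ord0 i ^+ 2).

Definition eball (r : R) : set 'rV[R]_n := [set eta | enorm eta <= r].

(* Extended real values: no junk value for an unbounded or empty set. *)
Definition dist_set xi K : \bar R :=
  ereal_inf [set (enorm (xi - eta))%:E | eta in K].

Definition hausdorff_dist K L : \bar R :=
  maxe (ereal_sup [set dist_set xi L | xi in K])
       (ereal_sup [set dist_set eta K | eta in L]).

Definition clco A : set 'rV[R]_n :=
  smallest [set C : set 'rV[R]_n |
    closed C /\ convex_set (C : set (convex_lmodType 'rV[R]_n))] A.

End Euclidean.

Section Measurability.
Context {R : realType} {n : nat}.

(* The Caratheodory sigma-algebra is that of the Lebesgue measurable sets, not
   only the Borel ones. *)
Definition lebesgue_sets_ge0 : set (set R) :=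
  [set A | (wlength (R := R) idfun)^*%mu.-cara.-measurable A /\
           A `<=` `[0, +oo[ ].

Definition borel_sets : set (set 'rV[R]_n) := <<s open >>.

Definition prod_lebesgue_borel : set (set (R * 'rV[R]_n)) :=
  <<s `[0, +oo[ `*` setT,
      [set E | exists A B, [/\ lebesgue_sets_ge0 A, borel_sets B & E = A `*` B]] >>.

(* A set-valued map on [0, oo) x R^n is a total function whose values at
   negative times are never used. *)
Definition measurable_multifunction (F : R -> 'rV[R]_n -> set 'rV[R]_n) :=
  forall O : set 'rV[R]_n, open O ->
    prod_lebesgue_borel
      [set p | 0 <= p.1 /\ F p.1 p.2 `&` O !=set0].

(* The library's locally_integrable requires an open domain and Borel
   measurability. *)
Definition L1loc_ge0 (k : R -> R) :=
  forall K : set R, K `<=` `[0, +oo[ -> compact K ->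
    (@completed_lebesgue_measure R).-integrable K (EFin \o k).

End Measurability.

Section Inclusions.
Context {R : realType} {n : nat}.
Implicit Types (x y : R -> 'rV[R]_n) (G : R -> 'rV[R]_n -> set 'rV[R]_n).

Definition abs_continuous (a b : R) x :=
  forall e : R, 0 < e -> exists2 d : R, 0 < d &
    forall (m : nat) (u v : 'I_m -> R),
      (forall i, [/\ a <= u i, u i <= v i & v i <= b]) ->
      trivIset setT (fun i => `]u i, v i[%classic) ->
      \sum_(i < m) (v i - u i) < d ->
      \sum_(i < m) enorm (x (v i) - x (u i)) < e.

(* On an interval that is not compact, absolute continuity is meant on every
   compact subinterval, as is usual for differential inclusions; on [0, T] this
   is absolute continuity. *)
Definition is_solution G (I : set R) x :=
  (forall a b : R, `[a, b] `<=` I -> abs_continuous a b x) /\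
  {ae (@lebesgue_measure R), forall t : R,
    I t -> derivable x t 1 /\ G t (x t) ('D_1 x t)}.

Definition horizon (T : \bar R) : set R := [set t : R | 0 <= t /\ (t%:E < T)%E].

Definition maximal_solution G (T : \bar R) x :=
  [/\ (0 < T)%E, is_solution G (horizon T) x &
      T = +oo%E \/
      ~ exists (Tp : R) y, [/\ (T < Tp%:E)%E, is_solution G `[0, Tp] y &
                               forall t, horizon T t -> y t = x t]].

Definition forward_complete G :=
  forall (T : \bar R) x, maximal_solution G T x -> T = +oo%E.

End Inclusions.

(* Main.v *)
(* Fix T finite and call a solution on [0, T) bounded if its values are.  A
   bounded solution of either inclusion has a limit at T, from which a local
   solution of the F-inclusion continues it; an unbounded one is maximal.  So an
   inclusion is forward complete iff all its solutions on bounded intervals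
   [0, T) are bounded, and everything reduces to relaxation with a uniform error
   on the half-open interval: for a solution x of the relaxed inclusion on [0, T)
   there is a solution y of the original one with |y - x| <= 1.

   First, a measurable selection w of F(t, x t) is built whose primitive stays
   close to x.  On each short piece w nearly minimises the inner product with the
   accumulated error e = int (w - x'); as x' lies in the closed convex hull, this
   makes the derivative of |e|^2 / 2 almost nonpositive.  Windows accumulating at T
   with summable errors make the error from t on at most a prescribed weight
   rho(t) > 0 that may tend to 0 at T.  Then Filippov's successive approximations,
   integrated backwards from T and with rho = exp (-4 int_0^t kap) / 2 for kap the
   Lipschitz constant along x, turn w into the derivative of y: the weight makes
   the iteration a contraction although kap need not be integrable up to T.

   Lebesgue measurability is traded for Borel measurability by deleting a null set
   of times, on whose complement t |-> F(t, y t) is Borel for every Borel y. *)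
Require Import Defs.
From HB Require Import structures.
From mathcomp Require Import all_boot all_order all_algebra.
From mathcomp Require Import all_classical all_reals all_analysis.
From mathcomp Require Import measurable_realfun.
From mathcomp Require Import ring lra.
Set Implicit Arguments.
Unset Strict Implicit.
Unset Printing Implicit Defensive.

Import Order.TTheory GRing.Theory Num.Theory.
Import numFieldNormedType.Exports.
Local Open Scope classical_set_scope.
Local Open Scope ring_scope.

(** The Lipschitz constants belong to balls, and a relaxed solution may a priori blow up at [T], so
    the constant [kap] along it may fail to be integrable on [0, T). A forward Gronwall estimate
    then loses all control near [T]. But forward completeness quantifies over all initial values:
    the approximating solution need not start at [x 0], and this freedom allows corrections to be
    integrated backwards from [T]. The weight solves rho' = -4 kap rho, so the integral of kap rho
    over [t, T] is at most rho(t) / 4: the Lipschitz bound turns a state error rho into a velocity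
    correction kap rho, and integrating that back gains a factor 1/4. A factor 2 of this gain pays
    for the strict slack that measurable selections need; the rest makes the corrections decrease
    like 2^-m. The factor 1/2 in rho keeps the selection error and the correction, each at most rho,
    inside the unit tube around [x]. Truncating states to that tube makes the Lipschitz condition
    global without changing [F] in the tube. *)

(** * Absolute continuity, and monotonicity from the sign of the derivative *)

Section AbsoluteContinuity.
Context {R : realType}.
Notation mu := (@lebesgue_measure R).
Implicit Types (a b s e : R) (phi : R -> R) (D : R -> R -> R).

(* Applied to the increments [D u v] of a function, this is absolute continuity
   on [a, b]; interval integrals are other instances. *)
Definition ac_on a b D : Prop :=
  forall e : R, 0 < e -> exists2 d : R, 0 < d &
    forall (m : nat) (u v : 'I_m -> R),
      (forall i, [/\ a <= u i, u i <= v i & v i <= b]) ->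
      trivIset setT (fun i => `]u i, v i[%classic) ->
      \sum_(i < m) (v i - u i) < d ->
      \sum_(i < m) D (u i) (v i) < e.

Lemma ac_on_le a b D1 D2 c : 0 <= c ->
  (forall u v, a <= u -> u <= v -> v <= b -> D1 u v <= c * D2 u v) ->
  ac_on a b D2 -> ac_on a b D1.
Proof.
move=> c0 D12 acD e e0.
have c1 : 0 < c + 1 by rewrite ltr_wpDl.
have [d d0 dP] := acD (e / (c + 1)) (divr_gt0 e0 c1).
exists (Num.min d d); first by rewrite lt_min d0.
rewrite minxx => m u v uv tuv sd.
case: m u v uv tuv sd => [|m] u v uv tuv sd; first by rewrite big_ord0.
have := dP _ _ _ uv tuv sd; set S := \sum_(i < _) _ => Se.
apply: (@le_lt_trans _ _ (c * S)).
  by rewrite /S mulr_sumr; apply: ler_sum => i _; have [? ? ?] := uv i; exact: D12.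
have [S0|S0] := leP 0 S.
  rewrite (@le_lt_trans _ _ ((c + 1) * S))//.
    by rewrite ler_wpM2r// lerDl.
  by rewrite mulrC -ltr_pdivlMr.
by rewrite (@le_lt_trans _ _ 0)// mulr_ge0_le0// ltW.
Qed.

Lemma ac_onD a b D1 D2 : ac_on a b D1 -> ac_on a b D2 ->
  ac_on a b (fun u v => D1 u v + D2 u v).
Proof.
move=> ac1 ac2 e e0; have e2 : 0 < e / 2 by rewrite divr_gt0.
have [d1 d10 H1] := ac1 _ e2; have [d2 d20 H2] := ac2 _ e2.
exists (Num.min d1 d2); first by rewrite lt_min d10.
move=> m u v uv tuv; rewrite lt_min => /andP[sd1 sd2].
by rewrite big_split/= (splitr e) ltrD// ?H1// H2.
Qed.

Lemma ac_on_small a b D : ac_on a b D ->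
  forall e, 0 < e -> exists2 d, 0 < d & forall u v,
    a <= u -> u <= v -> v <= b -> v - u < d -> D u v < e.
Proof.
move=> acp e e0; have [d d0 H] := acp _ e0; exists d => // u v au uv vb vud.
have := @H 1%N (fun=> u) (fun=> v).
rewrite !big_ord1; apply => //.
by apply/trivIsetP => i j _ _; rewrite !ord1 eqxx.
Qed.

(** Solutions are tested on all subintervals, empty ones included; there only the empty family of
    intervals is admissible. *)
Lemma ac_on_empty a b D : b < a -> ac_on a b D.
Proof.
move=> ba e e0; exists 1 => // -[|m] u v uv _ _; first by rewrite big_ord0.
have [au uv0 vb] := uv ord0.
by have := le_trans au (le_trans uv0 vb); rewrite leNgt ba.
Qed.

Definition isum (l : seq (R * R)) (phi : R -> R) := \sum_(p <- l) `|phi p.2 - phi p.1|.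

(** The intervals inside the exceptional open set crossed so far, whose increments are charged to
    absolute continuity instead of the derivative. *)
Definition family (U : set R) a t (l : seq (R * R)) :=
  (forall p, p \in l -> [/\ a <= p.1, p.1 <= p.2, p.2 <= t &
      `]p.1, p.2[%classic `<=` U]) /\
  pairwise (fun p q => p.2 <= q.1) l.

(** The interiors are disjoint and lie in [U], so their total length is at most the measure of
    [U]. *)
Lemma family_sum U a b l phi d e :
  (forall (m : nat) (u v : 'I_m -> R),
      (forall i, [/\ a <= u i, u i <= v i & v i <= b]) ->
      trivIset setT (fun i => `]u i, v i[%classic) ->
      \sum_(i < m) (v i - u i) < d ->
      \sum_(i < m) `|phi (v i) - phi (u i)| < e) ->
  measurable U -> (mu U < d%:E)%E -> family U a b l -> isum l phi < e.
Proof.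
move=> H mU Ud [lP pl].
pose u (i : 'I_(size l)) := (nth (0, 0) l i).1.
pose v (i : 'I_(size l)) := (nth (0, 0) l i).2.
have tuv : trivIset setT (fun i => `]u i, v i[%classic).
  suff K (i j : 'I_(size l)) : (i < j)%N -> `]u i, v i[ `&` `]u j, v j[ = set0.
    apply/trivIsetP => i j _ _ /eqP ij.
    have [/K//|/K|/ord_inj//] := ltngtP i j.
    by rewrite setIC.
  move=> ij; rewrite -subset0 => z [/=]; rewrite !in_itv/= => /andP[_ zv] /andP[uz _].
  have := pairwiseP (0, 0) pl i j (ltn_ord i) (ltn_ord j) ij.
  by rewrite leNgt (lt_trans uz zv).
have uvP i : [/\ a <= u i, u i <= v i, v i <= b & `]u i, v i[%classic `<=` U].
  by apply: lP; exact: mem_nth.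
rewrite /isum (big_nth (0, 0)) big_mkord; apply: (H _ u v) => //.
  by move=> i; have [] := uvP i.
rewrite -lte_fin; apply: le_lt_trans Ud; rewrite -sumEFin.
rewrite (eq_bigr (fun i => mu `]u i, v i[%classic)); last first.
  move=> i _; rewrite lebesgue_measure_itv/= lte_fin.
  have [_ + _ _] := uvP i; rewrite le_eqVlt => /predU1P[->|->//].
  by rewrite ltxx subrr.
rewrite -measure_bigsetU_ord//.
apply: le_measure; rewrite ?inE//.
  by apply: bigsetU_measurable => i _; exact: measurable_itv.
apply: (big_ind (fun X => X `<=` U)) => // [X Y XU YU z [/XU|/YU]//|i _].
by have [] := uvP i.
Qed.

Lemma derivable_approx phi c e : derivable phi c 1 -> 0 < e ->
  exists2 r, 0 < r & forall y, `|y - c| < r ->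
    `|phi y - phi c - 'D_1 phi c * (y - c)| <= e * `|y - c|.
Proof.
move=> dc e0; have /cvgrPdist_le/(_ _ e0) := dc.
move=> [r /= r0 rP]; exists r => // y yc.
have [->|yc0] := eqVneq y c; first by rewrite !subrr mulr0 subrr normr0 mulr0.
have := rP (y - c); rewrite /ball_/= sub0r normrN => /(_ yc).
rewrite subr_eq0 => /(_ yc0).
rewrite [(y - c) *: 1]mulr1 subrK -(@ler_pM2r _ `|y - c|) ?normr_gt0 ?subr_eq0//.
rewrite -normrM mulrBl distrC; congr (`|_ - _| <= _).
by rewrite [_ *: _]mulrC divfK// subr_eq0.
Qed.

(* Cousin-type argument: off an open set of small measure the derivative bounds
   the increments of [phi]; inside it absolute continuity does. *)
Lemma ac_on_nonincreasing a b phi : a <= b ->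
  ac_on a b (fun u v => `|phi v - phi u|) ->
  {ae mu, forall t : R, a < t < b -> derivable phi t 1 /\ 'D_1 phi t <= 0} ->
  phi b <= phi a.
Proof.
rewrite le_eqVlt => /predU1P[-> _ _|ab acp [A [mA A0 NA]]] //.
suff H e : 0 < e -> phi b - phi a <= e * (b - a) + e.
  have c0 : 0 < b - a + 1 by rewrite ltr_wpDl// subr_ge0 ltW.
  rewrite -subr_le0; apply/ler_addgt0Pr => e e0; rewrite add0r.
  have := H (e / (b - a + 1)) (divr_gt0 e0 c0).
  rewrite -[X in _ <= _ + X](mulr1 (e / _)) -mulrDr.
  by rewrite divfK// gt_eqF.
move=> e0.
have [d d0 dP] := acp _ e0.
(* The endpoints join the exceptional set because the derivative is controlled only in the open
   interval. *)
pose B := (A `&` `[a, b]) `|` [set a] `|` [set b].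
have mAab : measurable (A `&` `[a, b]) by apply: measurableI.
have mB : measurable B by apply: measurableU => //; exact: measurableU.
have B0 : mu B = 0%E.
  apply: measure_negligible => //.
  have n1 x : mu.-negligible [set x].
    by apply/negligibleP => //; exact: lebesgue_measure_set1.
  apply: negligibleU => //; apply: negligibleU => //.
  by exists A; split => //; exact: subIsetl.
have Boo : (mu B < +oo)%E by rewrite B0 ltry.
have [U [oU BU UB]] := lebesgue_regularity_outer mB Boo d0.
have mU : measurable U by exact: open_measurable.
have Ud : (mu U < d%:E)%E.
  have -> : U = (U `\` B) `|` B by rewrite setUC setDUK.
  by rewrite measureU0//; exact: measurableD.
(* The points up to which the increment is bounded by slope [e] plus the increments over finitely
   many intervals inside [U]; the goal is to reach [b]. *)
pose S := [set t | [/\ a <= t, t <= b & exists l, family U a t l /\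
   phi t - phi a <= e * (t - a) + isum l phi]].
have Sa : S a.
  split => //; first exact: ltW.
  exists [::]; split; first by split.
  by rewrite /isum big_nil !subrr mulr0 addr0.
have Sb z : S z -> z <= b by case.
have supS : has_sup S by split; [exists a|exists b => z /Sb].
pose c := sup S.
have ac : a <= c by exact: (ub_le_sup supS.2 Sa).
have cb : c <= b by apply: ge_sup; [exists a|move=> z /Sb].
have step t t' : S t -> t <= t' -> t' <= b -> phi t' - phi t <= e * (t' - t) -> S t'.
  move=> [at_ tb [l [[lP pl] lS]]] tt' t'b h; split => //; first exact: le_trans tt'.
  exists l; split.
    split=> // p /lP[h1 h2 h3 h4]; split => //; exact: le_trans tt'.
  by rewrite !mulrBr in h lS *; lra.
have stepU t t' : S t -> t <= t' -> t' <= b -> `]t, t'[ `<=` U -> S t'.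
  move=> [at_ tb [l [[lP pl] lS]]] tt' t'b h; split => //; first exact: le_trans tt'.
  exists (rcons l (t, t')); split.
    split.
      move=> p; rewrite mem_rcons inE => /predU1P[->//|/lP[h1 h2 h3 h4]].
      split => //; exact: le_trans tt'.
    rewrite pairwise_rcons pl andbT; apply/allP => p /lP[_ _ + _] //.
  rewrite /isum -cats1 big_cat/= big_seq1/=.
  have : 0 <= e * (t' - t) by rewrite mulr_ge0 ?subr_ge0 ?(ltW e0).
  have := ler_norm (phi t' - phi t).
  by rewrite -/(isum l phi) !mulrBr in lS *; lra.
have nearS r : 0 < r -> exists2 t, S t & c - r < t <= c.
  move=> r0; have [t St rt] := sup_adherent r0 supS.
  by exists t => //; rewrite rt/=; exact: (ub_le_sup supS.2 St).
(* If points of [S] just left of the supremum [c] propagate to points just right of it, then either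
   [c] is not an upper bound or [b] is reached. *)
have adv r : 0 < r -> (forall t t', a <= t -> t' <= b -> c - r < t -> t <= c -> c <= t' -> t' < c + r ->
    S t -> S t') -> S b.
  move=> r0 K; have [t St /andP[rt tc]] := nearS _ r0.
  have [at_ tb _] := St.
  have Sm : S (Num.min b (c + r / 2)).
    apply: K St => //; first by rewrite ge_min lexx.
      by rewrite le_min cb/= lerDl divr_ge0// ltW.
    by rewrite gt_min; apply/orP; right; lra.
  have := ub_le_sup supS.2 Sm; rewrite -/c ge_min => /orP[bc|].
    by move: Sm; rewrite (min_idPl _)// (le_trans bc)// lerDl divr_ge0// ltW.
  by rewrite leNgt ltrDl divr_gt0.
have [_ _ [l [lfam lS]]] : S b.
  have [Bc|nBc] := pselect (B c).
    have /nbhs_ballP[r /= r0 rU] : nbhs c U by apply: open_nbhs_nbhs; split => //; exact: BU.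
    apply: (adv r r0) => t t' at_ t'b rt tc ct' rt' St.
    apply: stepU St _ t'b _; first exact: le_trans ct'.
    move=> z /=; rewrite in_itv/= => /andP[tz zt']; apply: rU; rewrite /ball/=.
    by rewrite ltr_norml; apply/andP; split; lra.
  have cab : a < c < b.
    rewrite !lt_neqAle ac cb !andbT; apply/andP; split.
      by apply/eqP => ?; apply: nBc; left; right.
    by apply/eqP => ?; apply: nBc; right.
  have [dc Dc] : derivable phi c 1 /\ 'D_1 phi c <= 0.
    apply/not_notP => h; apply: nBc; left; left; split; last first.
      by rewrite /= in_itv/= ac.
    by apply: NA => /= /(_ cab).
  have [r r0 rP] := derivable_approx dc e0.
  apply: (adv r r0) => t t' at_ t'b rt tc ct' rt' St.
  apply: step St _ t'b _; first exact: le_trans ct'.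
  (* As [t] and [t'] lie on opposite sides of [c], the errors of the two expansions at [c] sum to
     exactly [e] times their distance. *)
  have := rP t; have := rP t'.
  rewrite (ger0_norm (_ : 0 <= t' - c)) ?subr_ge0//.
  rewrite (ler0_norm (_ : t - c <= 0)) ?subr_le0//.
  have -> : t' - c < r by lra.
  have -> : - (t - c) < r by lra.
  move=> /(_ isT) + /(_ isT); rewrite !ler_norml => /andP[_ h1] /andP[h2 _].
  have h3 : 'D_1 phi c * (t' - c) <= 0 by rewrite mulr_le0_ge0// subr_ge0.
  have h4 : 0 <= 'D_1 phi c * (t - c) by rewrite mulr_le0// subr_le0.
  rewrite [leRHS](_ : _ = e * (t' - c) + e * (- (t - c))); last by rewrite -mulrDr; congr (_ * _); lra.
  by lra.
apply: (le_trans lS); rewrite lerD2l ltW//.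
exact: (family_sum dP mU Ud lfam).
Qed.

End AbsoluteContinuity.

(** * Integrals over compact intervals *)

Section IntervalIntegrals.
Context {R : realType}.
Notation mu := (@lebesgue_measure R).
Implicit Types (a b c d : R) (f g : R -> R).

Lemma ae_imp (P Q : R -> Prop) : (forall t, P t -> Q t) ->
  {ae mu, forall t, P t} -> {ae mu, forall t, Q t}.
Proof. by move=> PQ; apply: filterS; first exact: (ae_filter_ringOfSetsType mu). Qed.

Lemma ae_and (P Q : R -> Prop) : {ae mu, forall t, P t} ->
  {ae mu, forall t, Q t} -> {ae mu, forall t, P t /\ Q t}.
Proof. by apply: filterI; exact: (ae_filter_ringOfSetsType mu). Qed.

Definition integ a b f := mu.-integrable `[a, b] (EFin \o f).
Definition int a b f : R := \int[mu]_(t in `[a, b]) f t.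

Let m_itv a b : measurable (`[a, b]%classic : set (measurableTypeR R)).
Proof. exact: measurable_itv. Qed.

Lemma integ_sub a b c d f : a <= c -> d <= b -> integ a b f -> integ c d f.
Proof.
move=> ac db; apply: integrableS => //.
by apply: subset_itv; rewrite bnd_simp.
Qed.

Lemma integ_le a b f g : measurable_fun `[a, b] f ->
  (forall t, a <= t <= b -> `|f t| <= g t) -> integ a b g -> integ a b f.
Proof.
move=> mf fg ig; apply: le_integrable ig => //; first exact/measurable_EFinP.
move=> t; rewrite /= in_itv/= => /fg h.
by rewrite lee_fin (le_trans h)// ler_norm.
Qed.

Lemma eq_integ a b f g : (forall t, a <= t <= b -> f t = g t) ->
  integ a b f -> integ a b g.
Proof.
move=> fg; apply: eq_integrable => // t; rewrite inE/= in_itv/= => /fg.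
by move=> /= ->.
Qed.

Lemma integD a b f g : integ a b f -> integ a b g -> integ a b (f \+ g).
Proof.
move=> fi gi; have := integrableD (m_itv a b) fi gi.
by apply: eq_integrable.
Qed.

Lemma integB a b f g : integ a b f -> integ a b g -> integ a b (f \- g).
Proof.
move=> fi gi; have := integrableB (m_itv a b) fi gi.
by apply: eq_integrable.
Qed.

Lemma integZ a b c f : integ a b f -> integ a b (fun t => c * f t).
Proof.
move=> fi; have := integrableZl (m_itv a b) c fi.
by apply: eq_integrable.
Qed.

Lemma integ_norm a b f : integ a b f -> integ a b (fun t => `|f t|).
Proof. by move=> ?; exact: (@integrable_norm _ _ _ mu). Qed.

Lemma integ_sum a b (I : finType) (f : I -> R -> R) :
  (forall i, integ a b (f i)) -> integ a b (fun t => \sum_i f i t).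
Proof.
move=> fi; have := @integrable_sum _ _ _ mu `[a, b] _ I (index_enum I) xpredT (fun i => EFin \o f i).
move=> /(_ (measurable_itv _) (fun i _ => fi i)).
by apply: eq_integrable => // t _; rewrite /= sumEFin.
Qed.

Lemma integ_cst a b c : integ a b (fun=> c).
Proof.
apply: measurable_bounded_integrable => //=.
  by rewrite lebesgue_measure_itv/= lte_fin; case: ifP => _; rewrite ltry.
by exists `|c|; split; [exact: num_real|move=> M cM t _ /=; exact: ltW].
Qed.

Lemma int_chasles a b c f : a <= c -> c <= b -> integ a b f ->
  int a b f = int a c f + int c b f.
Proof.
move=> ac cb fi; have := @Rintegral_itvB R f (BLeft a) (BRight b) c fi.
rewrite !bnd_simp => /(_ ac cb); rewrite Rintegral_itv_obnd_cbnd; last first.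
  by apply: integrableS fi => //; apply: subset_itv; rewrite bnd_simp.
by rewrite /int => <-; rewrite addrC subrK.
Qed.

Lemma intaa a f : int a a f = 0.
Proof. by rewrite /int set_itv1 Rintegral_set1. Qed.

Lemma int_ge0 a b f : (forall t, a <= t <= b -> 0 <= f t) -> 0 <= int a b f.
Proof. by move=> f0; apply: Rintegral_ge0 => t /=; rewrite in_itv/= => /f0. Qed.

Lemma int_le a b f g : integ a b f -> integ a b g ->
  (forall t, a <= t <= b -> f t <= g t) -> int a b f <= int a b g.
Proof. by move=> fi gi fg; apply: le_Rintegral => // t /=; rewrite in_itv/= => /fg. Qed.

Lemma eq_int a b f g : (forall t, a <= t <= b -> f t = g t) ->
  int a b f = int a b g.
Proof. by move=> fg; apply: eq_Rintegral => t; rewrite inE/= in_itv/= => /fg. Qed.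

Lemma int_norm a b f g : integ a b f -> integ a b g ->
  (forall t, a <= t <= b -> `|f t| <= g t) -> `|int a b f| <= int a b g.
Proof.
move=> fi gi fg; apply: (le_trans (le_normr_Rintegral _ fi)) => //.
by apply: int_le => //; exact: integ_norm.
Qed.

Lemma intD a b f g : integ a b f -> integ a b g ->
  int a b (fun t => f t + g t) = int a b f + int a b g.
Proof. by move=> fi gi; exact: RintegralD. Qed.

Lemma intB a b f g : integ a b f -> integ a b g ->
  int a b (fun t => f t - g t) = int a b f - int a b g.
Proof. by move=> fi gi; exact: RintegralB. Qed.

Lemma intZ a b c f : integ a b f -> int a b (fun t => c * f t) = c * int a b f.
Proof. by move=> fi; exact: RintegralZl. Qed.

Lemma int_sum a b (I : finType) (f : I -> R -> R) :
  (forall i, integ a b (f i)) ->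
  int a b (fun t => \sum_i f i t) = \sum_i int a b (f i).
Proof.
move=> fi; rewrite /int /Rintegral.
under eq_integral do rewrite -sumEFin.
rewrite (integral_sum (m_itv a b) fi).
rewrite (@eq_bigr _ _ _ _ _ _ _ (fun i => (int a b (f i))%:E)).
  by rewrite sumEFin.
by move=> i _; rewrite /int /Rintegral fineK//; exact: (integrable_fin_num _ (fi i)).
Qed.

Lemma int_cst a b c : a <= b -> int a b (fun=> c) = c * (b - a).
Proof.
move=> ab; rewrite /int Rintegral_cst//= lebesgue_measure_itv/= lte_fin.
by move: ab; rewrite le_eqVlt => /predU1P[->|->]//=; rewrite ltxx subrr.
Qed.

Lemma int_sub_le a b c d f : a <= c -> c <= d -> d <= b ->
  (forall t, a <= t <= b -> 0 <= f t) -> integ a b f -> int c d f <= int a b f.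
Proof.
move=> ac cd db f0 fi.
rewrite (@int_chasles a b c)//; last exact: le_trans db.
rewrite (@int_chasles c b d)//; last exact: integ_sub fi.
have h1 : 0 <= int a c f.
  apply: int_ge0 => t /andP[at_ tc]; apply: f0; rewrite at_/=.
  exact: le_trans tc (le_trans cd db).
have h2 : 0 <= int d b f.
  apply: int_ge0 => t /andP[dt tb]; apply: f0; rewrite tb andbT.
  exact: le_trans ac (le_trans cd dt).
lra.
Qed.

(** Absolute continuity of the integral as a set function, applied to the union of the disjoint
    intervals. *)
Lemma int_ac a b f : (forall t, a <= t <= b -> 0 <= f t) -> integ a b f ->
  ac_on a b (fun u v => int u v f).
Proof.
move=> f0 fi e e0.
have : mu.-integrable setT (EFin \o f \_ `[a, b]).
  by rewrite -restrict_EFin; apply/integrable_restrict => //=; rewrite setTI.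
move=> fi'; have [d [d0 H]] := integral_normr_continuous fi' e0.
exists d => // m u v uv tuv sd.
pose A := \big[setU/set0]_(i < m) `]u i, v i[%classic.
have mA : measurable A by apply: bigsetU_measurable => i _; exact: measurable_itv.
have muA : (mu A < d%:E)%E.
  rewrite /A measure_bigsetU_ord//.
  apply: (@le_lt_trans _ _ (\sum_(i < m) (v i - u i))%:E); last by rewrite lte_fin.
  rewrite -sumEFin; apply: lee_sum => i _; rewrite [leLHS]lebesgue_measure_itv/= lte_fin.
  by case: ifPn => // _; rewrite lee_fin subr_ge0; have [] := uv i.
apply: le_lt_trans (H A mA muA).
have uvi i : integ (u i) (v i) f by have [? _ ?] := uv i; exact: integ_sub fi.
suff -> : \sum_(i < m) int (u i) (v i) f =
    Rintegral mu A (fun x => `|(f \_ `[a, b]) x|) by [].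
rewrite /Rintegral /A (@integral_bigsetU_EFin _ (measurableTypeR R) R mu).
- rewrite (eq_bigr (fun i => (int (u i) (v i) f)%:E)) ?sumEFin// => i _.
  have [ui uvle vi] := uv i.
  transitivity (\int[mu]_(x in `]u i, v i[) (f x)%:E)%E.
    apply: eq_integral => x; rewrite inE/= in_itv/= => /andP[ux xv].
    have xab : a <= x <= b.
      by apply/andP; split; [exact: le_trans ui (ltW ux)|exact: le_trans (ltW xv) vi].
    by rewrite patchE mem_set/= ?in_itv//= ger0_norm// f0.
  have mf J : J `<=` `[u i, v i] -> measurable_fun J (EFin \o f).
    by move=> /measurable_funS; apply => //; case/integrableP : (uvi i).
  rewrite integral_itv_obnd_cbnd; last first.
    by apply: mf; apply: subset_itv; rewrite bnd_simp.
  rewrite integral_itv_bndo_bndc; last first.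
    by apply: mf; apply: subset_itv; rewrite bnd_simp.
  by rewrite /int /Rintegral fineK//; exact: (integrable_fin_num _ (uvi i)).
- by move=> i; exact: measurable_itv.
- exact: index_enum_uniq.
- by apply: sub_trivIset tuv.
- apply/measurable_EFinP/measurableT_comp => //; apply: measurable_funTS.
  by case/integrableP : fi' => /measurable_EFinP.
Qed.

(** The differentiation theorem is applied to [f] extended by 0; the two primitives agree near every
    point left of [b]. *)
Lemma int_ftc a b f : integ a b f ->
  {ae mu, forall t : R, a < t < b ->
    derivable (fun y => int a y f) t 1 /\ 'D_1 (fun y => int a y f) t = f t}.
Proof.
move=> fi; pose g := f \_ `[a, b].
have gi : mu.-integrable setT (EFin \o g).
  by rewrite -restrict_EFin; apply/integrable_restrict => //=; rewrite setTI.
have gloc : locally_integrable [set: R] g.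
  apply: integrable_locally => //.
have := @FTC1 R g (BLeft a) _ gloc.
move=> /(_ (fun y => integrableS measurableT (m_itv a y) (@subsetT _ _) gi)).
apply: ae_imp => t H /andP[at_ tb].
have [|dg Dg] := H.
  by rewrite lte_fin.
have E : {near t, (fun y => int a y g) =1 (fun y => int a y f)}.
  have : \forall y \near t, y < b by exact: lt_nbhsl.
  apply: filterS => y yb; apply: eq_int => z /andP[az zy].
  by rewrite /g patchE mem_set//= in_itv/= az (le_trans zy (ltW yb)).
split.
  exact: near_eq_derivable dg.
rewrite -(near_eq_derive _ E) -derive1E Dg /g patchE mem_set//= in_itv/=.
by rewrite !ltW.
Qed.

End IntervalIntegrals.

(** * Norms, rational points and geometric convergence in row vectors *)

Section RowVectors.
Context {R : realType} {n : nat}.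
Local Notation V := 'rV[R]_n.
Implicit Types (x y z : V) (c e : R).

Lemma coord_le x i : `|x ord0 i| <= `|x|.
Proof.
rewrite [leRHS]/Num.Def.normr/= mx_normrE.
exact: (le_bigmax _ (fun ij => `|x ij.1 ij.2|) (ord0, i)).
Qed.

Lemma rv_norm_le x c : 0 <= c -> (forall i, `|x ord0 i| <= c) -> `|x| <= c.
Proof.
move=> c0 xc; rewrite [leLHS]/Num.Def.normr/= mx_normrE.
by apply: bigmax_le => //= -[j i] _ /=; rewrite (ord1 j).
Qed.

Lemma rv_norm_lt x c : 0 < c -> (forall i, `|x ord0 i| < c) -> `|x| < c.
Proof.
move=> c0 xc; rewrite [ltLHS]/Num.Def.normr/= mx_normrE.
by apply: bigmax_lt => //= -[j i] _ /=; rewrite (ord1 j).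
Qed.

Lemma le_enorm x : `|x| <= enorm x.
Proof.
apply: rv_norm_le => [|i]; first exact: sqrtr_ge0.
rewrite -sqrtr_sqr ler_wsqrtr// (bigD1 i)//= lerDl.
by apply: sumr_ge0 => j _; exact: sqr_ge0.
Qed.

Lemma enorm_le x : enorm x <= n%:R * `|x|.
Proof.
rewrite -[leRHS]ger0_norm ?mulr_ge0// -sqrtr_sqr ler_wsqrtr//.
rewrite (@le_trans _ _ (\sum_(i < n) `|x| ^+ 2))//.
  by apply: ler_sum => i _; rewrite -real_normK ?num_real// lerXn2r ?nnegrE// coord_le.
rewrite sumr_const card_ord -[leLHS]mulr_natl exprMn ler_wpM2r ?sqr_ge0//.
by rewrite -natrX ler_nat; case: (n) => // k; rewrite -{1}(expn1 k.+1) leq_pexp2l.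
Qed.

Lemma halfX_gt0 k : 0 < 2^-1 ^+ k :> R.
Proof. by rewrite exprn_gt0 ?invr_gt0. Qed.

Lemma halfX_small c e : 0 < e -> exists k, forall m, (k <= m)%N -> c * 2^-1 ^+ m < e.
Proof.
move=> e0; have /cvgrPdist_lt/(_ _ e0) : (geometric c 2^-1 : R^nat) @ \oo --> (0 : R).
  apply: cvg_geometric; rewrite ger0_norm ?invr_ge0//.
  by rewrite invf_lt1// ltr1n.
move=> [N _ NP]; exists N => m /NP /=; rewrite sub0r normrN.
exact: le_lt_trans (ler_norm _).
Qed.

(** Indexing a dense set by natural numbers lets measurable choices be made by a least index. *)
Definition rat_point (k : nat) : V :=
  map_mx ratr (odflt 0 (unpickle k : option 'rV[rat]_n)).

Lemma rat_point_dense x e : 0 < e -> exists k, `|x - rat_point k| < e.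
Proof.
move=> e0.
have H i : exists q : rat, `|x ord0 i - ratr q| < e.
  have [|q] := @rat_in_itvoo R (x ord0 i - e) (x ord0 i + e); first lra.
  by rewrite in_itv/= => /andP[h1 h2]; exists q; rewrite ltr_norml; lra.
have [f fP] := choice H.
exists (pickle (\row_i f i : 'rV[rat]_n)).
rewrite /rat_point pickleK/=; apply: rv_norm_lt => // i.
by rewrite !mxE.
Qed.

Lemma geometric_cvg (a : nat -> V) c :
  (forall k, `|a k.+1 - a k| <= c * 2^-1 ^+ k) ->
  exists l, forall k, `|a k - l| <= 2 * c * 2^-1 ^+ k.
Proof.
move=> ac.
have c0 : 0 <= c by have := ac 0%N; rewrite expr0 mulr1; exact: le_trans.
have H k m : `|a k - a (k + m)%N| <= 2 * c * 2^-1 ^+ k - 2 * c * 2^-1 ^+ (k + m).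
  elim: m => [|m IH]; first by rewrite addn0 !subrr normr0.
  rewrite addnS -(subrKA (a (k + m)%N)) (le_trans (ler_normD _ _))//.
  have := ac (k + m)%N; rewrite distrC exprS; set u := 2^-1 ^+ (k + m) in IH *.
  set w := `|_ - _|; move: IH; set w' := `|_ - _|; rewrite !mulrA.
  have -> : 2 * c / 2 * u = c * u by rewrite [2 * c]mulrC mulfK.
  have -> : 2 * c * u = 2 * (c * u) by rewrite mulrA.
  lra.
have H2 k m : (k <= m)%N -> `|a k - a m| <= 2 * c * 2^-1 ^+ k.
  move=> km; rewrite -(subnKC km) (le_trans (H k _))// gerBl mulr_ge0 ?exprn_ge0//.
  by rewrite mulr_ge0.
have ca : cauchy (a @ \oo).
  apply: cauchy_exP => e e0; have [N /(_ N (leqnn N)) Ne] := halfX_small (2 * c) e0; exists (a N).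
  exists N => // m /= Nm; rewrite -ball_normE /=; exact: le_lt_trans (H2 _ _ Nm) Ne.
have /cvg_ex[l al] : cvg (a @ \oo) by apply/cauchy_cvgP.
exists l => k; apply/ler_addgt0Pr => e e0.
have /cvgrPdist_lt/(_ _ e0)[N _ NP] := al.
rewrite -(subrKA (a (maxn k N))) (le_trans (ler_normD _ _))// lerD//.
  by apply: H2; exact: leq_maxl.
by rewrite distrC ltW// NP//= leq_maxr.
Qed.

End RowVectors.

(** * Least witnesses of predicates on the natural numbers *)

Section Least.

(** The default 0 keeps this total, so that it applies pointwise in time before a witness is
    known. *)
Definition least (P : nat -> Prop) : nat :=
  if pselect (exists k, `[< P k >]) is left h then ex_minn h else 0%N.

Lemma leastP (P : nat -> Prop) k : P k ->
  P (least P) /\ forall m, P m -> (least P <= m)%N.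
Proof.
move=> Pk; rewrite /least; case: pselect => [h|]; last first.
  by case; exists k; apply/asboolP.
by case: ex_minnP => m /asboolP Pm mP; split => // j /asboolP /mP.
Qed.

(** This writes a level set of the least index as a difference of sets where the predicate holds,
    the form in which it is measurable. *)
Lemma least_eq (P : nat -> Prop) k : P k ->
  forall m, least P = m <-> (P m /\ forall j, (j < m)%N -> ~ P j).
Proof.
move=> /leastP[Pl lP] m; split => [<-|[Pm mP]].
  by split=> // j + /lP; rewrite ltnNge => /negP.
apply/eqP; rewrite eqn_leq lP//= leqNgt; apply/negP => /mP; exact.
Qed.

End Least.

(** * Measurability of vector functions and measurable selections *)

Section VectorMeasurability.
Context {R : realType} {n : nat}.
Local Notation V := 'rV[R]_n.
Local Notation TR := (measurableTypeR R).
Implicit Types (D : set TR) (u v w : R -> V).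

(* Coordinatewise, as the library puts no sigma-algebra on ['rV[R]_n]. *)
Definition mfunv D v := forall i, measurable_fun D (fun t : TR => v t ord0 i : R).

Definition countable_index D (j : R -> nat) :=
  forall k, measurable (D `&` [set t | j t = k]).

Lemma countable_index_setI D j (A : nat -> set TR) : countable_index D j ->
  (forall k, measurable (D `&` A k)) -> measurable (D `&` [set t | A (j t) t]).
Proof.
move=> mj mA.
rewrite (_ : _ `&` _ = \bigcup_k ((D `&` [set t | j t = k]) `&` (D `&` A k))).
  by apply: bigcupT_measurable => k; exact: measurableI.
apply/seteqP; split=> [t [Dt At]|t [k _ [[Dt <-] [_ At]]]] //.
by exists (j t).
Qed.

Lemma measurable_fun_index D j (f : nat -> R -> R) : countable_index D j ->
  (forall k, measurable_fun D (f k : TR -> R)) ->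
  measurable_fun D (fun t : TR => f (j t) t : R).
Proof.
move=> mj mf mD Y mY.
exact: (@countable_index_setI D j (fun k => f k @^-1` Y) mj (fun k => mf k mD Y mY)).
Qed.

Lemma mfunv_index D j (f : nat -> R -> V) : countable_index D j ->
  (forall k, mfunv D (f k)) -> mfunv D (fun t => f (j t) t).
Proof.
move=> mj mf i; apply: (@measurable_fun_index D j (fun k t => f k t ord0 i)) => //.
by move=> k; exact: mf.
Qed.

Lemma countable_index_least D (P : R -> nat -> Prop) : measurable D ->
  (forall t, D t -> exists k, P t k) ->
  (forall k, measurable (D `&` [set t | P t k])) ->
  countable_index D (fun t => least (P t)).
Proof.
move=> mD exP mP k.
rewrite (_ : _ `&` _ = (D `&` [set t | P t k]) `\`
    \bigcup_(j in [set j | (j < k)%N]) (D `&` [set t | P t j])).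
  by apply: measurableD => //; exact: bigcup_measurable.
apply/seteqP; split=> [t [Dt /= h]|t [[Dt Pk] h]] /=.
  have [m Pm] := exP t Dt; have [Pk kP] := (least_eq Pm k).1 h.
  by split => // -[j /= jk [_]]; exact: kP.
split=> //; apply/(least_eq Pk); split => // j jk Pj; apply: h.
by exists j.
Qed.

Lemma mfunvD D u v : mfunv D u -> mfunv D v -> mfunv D (fun t => u t + v t).
Proof.
move=> mu mv i; rewrite [X in measurable_fun _ X](_ : _ = fun t => u t ord0 i + v t ord0 i).
  exact: measurable_funD.
by apply/funext => t; rewrite mxE.
Qed.

Lemma mfunvN D u : mfunv D u -> mfunv D (fun t => - u t).
Proof.
move=> mu i; rewrite [X in measurable_fun _ X](_ : _ = fun t => - u t ord0 i).
  by apply: measurableT_comp.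
by apply/funext => t; rewrite mxE.
Qed.

Lemma mfunvB D u v : mfunv D u -> mfunv D v -> mfunv D (fun t => u t - v t).
Proof. by move=> mu mv; apply: mfunvD => //; exact: mfunvN. Qed.

Lemma mfunv_cst D (x : V) : mfunv D (fun=> x).
Proof. by move=> i; exact: measurable_cst. Qed.

Lemma mfunv_sub D D' v : measurable D -> D' `<=` D -> mfunv D v -> mfunv D' v.
Proof. by move=> mD DD mv i; exact: measurable_funS (mv i). Qed.

Lemma measurable_norm D v : measurable D -> mfunv D v ->
  measurable_fun D (fun t : TR => `|v t| : R).
Proof.
move=> mD mv.
rewrite (_ : (fun t : TR => `|v t| : R) =
  (fun t => \big[Num.max/0]_(i < n) `|v t ord0 i|)).
  elim: (index_enum 'I_n) => [|i s IH].
    by under eq_fun do rewrite big_nil; exact: measurable_cst.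
  under eq_fun do rewrite big_cons.
  by apply: measurable_maxr => //; exact: measurableT_comp.
apply/funext => t; apply/eqP; rewrite eq_le; apply/andP; split.
  apply: rv_norm_le => [|i]; first by apply: bigmax_ge_id.
  exact: (le_bigmax _ (fun i => `|v t ord0 i|) i).
by apply: bigmax_le => // i _; exact: coord_le.
Qed.

Lemma measurable_norm_lt D v c : measurable D -> mfunv D v ->
  measurable (D `&` [set t | `|v t| < c]).
Proof.
move=> mD mv; have := measurable_norm mD mv mD (measurable_itv `]-oo, c[).
by congr measurable; apply/seteqP; split => t /=; rewrite in_itv/=.
Qed.

Lemma mfunv_cvg D (v_ : nat -> R -> V) v (c : R -> R) : measurable D ->
  (forall k, mfunv D (v_ k)) ->
  (forall t k, D t -> `|v_ k t - v t| <= c t * 2^-1 ^+ k) -> mfunv D v.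
Proof.
move=> mD mv_ vc i.
apply: (@measurable_fun_cvg _ _ _ D (fun k t => v_ k t ord0 i)) => [k|t Dt].
  exact: mv_.
apply/cvgrPdist_le => e e0; have [N NP] := halfX_small (c t) e0.
exists N => // k /= /NP h.
rewrite distrC; have := coord_le (v_ k t - v t) i; rewrite !mxE => h'.
exact: (le_trans h' (le_trans (vc t k Dt) (ltW h))).
Qed.

Definition rat_ball i k : set V := [set z | `|z - rat_point i| < 2^-1 ^+ k].

Lemma rat_ball_open i k : open (rat_ball i k).
Proof.
rewrite (_ : rat_ball i k = ball (rat_point i) (2^-1 ^+ k)); first exact: ball_open.
by apply/seteqP; split => z; rewrite -ball_normE /= distrC.
Qed.

(** The bound [K] serves where the ball must also be small relative to a margin, as in
    [mmulti_cut]. *)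
Lemma open_rat_ball_ge K (O : set V) z : open O -> O z ->
  exists i k, [/\ (K <= k)%N, rat_ball i k z & rat_ball i k `<=` O].
Proof.
move=> oO Oz; have /nbhs_ballP[r /= r0 rO] : nbhs z O by exact: open_nbhs_nbhs.
have [k0 k0r] := halfX_small 2 r0; pose k := maxn k0 K.
have kr : 2 * 2^-1 ^+ k < r by apply: k0r; exact: leq_maxl.
have [i zi] := rat_point_dense z (halfX_gt0 k).
exists i, k; split=> [|//|y yi]; first exact: leq_maxr.
apply: rO; rewrite -ball_normE /=.
rewrite -(subrKA (rat_point i)) (le_lt_trans (ler_normD _ _))//.
by move: yi; rewrite /rat_ball /= distrC; lra.
Qed.

Lemma open_rat_ball (O : set V) z : open O -> O z ->
  exists i k, rat_ball i k z /\ rat_ball i k `<=` O.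
Proof.
by move=> oO Oz; have [i [k [_ ? ?]]] := open_rat_ball_ge 0 oO Oz; exists i, k.
Qed.

Lemma rat_ball_ex z k : exists i, rat_ball i k z.
Proof. exact: rat_point_dense (halfX_gt0 k). Qed.

Lemma mfunv_open D v (O : set V) : measurable D -> mfunv D v -> open O ->
  measurable (D `&` [set t | O (v t)]).
Proof.
move=> mD mv oO.
rewrite (_ : _ `&` _ = \bigcup_(p in [set p : nat * nat | rat_ball p.1 p.2 `<=` O])
    (D `&` [set t | `|v t - rat_point p.1| < 2^-1 ^+ p.2])).
  rewrite bigcup_mkcond; apply: countable_bigcupT_measurable => // p.
  case: ifP => // _; apply: measurable_norm_lt => //.
  by apply: mfunvB => //; exact: mfunv_cst.
apply/seteqP; split=> [t [Dt /= Ot]|t [p pO [Dt /= h]]]; last first.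
  by split=> //; exact: pO.
by have [i [k [zik ikO]]] := open_rat_ball oO Ot; exists (i, k).
Qed.

(* Kuratowski--Ryll-Nardzewski: successive approximations by rational points. *)
Lemma measurable_selection D (H : R -> set V) : measurable D ->
  (forall t, D t -> H t !=set0) ->
  (forall O : set V, open O -> measurable (D `&` [set t | H t `&` O !=set0])) ->
  exists2 u : R -> V, mfunv D u & forall t, D t -> closure (H t) (u t).
Proof.
move=> mD H0 mH.
pose P0 t i := H t `&` rat_ball i 0 !=set0.
pose PS (k j : nat) t i := H t `&` (rat_ball i k.+1 `&` rat_ball j k) !=set0.
(* The next centre is the first one whose ball of half the radius meets [H t] inside the previous
   ball, so consecutive centres are closer than the sum of the radii. *)
pose idx := fix idx k t := if k is k'.+1 then least (PS k' (idx k' t) t) else least (P0 t).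
have P0e t : D t -> exists i, P0 t i.
  by move=> /H0[z Hz]; have [i zi] := rat_ball_ex z 0; exists i, z.
have inv k t : D t -> H t `&` rat_ball (idx k t) k !=set0.
  move=> Dt; elim: k => [|k [z [Hz zk]]] /=.
    by have [i /leastP[]] := P0e t Dt.
  have [i zi] := rat_ball_ex z k.+1.
  have /leastP[] : PS k (idx k t) t i by exists z; split.
  by move=> [y [Hy [yk _]]] _; exists y.
have near_idx k t : D t -> `|rat_point (idx k.+1 t) - rat_point (idx k t) : V| <= 2 * 2^-1 ^+ k.
  move=> Dt; have [z [Hz zk]] := inv k t Dt.
  have [i zi] := rat_ball_ex z k.+1.
  have /leastP[] : PS k (idx k t) t i by exists z; split.
  rewrite -/(idx k.+1 t) => -[y [Hy []]]; rewrite /rat_ball /= => y1 y2 _.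
  apply: (le_trans (ler_distD y _ _)); rewrite [`|_ - y|]distrC.
  have : 2^-1 ^+ k.+1 <= 2^-1 ^+ k :> R.
    by rewrite exprS ger_pMl ?halfX_gt0// invf_le1// ler1n.
  by move=> h; rewrite (le_trans (lerD (ltW y1) (ltW y2)))// mulr_natl mulr2n lerD2r.
have midx k : countable_index D (idx k).
  elim: k => [|k IH] /=.
    by apply: countable_index_least => // i; apply: mH; exact: rat_ball_open.
  apply: countable_index_least => // [t Dt|i].
    have [z [Hz zk]] := inv k t Dt; have [i zi] := rat_ball_ex z k.+1.
    by exists i, z; split.
  apply: (@countable_index_setI _ _ (fun j => [set t | PS k j t i])) => // j.
  by apply: mH; apply: openI; exact: rat_ball_open.
have lim t : exists l : V, D t -> forall k, `|rat_point (idx k t) - l| <= 4 * 2^-1 ^+ k.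
  have [Dt|nDt] := pselect (D t); last by exists 0.
  have [l lP] := geometric_cvg (fun k => near_idx k t Dt).
  by exists l => _ k; apply: (le_trans (lP k)); rewrite -natrM.
have [u uP] := choice lim.
exists u.
  apply: (@mfunv_cvg D (fun k t => rat_point (idx k t)) u (fun=> 4)) => //.
    move=> k; apply: (@mfunv_index D (idx k) (fun i t => rat_point i)) => // i.
    exact: mfunv_cst.
  by move=> t k Dt; exact: uP.
move=> t Dt O /nbhs_ballP[e /= e0 eO].
have [k /(_ k (leqnn k)) ke] := halfX_small 5 e0.
have [z [Hz zk]] := inv k t Dt; exists z; split=> //; apply: eO.
rewrite -ball_normE /= -(subrKA (rat_point (idx k t))) (le_lt_trans (ler_normD _ _))//.
by have := uP t Dt k; move: zk; rewrite /rat_ball/= distrC [`|u t - _|]distrC; lra.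
Qed.

End VectorMeasurability.

(** * Selections subject to a scalar inequality *)

Section Selections.
Context {R : realType} {n : nat}.
Local Notation V := 'rV[R]_n.
Local Notation TR := (measurableTypeR R).
Implicit Types (D : set TR) (G : R -> set V) (u v w : R -> V).

Definition mmulti D G := forall O : set V, open O ->
  measurable (D `&` [set t | G t `&` O !=set0]).

(** If [f] is below -L r at the centre of a ball of radius r, it is negative on the whole ball; by
    strictness, every point where [f] is negative lies in such a rational ball. So [G t] has only to
    meet the ball and [f] is tested at the centre, over countably many balls. *)
Lemma mmulti_cut D G (f : R -> V -> R) (L : R) : 0 <= L -> measurable D ->
  (forall t z z', f t z' <= f t z + L * `|z' - z|) ->
  (forall z, measurable_fun D (fun t : TR => f t z : R)) ->
  mmulti D G -> mmulti D (fun t => G t `&` [set z | f t z < 0]).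
Proof.
move=> L0 mD fL mf mG O oO.
pose A (p : nat * nat) := (D `&` [set t | G t `&` rat_ball p.1 p.2 !=set0]) `&`
  (D `&` [set t | f t (rat_point p.1) < - (L * 2^-1 ^+ p.2)]).
rewrite (_ : _ `&` _ =
  \bigcup_(p in [set p : nat * nat | @rat_ball R n p.1 p.2 `<=` O]) A p).
  rewrite bigcup_mkcond; apply: countable_bigcupT_measurable => // p.
  case: ifP => // _; apply: measurableI; first by apply: mG; exact: rat_ball_open.
  have := mf (rat_point p.1) mD _ (measurable_itv `]-oo, (- (L * 2^-1 ^+ p.2))[).
  by congr measurable; apply/seteqP; split => t /=; rewrite in_itv/=.
apply/seteqP; split=> [t [Dt [z [[Gz /= fz] Oz]]]|t [p pO [[Dt [z [Gz zp]]] [_ /= h]]]].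
  have fz' : 0 < - f t z by rewrite oppr_gt0.
  have [K KP] := halfX_small (2 * L) fz'.
  have [i [k [/KP Kk zk kO]]] := open_rat_ball_ge K oO Oz.
  exists (i, k) => //; split; split => //=; first by exists z.
  have := fL t z (rat_point i); move: zk; rewrite /rat_ball /= distrC => zk h.
  have h2 : L * `|rat_point i - z| <= L * 2^-1 ^+ k by rewrite ler_wpM2l// ltW.
  by move: Kk; rewrite -mulrA; move: (f t z) (f _ _) (L * _) (L * _) h h2 => *; lra.
split=> //; exists z; split; last exact: pO.
split=> //=; apply: (le_lt_trans (fL t (rat_point p.1) z)).
rewrite -ltrBrDr sub0r (lt_le_trans h)// lerN2 ler_wpM2l// ltW//.
Qed.

(** The cut set need not be closed, so the selection lands in its closure, where the strict
    inequality becomes a weak one. *)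
Lemma selection_cut D G (f : R -> V -> R) (L : R) : 0 <= L -> measurable D ->
  (forall t z z', f t z' <= f t z + L * `|z' - z|) ->
  (forall z, measurable_fun D (fun t : TR => f t z : R)) ->
  mmulti D G -> (forall t, D t -> closed (G t)) ->
  (forall t, D t -> exists2 z, G t z & f t z < 0) ->
  exists2 u, mfunv D u & forall t, D t -> G t (u t) /\ f t (u t) <= 0.
Proof.
move=> L0 mD fL mf mG cG ex.
have [|u mu uP] := @measurable_selection R n D _ mD _ (mmulti_cut L0 mD fL mf mG).
  by move=> t /ex[z Gz fz]; exists z.
exists u => // t Dt; have := uP t Dt => /closureI[].
rewrite -(closure_id _).1; last exact: cG.
move=> Gu fu; split=> //; apply/ler_addgt0Pr => e e0.
have d0 : 0 < e / (L + 1) by rewrite divr_gt0// ltr_wpDl.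
have [z [/= fz]] := fu _ (nbhsx_ballx (u t) _ d0).
rewrite -ball_normE /= => uz; apply: (le_trans (fL t z (u t))); rewrite lerD ?ltW//.
apply: (@le_lt_trans _ _ ((L + 1) * `|u t - z|)).
  by rewrite ler_wpM2r// lerDl.
by rewrite mulrC -ltr_pdivlMr// ltr_wpDl.
Qed.

Lemma selection_near D G w (r : R -> R) : measurable D -> mfunv D w ->
  measurable_fun D (r : TR -> R) -> mmulti D G -> (forall t, D t -> closed (G t)) ->
  (forall t, D t -> exists2 z, G t z & `|z - w t| < r t) ->
  exists2 u, mfunv D u & forall t, D t -> G t (u t) /\ `|u t - w t| <= r t.
Proof.
move=> mD mw mr mG cG ex.
have [|t z z'|z|//|//|t Dt|u mu uP] :=
  @selection_cut D G (fun t z => `|z - w t| - r t) 1 _ mD.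
- exact: ler01.
- have := ler_distD z z' (w t); lra.
- apply: measurable_funB => //; apply: measurable_norm => //.
  by apply: mfunvB => //; exact: mfunv_cst.
- by have [z Gz zw] := ex t Dt; exists z => //; rewrite subr_lt0.
- by exists u => // t /uP; rewrite subr_le0.
Qed.

Definition dot (e z : V) : R := \sum_(i < n) e ord0 i * z ord0 i.

Lemma dotD e x y : dot e (x + y) = dot e x + dot e y.
Proof. by rewrite /dot -big_split/=; apply: eq_bigr => i _; rewrite mxE mulrDr. Qed.

Lemma dotZ e c x : dot e (c *: x) = c * dot e x.
Proof. by rewrite /dot mulr_sumr; apply: eq_bigr => i _; rewrite mxE mulrCA. Qed.

Lemma dotN e x : dot e (- x) = - dot e x.
Proof. by rewrite -scaleN1r dotZ mulN1r. Qed.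

Lemma dotC x y : dot x y = dot y x.
Proof. by apply: eq_bigr => i _; rewrite mulrC. Qed.

Lemma dot_norm e x : `|dot e x| <= (\sum_(i < n) `|e ord0 i|) * `|x|.
Proof.
rewrite mulr_suml (le_trans (ler_norm_sum _ _ _))//; apply: ler_sum => i _.
by rewrite normrM ler_wpM2l// coord_le.
Qed.

(** The infimum is measurable because it lies below [c] exactly when [G t] meets an open half-space;
    the margin [s] makes the cut nonempty. *)
Lemma selection_argmin D G e s : 0 < s -> measurable D -> mmulti D G ->
  (forall t, D t -> closed (G t)) -> (forall t, D t -> G t !=set0) ->
  (forall t, D t -> exists M, forall z, G t z -> `|z| <= M) ->
  exists2 u, mfunv D u & forall t, D t -> G t (u t) /\
    forall z, G t z -> dot e (u t) <= dot e z + s.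
Proof.
move=> s0 mD mG cG G0 bG.
have [L L0 eL] : exists2 L : R, 0 <= L & forall x, `|dot e x| <= L * `|x|.
  by exists (\sum_(i < n) `|e ord0 i|); [exact: sumr_ge0|exact: dot_norm].
pose theta t := inf [set dot e z | z in G t].
have dL z z' : dot e z' <= dot e z + L * `|z' - z|.
  rewrite -lerBlDl -dotN -dotD; exact: le_trans (ler_norm _) (eL _).
have infG t : D t -> has_inf [set dot e z | z in G t].
  move=> Dt; have [z Gz] := G0 t Dt; have [M bM] := bG t Dt; split.
    by exists (dot e z), z.
  exists (- (L * M)) => _ [y Gy <-].
  rewrite lerNl (le_trans _ (ler_wpM2l L0 (bM y Gy)))//.
  by rewrite (le_trans _ (eL y))// -normrN ler_norm.
have mtheta : measurable_fun D (theta : TR -> R).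
  apply: (measurability _ (RGenInftyO.measurableE R)) => _ [_ [c ->] <-].
  have oc : open [set z | dot e z < c].
    move=> z /= zc; apply/nbhs_ballP; exists ((c - dot e z) / (L + 1)) => /=.
      by rewrite divr_gt0 ?subr_gt0// ltr_wpDl.
    move=> y; rewrite -ball_normE /= distrC => h.
    have h2 : `|y - z| * (L + 1) < c - dot e z by rewrite -ltr_pdivlMr// ltr_wpDl.
    apply: (le_lt_trans (dL z y)); have : 0 <= `|y - z| by [].
    by move: h2; rewrite mulrDr mulr1 mulrC; lra.
  have := mG _ oc; congr measurable; apply/seteqP; split => t [Dt] /=.
    move=> [z [Gz zc]]; split=> //; rewrite in_itv/= (le_lt_trans _ zc)//.
    by apply: (ge_inf (infG t Dt).2); exists z.
  rewrite in_itv/= -subr_gt0 => h.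
  have [_ [z Gz <-] zc] := inf_adherent h (infG t Dt).
  by split=> //; exists z; split=> //=; rewrite -(subrKC (theta t) c).
have [|t z z'|z|//|//|t Dt|u mu uP] :=
  @selection_cut D G (fun t z => dot e z - (theta t + s)) L _ mD.
- exact: L0.
- have := dL z z'; lra.
- by apply: measurable_funB => //; exact: measurable_funD.
- have [_ [z Gz <-] zc] := inf_adherent s0 (infG t Dt); exists z => //.
  by rewrite subr_lt0.
- exists u => // t Dt; have [Gu] := uP t Dt; rewrite subr_le0 => h; split=> // z Gz.
  apply: (le_trans h); rewrite lerD2r; apply: (ge_inf (infG t Dt).2).
  by exists z.
Qed.

End Selections.

(** * Filippov's iteration with an abstract integral operator *)

Section Picard.
Context {R : realType} {n : nat}.
Local Notation V := 'rV[R]_n.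
Local Notation TR := (measurableTypeR R).
Implicit Types (D : set TR) (u v w y : R -> V) (I : (R -> R) -> R -> R).

(** Superposition measurability replaces joint measurability: it survives restriction of the times
    and truncation of the state. *)
Definition mmap D (G : R -> V -> set V) :=
  forall y, mfunv D y -> mmulti D (fun t => G t (y t)).

Definition lipschitz_map D (G : R -> V -> set V) (kap : R -> R) :=
  forall t xi eta z, D t -> G t xi z ->
    exists2 z', G t eta z' & `|z - z'| <= kap t * `|xi - eta|.

Definition admissible D (g : R -> R) (u : R -> R) :=
  measurable_fun D (u : TR -> R) /\ exists c, forall t, D t -> `|u t| <= c * g t.

Definition rowop I u t : V := \row_i I (fun s => u s ord0 i) t.

(** [I] maps errors of size g to errors rho / 4, and the Lipschitz bound returns kap rho = g. An
    increment 2 * 2^-m g thus leaves a defect 2^-(m+1) g, and the next selection removes it with an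
    increment at most twice as large. *)
Lemma filippov_picard D (G : R -> V -> set V) (kap rho : R -> R) I w y0 :
  measurable D -> measurable_fun D (kap : TR -> R) -> measurable_fun D (rho : TR -> R) ->
  (forall t, D t -> 0 < kap t) -> (forall t, D t -> 0 < rho t) ->
  mmap D G -> (forall t xi, D t -> closed (G t xi)) -> lipschitz_map D G kap ->
  let g := fun t => kap t * rho t in
  (forall u : R -> R, admissible D g u -> measurable_fun D (I u : TR -> R)) ->
  (forall t, D t -> I (fun=> 0) t = 0) ->
  (forall (u v : R -> R) c, admissible D g u -> admissible D g v ->
    (forall t, D t -> `|u t - v t| <= c * g t) ->
    forall t, D t -> `|I u t - I v t| <= c / 4 * rho t) ->
  mfunv D w -> mfunv D y0 ->
  (forall t, D t -> exists2 z, G t (y0 t) z & `|z - w t| <= g t) ->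
  exists u, [/\ mfunv D u, forall t, D t -> `|u t| <= 4 * g t,
    forall t, D t -> G t (y0 t + rowop I u t) (w t + u t) &
    forall t, D t -> `|rowop I u t| <= rho t].
Proof.
move=> mD mkap mrho kap0 rho0 mG cG lG g mI I0 cI mw my0 w0.
have g0 t : D t -> 0 < g t by move=> Dt; rewrite mulr_gt0 ?kap0 ?rho0.
have mg : measurable_fun D (g : TR -> R) by exact: measurable_funM.
have adm u c i : mfunv D u -> (forall t, D t -> `|u t| <= c * g t) ->
    admissible D g (fun s => u s ord0 i).
  move=> mu uc; split; first exact: mu.
  by exists c => t /uc; exact: le_trans (coord_le _ _).
have mrow u c : mfunv D u -> (forall t, D t -> `|u t| <= c * g t) -> mfunv D (rowop I u).
  move=> mu uc i; rewrite [X in measurable_fun _ X](_ : _ = I (fun s => u s ord0 i)).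
    by apply: mI; exact: adm uc.
  by apply/funext => t; rewrite mxE.
have crow u v c1 c2 c : 0 <= c -> mfunv D u -> mfunv D v ->
    (forall t, D t -> `|u t| <= c1 * g t) -> (forall t, D t -> `|v t| <= c2 * g t) ->
    (forall t, D t -> `|u t - v t| <= c * g t) ->
    forall t, D t -> `|rowop I u t - rowop I v t| <= c / 4 * rho t.
  move=> c0 mu mv uc1 vc2 uvc t Dt; apply: rv_norm_le => [|i].
    by rewrite mulr_ge0 ?divr_ge0// ltW// rho0.
  rewrite !mxE; apply: cI => // [||s Ds]; [exact: adm uc1|exact: adm vc2|].
  have := coord_le (u s - v s) i; rewrite !mxE => /le_trans; apply.
  exact: uvc.
(* 4 (1 - 2^-m) is the partial sum of the increments 2 * 2^-j; the last clause is the defect of the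
   current velocity. *)
pose Q (m : nat) u := [/\ mfunv D u,
  forall t, D t -> `|u t| <= 4 * (1 - 2^-1 ^+ m) * g t &
  forall t, D t -> exists2 z, G t (y0 t + rowop I u t) z &
    `|z - (w t + u t)| <= 2^-1 ^+ m * g t].
pose rel (m : nat) u u' := forall t, D t ->
  G t (y0 t + rowop I u t) (w t + u' t) /\ `|u' t - u t| <= 2 * 2^-1 ^+ m * g t.
have h1 m : 1 - 2^-1 ^+ m <= 1 :> R by rewrite gerBl ltW// halfX_gt0.
(* Stated for all pairs, with a dummy value where [Q] fails, so that the iterates can be defined by
   choice before [Q] is known for them. *)
have step (p : nat * (R -> V)) : exists u', Q p.1 p.2 -> Q p.1.+1 u' /\ rel p.1 p.2 u'.
  case: p => m u /=; have [|nQ] := pselect (Q m u); last by exists u.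
  move=> [mu ub uz].
  have mwu : mfunv D (fun t => w t + u t) by exact: mfunvD.
  have [|||t Dt|v mv vP] := @selection_near R n D (fun t => G t (y0 t + rowop I u t))
      (fun t => w t + u t) (fun t => 2 * (2^-1 ^+ m * g t)) mD mwu.
  - by do 2 apply: measurable_funM => //.
  - by apply: mG; apply: mfunvD => //; exact: mrow ub.
  - by move=> t Dt; exact: cG.
  - have [z Gz zw] := uz t Dt; exists z => //; apply: (le_lt_trans zw).
    by rewrite ltr_pMl ?ltr1n// mulr_gt0 ?halfX_gt0 ?g0.
  exists (fun t => v t - w t) => _.
  have mvw : mfunv D (fun t => v t - w t) by exact: mfunvB.
  have vwu t : D t -> `|v t - w t - u t| <= 2 * 2^-1 ^+ m * g t.
    by move=> /vP[_]; rewrite opprD addrA mulrA.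
  have vwb t : D t -> `|v t - w t| <= 4 * (1 - 2^-1 ^+ m.+1) * g t.
    move=> Dt; rewrite -(subrK (u t) (v t - w t)) (le_trans (ler_normD _ _))//.
    rewrite (le_trans (lerD (vwu t Dt) (ub t Dt)))// -mulrDl exprS.
    rewrite ler_pM2r ?g0//; move: (_ ^+ m) => r; lra.
  split; last first.
    move=> t Dt; rewrite /= subrKC; split; first by have [] := vP t Dt.
    exact: vwu.
  split => // t Dt; have [Gv _] := vP t Dt.
  have [z Gz zv] := lG t _ (y0 t + rowop I (fun t => v t - w t) t) _ Dt Gv.
  exists z => //; rewrite subrKC distrC (le_trans zv)//.
  have := @crow u (fun t => v t - w t) _ _ (2 * 2^-1 ^+ m) _ mu mvw ub vwb _ t Dt.
  rewrite opprD addrACA subrr add0r => h.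
  rewrite /g mulrCA ler_pM2l ?kap0//; apply: (le_trans (h _ _)).
  - by rewrite mulr_ge0// ltW// halfX_gt0.
  - by move=> s Ds; rewrite distrC; exact: vwu.
  - rewrite exprS ler_pM2r ?rho0//; move: (_ ^+ m) => r; lra.
have [f fP] := choice step.
pose us := fix us m := if m is m'.+1 then f (m', us m') else (fun=> 0 : V).
have rowop0 t : D t -> rowop I (fun=> 0) t = 0.
  move=> Dt; apply/rowP => i; rewrite !mxE -[RHS](I0 t Dt); congr (I _ t);
  by apply/funext => s; rewrite mxE.
have usQ m : Q m (us m).
  elim: m => [|m /(fP (m, us m))[]//]; split => /= [|t Dt|t Dt].
  - exact: mfunv_cst.
  - by rewrite normr0 expr0 subrr mulr0 mul0r.
  - by rewrite rowop0// !addr0 expr0 mul1r; exact: w0.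
have usR m : rel m (us m) (us m.+1) by have [] := fP (m, us m) (usQ m).
have lim t : exists l : V, D t -> forall k, `|us k t - l| <= 4 * g t * 2^-1 ^+ k.
  have [Dt|nDt] := pselect (D t); last by exists 0.
  have [|l lP] := @geometric_cvg R n (fun k => us k t) (2 * g t).
    by move=> k; have [_] := usR k t Dt; rewrite mulrAC.
  by exists l => _ k; apply: (le_trans (lP k)); rewrite !mulrA -natrM.
have [u uP] := choice lim.
have mus m : mfunv D (us m) by case: (usQ m).
have mu : mfunv D u by apply: (@mfunv_cvg R n D us u (fun t => 4 * g t)) => // t k Dt; exact: uP.
have usb m t : D t -> `|us m t| <= 4 * g t.
  case: (usQ m) => _ h _ Dt; apply: (le_trans (h t Dt)).
  by rewrite ler_pM2r ?g0// ler_piMr.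
have ub t : D t -> `|u t| <= 4 * g t.
  move=> Dt; have := uP t Dt; case: (usQ 0%N) => _ _ _ h.
  apply/ler_addgt0Pr => e e0; have [k /(_ k (leqnn k)) ke] := halfX_small (4 * g t) e0.
  rewrite -(subKr (us k t) (u t)) (le_trans (ler_normB _ _))// lerD ?usb//.
  exact: le_trans (h k) (ltW ke).
have rowb t : D t -> `|rowop I u t| <= rho t.
  move=> Dt; have := @crow u (fun=> 0) 4 0 4 _ mu _ ub _ _ t Dt.
  rewrite rowop0// subr0 mulfV ?pnatr_eq0// mul1r; apply => //.
  - by move=> s Ds; rewrite normr0 mul0r.
  - by move=> s Ds; rewrite subr0 ub.
exists u; split => // t Dt.
(* The velocity of the next iterate belongs to the value of [G] at the current state; the Lipschitz
   bound moves it into the value at the limit state, which is closed. *)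
apply: (cG t (y0 t + rowop I u t) Dt).
move=> O /nbhs_ballP[e /= e0 eO].
have [k /(_ k (leqnn k)) ke] := halfX_small (8 * g t) e0.
have [Gk _] := usR k t Dt.
have [z Gz zk] := lG t _ (y0 t + rowop I u t) _ Dt Gk.
exists z; split => //; apply: eO; rewrite -ball_normE /=.
apply: le_lt_trans ke; rewrite -(subrKA (w t + us k.+1 t)) (le_trans (ler_normD _ _))//.
have c2 : `|w t + u t - (w t + us k.+1 t)| <= 4 * g t * 2^-1 ^+ k.
  rewrite opprD addrACA subrr add0r distrC (le_trans (uP t Dt k.+1))//.
  rewrite exprS mulrA ler_pM2r ?halfX_gt0// -[leRHS]mulr1 ler_pM2l; last by rewrite mulr_gt0 ?g0.
  by rewrite invf_le1// ler1n.
have c1 : `|w t + us k.+1 t - z| <= g t * 2^-1 ^+ k.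
  apply: (le_trans zk); rewrite opprD addrACA subrr add0r /g -mulrA ler_pM2l; last exact: kap0.
  have := @crow (us k) u 4 4 (4 * 2^-1 ^+ k) _ (mus k) mu (usb k) ub _ t Dt.
  rewrite [4 * _ ^+ k]mulrC mulfK ?pnatr_eq0// [rho t * _]mulrC; apply.
    by rewrite mulr_ge0// ltW// halfX_gt0.
  by move=> s Ds; rewrite -mulrA [leRHS]mulrC; exact: uP.
have p1 := mulr_gt0 (g0 t Dt) (@halfX_gt0 R k).
apply: (le_trans (lerD c2 c1)); have -> : 8 * g t = 4 * g t + 4 * g t by rewrite -mulrDl -natrD.
by rewrite -mulrDl ler_pM2r ?halfX_gt0// lerD2l ler_peMl ?ler1n// ltW ?g0.
Qed.

End Picard.

(** * Increments of absolutely continuous functions *)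

Section Increments.
Context {R : realType}.
Notation mu := (@lebesgue_measure R).
Implicit Types (a b c : R) (f h phi : R -> R).

Lemma int_increment a b f u v : integ a b f -> a <= u -> u <= v -> v <= b ->
  int a v f - int a u f = int u v f.
Proof.
move=> fi au uv vb; rewrite (@int_chasles _ a v u)//; first by rewrite addrAC subrr add0r.
exact: integ_sub fi.
Qed.

Lemma integ_point a b f u : integ a b f -> a <= u -> u <= b -> integ a u f.
Proof. by move=> fi au ub; exact: integ_sub fi. Qed.

Lemma int_ac_norm a b f : integ a b f ->
  ac_on a b (fun u v => `|int a v f - int a u f|).
Proof.
move=> fi; have := @int_ac R a b (fun t => `|f t|) (fun _ _ => normr_ge0 _) (integ_norm fi).
apply: (@ac_on_le _ _ _ _ _ 1) => // u v au uv vb; rewrite mul1r (int_increment fi)//.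
have fi' : integ u v f by exact: integ_sub fi.
by apply: int_norm => //; exact: integ_norm.
Qed.

(* The one-sided fundamental theorem of calculus for absolutely continuous
   functions; all integral estimates along solutions come from it. *)
Lemma ac_int_le a b phi h : a <= b ->
  ac_on a b (fun u v => `|phi v - phi u|) -> integ a b h ->
  {ae mu, forall t : R, a < t < b -> derivable phi t 1 /\ h t <= 'D_1 phi t} ->
  int a b h <= phi b - phi a.
Proof.
move=> ab acp ih dphi.
suff : int a b h - phi b <= int a a h - phi a by rewrite intaa; lra.
apply: (@ac_on_nonincreasing R a b (fun t => int a t h - phi t)) => //.
  have := ac_onD (int_ac_norm ih) acp.
  apply: (@ac_on_le _ _ _ _ _ 1) => // u v _ _ _; rewrite mul1r.
  rewrite opprB addrACA addrC -opprB addrC [X in `|X| <= _](_ : _ =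
    (int a v h - int a u h) - (phi v - phi u)) ?ler_normB//.
  by lra.
apply: ae_imp (ae_and dphi (int_ftc ih)) => t [+ +] tab.
move=> /(_ tab)[dp hp] /(_ tab)[di Di].
split; first exact: derivableB.
by rewrite deriveB// Di subr_le0.
Qed.

End Increments.

(** * Increments and primitives of vector functions *)

Section VectorIncrements.
Context {R : realType} {n : nat}.
Notation mu := (@lebesgue_measure R).
Local Notation V := 'rV[R]_n.
Implicit Types (a b c : R) (v w x y : R -> V) (kap : R -> R).

Lemma abs_continuous_dot a b x (e : V) : abs_continuous a b x ->
  ac_on a b (fun u v : R => `|dot e (x v) - dot e (x u)|).
Proof.
move=> acx.
apply: (@ac_on_le _ _ _ _ (fun u v : R => enorm (x v - x u)) (\sum_(i < n) `|e ord0 i|) _ _ acx).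
  exact: sumr_ge0.
move=> u v _ _ _; rewrite -dotN -dotD (le_trans (dot_norm _ _))//.
by rewrite ler_wpM2l ?le_enorm// sumr_ge0.
Qed.

Lemma dot_delta (i : 'I_n) (z : V) : dot (delta_mx ord0 i) z = z ord0 i.
Proof.
rewrite /dot (bigD1 i)//= mxE !eqxx mul1r big1 ?addr0// => j ji.
by rewrite mxE (negPf ji) andbF mul0r.
Qed.

Lemma abs_continuous_coord a b x i : abs_continuous a b x ->
  ac_on a b (fun u v : R => `|x v ord0 i - x u ord0 i|).
Proof.
move=> /(abs_continuous_dot (delta_mx ord0 i)).
by apply: (@ac_on_le _ _ _ _ _ 1) => // u v _ _ _; rewrite !dot_delta mul1r.
Qed.

Lemma abs_continuous_le a b x (D : R -> R -> R) :
  (forall u v : R, a <= u -> u <= v -> v <= b -> `|x v - x u| <= D u v) ->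
  ac_on a b D -> abs_continuous a b x.
Proof.
move=> xD acD; apply: (@ac_on_le _ _ _ (fun u v : R => enorm (x v - x u)) _ n%:R _ _ acD) => //.
move=> u v au uv vb; apply: (le_trans (enorm_le _)).
by rewrite ler_wpM2l// xD.
Qed.

Lemma is_derive_dot (e : V) x t : derivable x t 1 ->
  derivable (fun s => dot e (x s)) t 1 /\
  'D_1 (fun s => dot e (x s)) t = dot e ('D_1 x t).
Proof.
move=> dx; have dxi i : derivable (fun s => x s ord0 i) t 1.
  by have /derivable_mxP := dx; exact.
have dexi i : derivable (fun s => e ord0 i * x s ord0 i) t 1 by exact: derivableM.
have E : (fun s => dot e (x s)) = \sum_(i < n) (fun s => e ord0 i * x s ord0 i).
  by apply/funext => s; rewrite fct_sumE.
rewrite E; split; first exact: derivable_sum.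
rewrite derive_sum//; apply: eq_bigr => i _.
rewrite deriveM// derive_cst scaler0 addr0 derive_mx// mxE.
by [].
Qed.

(** The scalar inequality is applied to the coordinate functionals with both signs; the zero
    functional shows that the integral of [kap] is nonnegative. *)
Lemma solution_increment a b x kap : a <= b -> abs_continuous a b x ->
  integ a b kap ->
  {ae mu, forall t : R, a < t < b -> derivable x t 1 /\ `|'D_1 x t| <= kap t} ->
  `|x b - x a| <= int a b kap.
Proof.
move=> ab acx ik dx.
have H (e : V) : (forall z, `|dot e z| <= `|z|) ->
    int a b (fun t => - kap t) <= dot e (x b) - dot e (x a).
  move=> e1; apply: (@ac_int_le R a b (fun t => dot e (x t))) => //.
  - exact: abs_continuous_dot.
  - by have := integZ (-1) ik; apply: eq_integ => t _; rewrite mulN1r.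
  apply: ae_imp dx => t + tab => /(_ tab)[dx xk].
  have [d ->] := is_derive_dot e dx; split => //.
  rewrite lerNl; apply: le_trans xk; apply: le_trans (e1 _).
  by rewrite -normrN ler_norm.
have intN : int a b (fun t => - kap t) = - int a b kap.
  by rewrite -mulN1r -intZ//; apply: eq_int => t _; rewrite mulN1r.
have d0 (z : V) : dot 0 z = 0 by rewrite /dot big1// => i _; rewrite mxE mul0r.
have ik0 : 0 <= int a b kap.
  have := H 0; rewrite intN !d0 subrr oppr_le0; apply => z.
  by rewrite d0 normr0.
apply: rv_norm_le => // i.
have d1 (z : V) : `|dot (delta_mx ord0 i) z| <= `|z| by rewrite dot_delta coord_le.
have dN (z : V) : dot (- delta_mx ord0 i) z = - dot (delta_mx ord0 i) z.
  by rewrite dotC dotN dotC.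
have h1 := H _ d1; have h2 : - int a b kap <= - x b ord0 i + x a ord0 i.
  have := H (- delta_mx ord0 i); rewrite intN !dN !dot_delta opprK; apply => z.
  by rewrite dN normrN.
by move: h1; rewrite intN !dot_delta !mxE ler_norml => h1; apply/andP; split; lra.
Qed.

Lemma derivable_add_cst (f : R -> V) (x0 : V) (t : R) : derivable f t 1 ->
  derivable (fun s => x0 + f s) t 1 /\ 'D_1 (fun s => x0 + f s) t = 'D_1 f t.
Proof.
move=> df; have dc : derivable (cst x0 : R -> V) t 1 by exact: derivable_cst.
have -> : (fun s => x0 + f s) = cst x0 + f by [].
by split; [exact: derivableD|rewrite deriveD// derive_cst add0r].
Qed.

Definition vint a t v : V := \row_i int a t (fun s => v s ord0 i).

Lemma vint_integ a b v kap i : mfunv `[a, b] v ->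
  (forall t, a <= t <= b -> `|v t| <= kap t) -> integ a b kap ->
  integ a b (fun s => v s ord0 i).
Proof.
move=> mv vk; apply: (@integ_le _ _ _ _ kap) => [|t tab]; first exact: mv.
exact: (le_trans (coord_le _ _) (vk t tab)).
Qed.

Lemma vint_le a b v kap : mfunv `[a, b] v ->
  (forall t, a <= t <= b -> `|v t| <= kap t) -> integ a b kap ->
  `|vint a b v| <= int a b kap.
Proof.
move=> mv vk ik; apply: rv_norm_le => [|i].
  by apply: int_ge0 => t /vk; apply: le_trans.
rewrite mxE; apply: int_norm => //; first exact: vint_integ ik.
move=> t tab; exact: (le_trans (coord_le _ _) (vk t tab)).
Qed.

Lemma vint_increment a b v kap s t : mfunv `[a, b] v ->
  (forall t, a <= t <= b -> `|v t| <= kap t) -> integ a b kap ->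
  a <= s -> s <= t -> t <= b -> vint a t v - vint a s v = vint s t v.
Proof.
move=> mv vk ik as_ st tb; apply/rowP => i; rewrite !mxE.
by apply: (@int_increment R a b) => //; exact: vint_integ ik.
Qed.

Lemma vint_increment_le a b v kap s t : mfunv `[a, b] v ->
  (forall t, a <= t <= b -> `|v t| <= kap t) -> integ a b kap ->
  a <= s -> s <= t -> t <= b -> `|vint a t v - vint a s v| <= int s t kap.
Proof.
move=> mv vk ik as_ st tb; rewrite (vint_increment mv vk ik)//.
apply: vint_le => [i|r /andP[sr rt]|].
- apply: measurable_funS (mv i) => //.
  by apply: subset_itv; rewrite bnd_simp.
- by apply: vk; rewrite (le_trans as_ sr) (le_trans rt tb).
- exact: integ_sub ik.
Qed.

Lemma vint_ftc a b v kap (x0 : V) : mfunv `[a, b] v ->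
  (forall t, a <= t <= b -> `|v t| <= kap t) -> integ a b kap ->
  {ae mu, forall t : R, a < t < b -> derivable (fun t => x0 + vint a t v) t 1 /\
    'D_1 (fun t => x0 + vint a t v) t = v t}.
Proof.
move=> mv vk ik.
have : {ae mu, forall t : R, forall i, a < t < b ->
    derivable (fun y : R => int a y (fun s => v s ord0 i)) t 1 /\
    'D_1 (fun y : R => int a y (fun s => v s ord0 i)) t = v t ord0 i}.
  have ae_fin (I : finType) (P : I -> R -> Prop) : (forall i, {ae mu, forall t, P i t}) ->
      {ae mu, forall t, forall i, P i t}.
    move=> aeP; have : {ae mu, forall t, forall i, i \in enum I -> P i t}.
      elim: (enum I) => [|i s IH]; first exact: aeW.
      apply: ae_imp (ae_and (aeP i) IH) => t [Pi Ps] j.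
      by rewrite inE => /predU1P[->|/Ps].
    by apply: ae_imp => t H i; apply: H; rewrite mem_enum.
  by apply: ae_fin => i; apply: int_ftc; exact: vint_integ ik.
apply: ae_imp => t H tab.
have dv : derivable (fun t => vint a t v) t 1.
  apply/derivable_mxP => j i; rewrite (ord1 j).
  by under eq_fun do rewrite mxE; have [] := H i tab.
have Dv : 'D_1 (fun t => vint a t v) t = v t.
  rewrite derive_mx//; apply/rowP => i; rewrite !mxE.
  by under eq_fun do rewrite mxE; have [] := H i tab.
by have [d ->] := derivable_add_cst x0 dv.
Qed.

End VectorIncrements.

(** * The integral operator in Filippov's iteration *)

Section IntegralOperator.
Context {R : realType} {n : nat}.
Notation mu := (@lebesgue_measure R).
Local Notation V := 'rV[R]_n.
Local Notation TR := (measurableTypeR R).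
Implicit Types (D : set TR) (a b : R) (u v w y : R -> V).

(** The primitive of a nonnegative function is monotone, hence measurable, and f = (f + |f|) -
    |f|. *)
Lemma int_measurable_r a b (f : R -> R) : integ a b f ->
  measurable_fun (`[a, b]%classic : set TR) (fun t : TR => int a t f : R).
Proof.
move=> fi; have nfi := integ_norm fi.
have mono (h : R -> R) : integ a b h -> (forall t, 0 <= h t) ->
    measurable_fun (`[a, b]%classic : set TR) (fun t : TR => int a t h : R).
  move=> hi h0; have mm : measurable_fun (`[a, b]%classic : set TR)
      (fun t : TR => int a (Num.min t b) h : R).
    apply: nondecreasing_measurable => // s t st.
    have [as_|sa] := leP a (Num.min s b).
      rewrite -subr_ge0 (int_increment hi) ?int_ge0//; last by rewrite ge_min lexx orbT.
      by rewrite le_min !ge_min st lexx orbT.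
    rewrite [X in X <= _](_ : _ = 0) ?int_ge0// /int set_itv_ge ?Rintegral_set0//.
    by rewrite bnd_simp -ltNge.
  apply: eq_measurable_fun mm => t; rewrite inE/= in_itv/= => /andP[at_ tb].
  by rewrite (min_idPl tb).
have m1 := mono _ (integD fi nfi) _; have m2 := mono _ nfi (fun _ => normr_ge0 _).
have {}m1 : measurable_fun (`[a, b]%classic : set TR) (fun t : TR => int a t (f \+ (fun t => `|f t|)) : R).
  by apply: m1 => t /=; have := ler_norm (- f t); rewrite normrN; lra.
apply: eq_measurable_fun (measurable_funB m1 m2) => t; rewrite inE/= in_itv/= => /andP[at_ tb].
rewrite intD ?addrK//; [exact: integ_point fi _ _|exact: integ_point nfi _ _].
Qed.

Lemma int_measurable_l a b (f : R -> R) : integ a b f ->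
  measurable_fun (`[a, b]%classic : set TR) (fun t : TR => int t b f : R).
Proof.
move=> fi; have mc : measurable_fun (`[a, b]%classic : set TR) (fun=> int a b f : R).
  exact: measurable_cst.
apply: eq_measurable_fun (measurable_funB mc (int_measurable_r fi)) => t.
rewrite inE/= in_itv/= => /andP[at_ tb].
by rewrite (int_increment fi).
Qed.

Lemma measurable_patch D E (f : R -> R) : measurable D -> measurable E -> D `<=` E ->
  measurable_fun D (f : TR -> R) -> measurable_fun E (f \_ D : TR -> R).
Proof.
move=> mD mE DE mf; by apply/(measurable_restrict f mD mE); rewrite setIC (setIidl DE).
Qed.

(* [l] and [r] are [a, t] for a problem with initial value and [t, b] for one
   with terminal value, with [sg = 1] and [sg = -1] respectively. *)
Lemma picard_int D a b (G : R -> V -> set V) (kap rho l r : R -> R) (sg : R) w y0 :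
  measurable D -> D `<=` `[a, b] ->
  measurable_fun D (kap : TR -> R) -> measurable_fun D (rho : TR -> R) ->
  (forall t, D t -> 0 < kap t) -> (forall t, D t -> 0 < rho t) ->
  mmap D G -> (forall t xi, D t -> closed (G t xi)) -> lipschitz_map D G kap ->
  let g := fun t => kap t * rho t in
  (forall t, a <= t <= b -> 0 <= g t) -> integ a b g -> `|sg| = 1 ->
  (forall t, D t -> a <= l t /\ r t <= b) ->
  (forall f, integ a b f -> measurable_fun D (fun t : TR => int (l t) (r t) f : R)) ->
  (forall t, D t -> int (l t) (r t) g <= rho t / 4) ->
  mfunv D w -> mfunv D y0 ->
  (forall t, D t -> exists2 z, G t (y0 t) z & `|z - w t| <= g t) ->
  exists u, [/\ mfunv setT u, forall t, a <= t <= b -> `|u t| <= 4 * g t,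
    forall t, D t -> G t (y0 t + sg *: vint (l t) (r t) u) (w t + u t) &
    forall t, D t -> `|sg *: vint (l t) (r t) u| <= rho t].
Proof.
move=> mD Dab mkap mrho kap0 rho0 mG cG lG g g0 ig sg1 lr mint gle mw my0 w0.
(* Measurability is known only on [D], so the integrand is cut off outside it; the final [u] is
   likewise extended by 0. *)
pose I (f : R -> R) t := sg * int (l t) (r t) (f \_ D).
have pg c (f : R -> R) : (forall t, D t -> `|f t| <= c * g t) -> forall t, a <= t <= b ->
    `|(f \_ D) t| <= Num.max 0 c * g t.
  move=> fc t tab; rewrite patchE; case: ifPn => [/set_mem Dt|_].
    by rewrite (le_trans (fc t Dt))// ler_wpM2r ?g0// le_max lexx orbT.
  by rewrite normr0 mulr_ge0 ?g0// le_max lexx.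
have iadm f : admissible D g f -> integ a b (f \_ D).
  move=> [mf [c fc]]; apply: (@integ_le R a b _ (fun t => Num.max 0 c * g t)).
  - by apply: measurable_patch.
  - exact: pg.
  - exact: integZ.
have [||f1 f2 c a1 a2 f12 t Dt|u [mu ub uG uI]] := @filippov_picard R n D G kap rho I w y0
  mD mkap mrho kap0 rho0 mG cG lG _ _ _ mw my0 w0.
- move=> f af; apply: measurable_funM; first exact: measurable_cst.
  exact: mint (iadm _ af).
- move=> t Dt; rewrite /I [X in int _ _ X](_ : _ = fun=> 0); last first.
    by apply/funext => s; rewrite patchE if_same.
  by rewrite /int Rintegral_cst ?mul0r ?mulr0.
- have [al rb] := lr t Dt.
  have i1 : integ (l t) (r t) (f1 \_ D) by exact: integ_sub (iadm _ a1).
  have i2 : integ (l t) (r t) (f2 \_ D) by exact: integ_sub (iadm _ a2).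
  have igt : integ (l t) (r t) g by exact: integ_sub ig.
  rewrite /I -mulrBr normrM sg1 mul1r -intB//.
  have c0 : 0 <= c.
    have := f12 t Dt; rewrite -(@pmulr_lge0 _ (g t)) ?mulr_gt0 ?kap0 ?rho0//.
    exact: le_trans.
  apply: (@le_trans _ _ (int (l t) (r t) (fun s => c * g s))).
    apply: int_norm; [exact: integB|exact: integZ|].
    move=> s /andP[ls sr].
    have sab : a <= s <= b by rewrite (le_trans al ls) (le_trans sr rb).
    rewrite !patchE; case: ifPn => [/set_mem Ds|_]; first exact: f12.
    by rewrite subr0 normr0 mulr_ge0 ?g0.
  by rewrite intZ// mulrAC -mulrA ler_wpM2l// gle.
exists (fun t => if t \in D then u t else 0).
have E t : rowop I u t = sg *: vint (l t) (r t) (fun t => if t \in D then u t else 0).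
  apply/rowP => i; rewrite !mxE /I; congr (_ * int _ _ _).
  by apply/funext => s; rewrite patchE; case: ifP; rewrite ?mxE.
split=> [i|t tab|t Dt|t Dt].
- rewrite [X in measurable_fun _ X](_ : _ = (fun t => u t ord0 i) \_ D).
    exact: measurable_patch.
  apply/funext => t.
  by rewrite patchE; case: ifP; rewrite ?mxE.
- case: ifPn => [/set_mem/ub//|_]; by rewrite normr0 mulr_ge0 ?g0.
- by rewrite -E mem_set//; exact: uG.
- by rewrite -E; exact: uI.
Qed.

End IntegralOperator.

(** * Standardised data and truncation of the state *)

Section Windows.
Context {R : realType} {n : nat}.
Notation mu := (@lebesgue_measure R).
Local Notation V := 'rV[R]_n.
Local Notation TR := (measurableTypeR R).
Implicit Types (D : set TR) (F G : R -> V -> set V) (K : nat -> R -> R).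

(* The working form of the hypotheses: after removal of a null set everything
   is Borel, the bounds hold for all states, and one function [K m] serves as
   Lipschitz constant and as bound on the ball of radius [m]. *)
Record std_data D F K : Prop := StdData {
  sd_measurable : measurable D;
  sd_ge0 : forall t, D t -> 0 <= t;
  sd_full : {ae mu, forall t : R, 0 <= t -> D t};
  sd_Kmeas : forall m, measurable_fun setT (K m : TR -> R);
  sd_K1 : forall m t, 1 <= K m t;
  sd_Kmono : forall m t, K m t <= K m.+1 t;
  sd_Kint : forall m S, integ 0 S (K m);
  sd_closed : forall t xi, D t -> closed (F t xi);
  sd_nonempty : forall t xi, D t -> F t xi !=set0;
  sd_bound : forall m t xi z, D t -> `|xi| <= m%:R -> F t xi z -> `|z| <= K m t;
  sd_lip : forall m t xi eta z, D t -> `|xi| <= m%:R -> `|eta| <= m%:R ->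
    F t xi z -> exists2 z', F t eta z' & `|z - z'| <= K m t * `|xi - eta|;
  sd_mmap : mmap D F }.

Lemma sd_Kle D F K m1 m2 t : std_data D F K -> (m1 <= m2)%N -> K m1 t <= K m2 t.
Proof.
move=> sd /subnKC <-; elim: (m2 - m1)%N => [|k IH]; first by rewrite addn0.
by rewrite addnS (le_trans IH)// (sd_Kmono sd).
Qed.

(** The retraction onto the unit ball of the sup norm, 1-Lipschitz for that norm. *)
Definition clamp (x : V) : V := \row_i Num.max (-1) (Num.min 1 (x ord0 i)).

Lemma clamp_le1 x : `|clamp x| <= 1.
Proof.
apply: rv_norm_le => // i; rewrite mxE ler_norml le_max lexx/=.
by rewrite ge_max ge_min lexx/= andbT; lra.
Qed.

Let dist_max_le (c p q : R) : `|Num.max c p - Num.max c q| <= `|p - q|.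
Proof.
have := ler_norm (p - q); have := ler_norm (q - p); rewrite distrC.
move: `|_ - _| => d h1 h2; rewrite ler_norml.
by case: (leP c p) => cp; case: (leP c q) => cq; apply/andP; split; lra.
Qed.

Let dist_min_le (c p q : R) : `|Num.min c p - Num.min c q| <= `|p - q|.
Proof.
have := ler_norm (p - q); have := ler_norm (q - p); rewrite distrC.
move: `|_ - _| => d h1 h2; rewrite ler_norml.
by case: (leP c p) => cp; case: (leP c q) => cq; apply/andP; split; lra.
Qed.

Lemma clamp_lip x y : `|clamp x - clamp y| <= `|x - y|.
Proof.
apply: rv_norm_le => // i; apply: le_trans (coord_le (x - y) i); rewrite !mxE.
exact: le_trans (dist_max_le _ _ _) (dist_min_le _ _ _).
Qed.

Lemma clamp_id x : `|x| <= 1 -> clamp x = x.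
Proof.
move=> x1; apply/rowP => i; rewrite mxE.
have := le_trans (coord_le x i) x1; rewrite ler_norml => /andP[h1 h2].
by rewrite (min_idPr h2) (max_idPr h1).
Qed.

Lemma mfunv_clamp D v : mfunv D v -> mfunv D (fun t => clamp (v t)).
Proof.
move=> mv i; rewrite [X in measurable_fun _ X](_ : _ = (cst (-1) \max (cst 1 \min (fun t => v t ord0 i)))).
  by apply: measurable_maxr => //; apply: measurable_minr.
by apply/funext => t; rewrite mxE.
Qed.

Lemma mmap_sub D D' F : measurable D -> measurable D' -> D' `<=` D -> mmap D F -> mmap D' F.
Proof.
move=> mD mD' DD mF y my O oO.
have my' : mfunv D (fun t => if t \in D' then y t else 0).
  move=> i; rewrite [X in measurable_fun _ X](_ : _ = (fun t => y t ord0 i) \_ D').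
    exact: measurable_patch.
  apply/funext => t.
  by rewrite patchE; case: ifP; rewrite ?mxE.
have := measurableI _ _ mD' (mF _ my' O oO).
congr measurable; apply/seteqP; split=> [t [D't [_ /=]]|t [D't h]] /=.
  by rewrite mem_set.
by split=> //; split; [exact: DD|rewrite mem_set].
Qed.

(** [F] is evaluated only at states of norm at most |x t| + 1, so one Lipschitz constant per time
    serves all states. *)
Definition window F (x : R -> V) : R -> V -> set V :=
  fun t xi => F t (x t + clamp (xi - x t)).

Lemma window_norm (x xi : V) (m : nat) : `|x| + 1 <= m%:R -> `|x + clamp (xi - x)| <= m%:R.
Proof.
move=> xm; rewrite (le_trans (ler_normD _ _))// (le_trans _ xm)// lerD2l.
exact: clamp_le1.
Qed.

Lemma mmap_window D F x : mmap D F -> mfunv D x -> mmap D (window F x).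
Proof.
move=> mF mx y my; apply: (mF (fun t => x t + clamp (y t - x t))).
by apply: mfunvD => //; apply: mfunv_clamp; exact: mfunvB.
Qed.

Lemma lipschitz_window D D' F K x (m : R -> nat) : std_data D F K -> D' `<=` D ->
  (forall t, D' t -> `|x t| + 1 <= (m t)%:R) ->
  lipschitz_map D' (window F x) (fun t => K (m t) t).
Proof.
move=> sd DD xm t xi eta z Dt Fz.
have [z' Fz' zz'] := sd_lip sd (DD _ Dt) (window_norm xi (xm t Dt)) (window_norm eta (xm t Dt)) Fz.
exists z' => //; apply: (le_trans zz'); apply: ler_wpM2l.
  by rewrite (le_trans ler01)// (sd_K1 sd).
rewrite opprD addrACA subrr add0r; apply: le_trans (clamp_lip _ _) _.
by rewrite opprB addrA subrK.
Qed.

Lemma window_id F x t xi : `|xi - x t| <= 1 -> window F x t xi = F t xi.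
Proof. by move=> h; rewrite /window clamp_id// subrKC. Qed.

End Windows.

(** * Local solutions and extension of bounded solutions *)

Section LocalExistence.
Context {R : realType} {n : nat}.
Notation mu := (@lebesgue_measure R).
Local Notation V := 'rV[R]_n.
Local Notation TR := (measurableTypeR R).
Implicit Types (D : set TR) (F G : R -> V -> set V) (K : nat -> R -> R).

Lemma sd_Kinteg D F K m a b : std_data D F K -> 0 <= a -> integ a b (K m).
Proof. by move=> sd a0; apply: integ_sub (sd_Kint sd m b). Qed.

(** Filippov's iteration with rho = 1 around the constant [x0], on an interval where the integral of
    [K m] is below 1/4. It starts from velocity 0, with defect at most [K m]; the state moves by at
    most 1, so the window is inactive. *)
Lemma local_solution D F K T (x0 : V) (m : nat) : std_data D F K -> 0 <= T ->
  `|x0| + 1 <= m%:R ->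
  exists Tp y, [/\ T < Tp, y T = x0,
    forall s t, T <= s -> s <= t -> t <= Tp -> `|y t - y s| <= int s t (fun t => 4 * K m t) &
    {ae mu, forall t : R, T < t < Tp -> derivable y t 1 /\ F t (y t) ('D_1 y t)}].
Proof.
move=> sd T0 x0m.
have K0 t : 0 < K m t by apply: lt_le_trans (sd_K1 sd m t).
have iK b : integ T b (K m) by exact: sd_Kinteg sd _.
have := int_ac (fun t _ => ltW (K0 t)) (iK (T + 1)).
move=> /ac_on_small /(_ (1/4)) []; first by lra.
move=> d d0 dP; pose h := Num.min 1 (d / 2); pose Tp := T + h.
have h0 : 0 < h by rewrite lt_min ltr01 divr_gt0.
have TTp : T < Tp by rewrite ltrDl.
have gK : int T Tp (K m) < 1 / 4.
  apply: dP => //; rewrite ?lerD2l ?ge_min ?lexx// /Tp; first lra.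
  by rewrite addrAC subrr add0r gt_min; apply/orP; right; lra.
pose D' : set TR := D `&` `[T, Tp].
have mD' : measurable D' by apply: measurableI => //; exact: sd_measurable sd.
have D'D : D' `<=` D by exact: subIsetl.
pose G := window F (cst x0).
have mcst : mfunv D (cst x0) by exact: mfunv_cst.
have [|||||||||||||||||u [mu_ ub uG uI]] := @picard_int R n D' T Tp G (K m) (cst 1) (cst T) id 1 (cst 0) (cst x0) mD'.
- exact: subIsetr.
- by apply: measurable_funTS; exact: sd_Kmeas sd _.
- exact: measurable_cst.
- by move=> t _; exact: K0.
- by move=> t _ /=.
- by apply: mmap_sub D'D _ => //; [exact: sd_measurable sd|apply: mmap_window => //; exact: sd_mmap sd].
- by move=> t xi [Dt _]; exact: sd_closed sd _ _ Dt.
- exact: (@lipschitz_window _ _ D D' F K (cst x0) (cst m)).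
- by move=> t _ /=; rewrite mulr1 ltW.
- by apply: eq_integ (iK Tp) => t _ /=; rewrite mulr1.
- by rewrite normr1.
- by move=> t [_ /=]; rewrite in_itv/= => /andP[].
- move=> f fi; apply: measurable_funS (int_measurable_r fi) => //; exact: subIsetr.
- move=> t [_ /=]; rewrite in_itv/= => /andP[Tt tTp].
  rewrite (@eq_int _ _ _ _ (K m)); last by move=> s _; rewrite mulr1.
  by rewrite (le_trans _ (ltW gK))//; apply: int_sub_le => // s _; exact: ltW.
- exact: mfunv_cst.
- exact: mfunv_cst.
- move=> t [Dt _]; have x0m' : `|x0| <= m%:R by rewrite (le_trans _ x0m)// lerDl.
  have [z Fz] := sd_nonempty sd x0 Dt; exists z.
    by rewrite /G window_id// subrr normr0.
  by rewrite subr0 mulr1; exact: sd_bound sd _ _ _ _ Dt x0m' Fz.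
have {}mu_ : mfunv `[T, Tp] u by move=> i; exact: measurable_funTS (mu_ i).
have {}ub t : T <= t <= Tp -> `|u t| <= 4 * K m t by move=> /ub; rewrite mulr1.
exists Tp, (fun t => x0 + vint T t u); split => //.
- by rewrite (_ : vint T T u = 0) ?addr0//; apply/rowP => i; rewrite !mxE intaa.
- move=> s t Ts st tTp; rewrite opprD addrACA subrr add0r.
  exact: vint_increment_le mu_ ub (integZ 4 (iK Tp)) Ts st tTp.
apply: ae_imp (ae_and (vint_ftc x0 mu_ ub (integZ 4 (iK Tp))) (sd_full sd)) => t [+ Dt] tT.
move=> /(_ tT)[dy ->]; split => //.
have /andP[Tt tTp] := tT.
have D't : D' t.
  by split; [apply: Dt; rewrite (le_trans T0)// ltW|rewrite /= in_itv/= !ltW].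
have := uG t D't; have := uI t D't; rewrite !scale1r /cst add0r => h1.
by rewrite /G window_id// addrAC subrr add0r.
Qed.

Lemma sol_increment D F K G T x (M : nat) s t : std_data D F K ->
  (forall m t xi z, D t -> `|xi| <= m%:R -> G t xi z -> `|z| <= K m t) ->
  is_solution G (horizon T%:E) x -> (forall t, 0 <= t < T -> `|x t| <= M%:R) ->
  0 <= s -> s <= t -> t < T -> `|x t - x s| <= int s t (K M).
Proof.
move=> sd bG [acx dx] xM s0 st tT; apply: solution_increment => //.
- by apply: acx => r /=; rewrite in_itv/= /horizon/= lte_fin => /andP[sr rt];
    rewrite (le_trans s0 sr) (le_lt_trans rt tT).
- exact: sd_Kinteg sd s0.
apply: ae_imp (ae_and dx (sd_full sd)) => r [+ Dr] /andP[sr rt].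
have r0 : 0 <= r by rewrite (le_trans s0)// ltW.
have rT : r < T by exact: lt_trans tT.
rewrite /horizon/= lte_fin => /(_ (conj r0 rT))[dxr Gr]; split => //.
by apply: bG Gr; [exact: Dr|apply: xM; rewrite r0].
Qed.

(** Boundedness puts the velocity below the single integrable function [K M] up to [T], so [x] is
    Cauchy at [T]. From its limit a solution for [F] continues it, and [F] is contained in [G]. *)
Lemma solution_extension D F K G T x (M : nat) : std_data D F K ->
  (forall t xi z, D t -> F t xi z -> G t xi z) ->
  (forall m t xi z, D t -> `|xi| <= m%:R -> G t xi z -> `|z| <= K m t) ->
  0 < T -> is_solution G (horizon T%:E) x -> (forall t, 0 <= t < T -> `|x t| <= M%:R) ->
  exists Tp y, [/\ (T%:E < Tp%:E)%E, is_solution G `[0, Tp] y &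
    forall t, horizon T%:E t -> y t = x t].
Proof.
move=> sd FG bG T0 solx xM.
have incr s t := @sol_increment D F K G T x M s t sd bG solx xM.
have K0 m t : 0 < K m t by apply: lt_le_trans (sd_K1 sd m t).
have iKT : integ 0 T (K M) := sd_Kint sd M T.
have small := ac_on_small (int_ac (fun t _ => ltW (K0 M t)) iKT).
have [l lx] : exists l, forall s, 0 <= s < T -> `|l - x s| <= int s T (K M).
  have ca : cauchy (x t @[t --> T^'-]).
    apply: cauchy_exP => e e0; have [d d0 dP] := small e e0.
    pose s := Num.max 0 (T - d / 2).
    have s0 : 0 <= s by rewrite le_max lexx.
    have sT : s < T by rewrite gt_max T0/=; lra.
    have sd' : T - s < d by rewrite ltrBlDl -ltrBlDr lt_max; apply/orP; right; lra.
    exists (x s); suff : \forall t \near T^'-, ball (x s) e (x t) by [].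
    near=> t; rewrite -ball_normE /= distrC.
    have st : s <= t by near: t; exact: nbhs_left_ge.
    have tT : t < T by near: t; exact: nbhs_left_lt.
    apply: le_lt_trans (incr _ _ s0 st tT) _; apply: (dP _ _ s0 st (ltW tT)).
    by rewrite (le_lt_trans _ sd')// lerD2r ltW.
  have /cvg_ex[l xl] : cvg (x t @[t --> T^'-]) by apply/cauchy_cvgP.
  exists l => s /andP[s0 sT]; apply/ler_addgt0Pr => e e0.
  have /cvgrPdist_le/(_ _ e0) := xl => near_e.
  suff [t [tT st xt]] : exists t, [/\ t < T, s <= t & `|l - x t| <= e].
    apply: (le_trans (ler_distD (x t) _ _)); rewrite addrC lerD//.
    apply: (le_trans (incr _ _ s0 st tT)); apply: int_sub_le => //; first exact: ltW.
      by move=> r _; exact: ltW.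
    exact: sd_Kinteg sd s0.
  near (T^'-) => t; exists t; split.
  - by near: t; exact: nbhs_left_lt.
  - by near: t; exact: nbhs_left_ge.
  - by near: t; exact: near_e.
have [m lm] : exists m : nat, `|l| + 1 <= m%:R.
  by exists (Num.truncn (`|l| + 1)).+1; rewrite ltW// truncnS_gt.
have [Tp [y2 [TTp y2T y2i y2s]]] := local_solution sd (ltW T0) lm.
pose y t := if t < T then x t else y2 t.
pose kap t := K M t + 4 * K m t.
have ikap a b : 0 <= a -> integ a b kap.
  by move=> a0; apply: integD; [|apply: integZ]; exact: sd_Kinteg sd a0.
have kap0 t : 0 <= kap t by rewrite addr_ge0 ?mulr_ge0 ?ltW.
have yincr s t : 0 <= s -> s <= t -> t <= Tp -> `|y t - y s| <= int s t kap.
  move=> s0 st tTp; have t0 := le_trans s0 st.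
  have le1 a b : 0 <= a -> int a b (K M) <= int a b kap.
    move=> a0; apply: int_le; [exact: sd_Kinteg sd a0|exact: ikap|].
    by move=> r _; rewrite lerDl mulr_ge0 ?ltW.
  have le2 a b : 0 <= a -> int a b (fun t => 4 * K m t) <= int a b kap.
    move=> a0; apply: int_le; [|exact: ikap|].
      by apply: integZ; exact: sd_Kinteg sd a0.
    by move=> r _; rewrite lerDr ltW.
  rewrite /y; case: ltP => tT; case: ltP => sT.
  - exact: le_trans (incr _ _ s0 st tT) (le1 _ _ s0).
  - by have := le_lt_trans st tT; rewrite ltNge sT.
  - apply: (le_trans (ler_distD l _ _)).
    rewrite (@int_chasles R s t T kap (ltW sT) tT (ikap _ _ s0)) addrC lerD//.
      by rewrite (le_trans (lx s _)) ?s0// le1.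
    by rewrite -y2T (le_trans (y2i _ _ _ tT tTp))// le2// ltW.
  - by rewrite (le_trans (y2i _ _ sT st tTp))// le2.
exists Tp, y; split; first by rewrite lte_fin.
  split=> [a b abI|].
    have [ba|ab] := ltP b a; first exact: (@ac_on_empty R a b (fun u v : R => enorm (y v - y u))).
    have /andP[a0 _] : 0 <= a <= Tp by have := abI a; rewrite /= !in_itv/= lexx ab; exact.
    have /andP[_ bTp] : 0 <= b <= Tp by have := abI b; rewrite /= !in_itv/= lexx ab; exact.
    apply: (@abs_continuous_le _ _ _ _ _ (fun s t : R => int s t kap)).
      move=> u v au uv vb; apply: yincr => //; first exact: le_trans au.
      exact: le_trans bTp.
    by apply: int_ac => //; exact: ikap.
  (* At the junction and at the right end no two-sided derivative is known. *)
  have T_null : {ae mu, forall t : R, t != T /\ t != Tp}.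
    have ne (c : R) : {ae mu, forall t : R, t != c}.
      exists [set c]; split => //; first exact: lebesgue_measure_set1.
      by move=> t /= /negP; rewrite negbK => /eqP.
    exact: ae_and.
  apply: ae_imp (ae_and (ae_and solx.2 y2s) (ae_and (sd_full sd) T_null)).
  move=> t [[dx dy] [Dt [tneT tneTp]]] /=; rewrite in_itv/= => /andP[t0 tTp].
  have {}Dt := Dt t0.
  have [tT|Tt] := ltP t T.
    have E : {near t, x =1 y}.
      have : \forall r \near t, r < T by exact: lt_nbhsl.
      by apply: filterS => r rT; rewrite /y rT.
    have [dxt Gt] : derivable x t 1 /\ G t (x t) ('D_1 x t).
      by apply: dx; rewrite /horizon/= lte_fin.
    split; first exact: near_eq_derivable dxt.
    by rewrite -(near_eq_derive _ E) /y tT.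
  have {}Tt : T < t by rewrite lt_neqAle eq_sym tneT.
  have {}tTp : t < Tp by rewrite lt_neqAle tneTp.
  have E : {near t, y2 =1 y}.
    have : \forall r \near t, T < r by exact: lt_nbhsr.
    by apply: filterS => r rT; rewrite /y ltNge (ltW rT).
  have [dyt Ft] := dy (introT andP (conj Tt tTp)).
  split; first exact: near_eq_derivable dyt.
  rewrite -(near_eq_derive _ E) /y ltNge (ltW Tt)/=; exact: FG.
by move=> t [t0]; rewrite lte_fin /y => ->.
Unshelve. all: by end_near. Qed.

End LocalExistence.

(** * Approximation of a relaxed solution by a selection on a compact interval *)

Section SigmaDelta.
Context {R : realType} {n : nat}.
Notation mu := (@lebesgue_measure R).
Local Notation V := 'rV[R]_n.
Local Notation TR := (measurableTypeR R).
Implicit Types (D : set TR) (F G : R -> V -> set V) (K : nat -> R -> R) (x w : R -> V).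

(** Composition with the projection onto [a, b] gives continuity on the whole line. *)
Lemma ac_coord_extension a b x i : a <= b -> abs_continuous a b x ->
  exists2 f : R -> R, continuous f & forall t, a <= t <= b -> f t = x t ord0 i.
Proof.
move=> ab acx.
pose p (t : R) := Num.max a (Num.min b t).
have pab t : a <= p t <= b by rewrite /p le_max lexx/= ge_max ab ge_min lexx.
have pid t : a <= t <= b -> p t = t.
  by move=> /andP[at_ tb]; rewrite /p (min_idPr tb) (max_idPr at_).
have plip s t : s <= t -> p s <= p t /\ p t - p s <= t - s.
  rewrite /p => st; case: (leP b s) => bs; case: (leP b t) => bt;
    case: (leP a s) => as_; case: (leP a t) => at_; case: (leP a b) => ab'; split; lra.
exists (fun t => x (p t) ord0 i); last by move=> t /pid ->.
move=> t; apply/cvgrPdist_lt => e e0.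
have [d d0 dP] := ac_on_small (abs_continuous_coord i acx) e0.
exists d => //= s /= ts.
have /andP[apt ptb] := pab t; have /andP[aps psb] := pab s.
have [st|ts'] := leP s t.
  have [h1 h2] := plip _ _ st; apply: dP => //.
  by apply: (le_lt_trans h2); exact: le_lt_trans (ler_norm _) ts.
have [h1 h2] := plip _ _ (ltW ts'); rewrite distrC; apply: dP => //.
by apply: (le_lt_trans h2); rewrite distrC in ts; exact: le_lt_trans (ler_norm _) ts.
Qed.

Lemma ac_measurable a b x : abs_continuous a b x -> mfunv (`[a, b]%classic : set TR) x.
Proof.
move=> acx i; have [ab|ba] := leP a b; last first.
  by rewrite set_itv_ge; [exact: measurable_fun_set0|rewrite bnd_simp -ltNge].
have [f cf fx] := ac_coord_extension i ab acx.
apply: eq_measurable_fun (measurable_funTS (continuous_measurable_fun cf)) => t.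
by rewrite inE/= in_itv/= => /fx.
Qed.

Lemma ac_bounded a b x : a <= b -> abs_continuous a b x ->
  exists M : nat, forall t, a <= t <= b -> `|x t| <= M%:R.
Proof.
move=> ab acx.
have bi i : exists M : nat, forall t, a <= t <= b -> `|x t ord0 i| <= M%:R.
  have [f cf fx] := ac_coord_extension i ab acx.
  have cn : {within `[a, b], continuous (fun t => `|f t|)}.
    by apply: continuous_subspaceT => t; apply: cvg_norm; exact: cf.
  have [c _ cP] := EVT_max ab cn.
  exists (Num.truncn `|f c|).+1 => t tab; rewrite -fx//.
  by rewrite ltW// (le_lt_trans _ (truncnS_gt _))//; apply: cP; rewrite in_itv.
have [m mP] := choice bi.
exists (\sum_(i < n) m i)%N => t tab; apply: rv_norm_le => // i.
by rewrite (le_trans (mP i t tab))// ler_nat (bigD1 i)//= leq_addr.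
Qed.

(* Membership of the derivative in the closed convex hull is only used through
   linear functionals. *)
Record relaxed_solution F T x : Prop := RelaxedSolution {
  rs_ac : forall a b, 0 <= a -> b < T -> abs_continuous a b x;
  rs_der : {ae mu, forall t : R, 0 <= t < T -> derivable x t 1 /\
    forall (e : V) c, (forall z, F t (x t) z -> c <= dot e z) -> c <= dot e ('D_1 x t)} }.

Lemma rs_bound D F K T x (M : nat) a b : std_data D F K -> relaxed_solution F T x ->
  0 <= a -> b < T -> (forall t, a <= t <= b -> `|x t| <= M%:R) ->
  {ae mu, forall t : R, a < t < b -> derivable x t 1 /\ `|'D_1 x t| <= K M t}.
Proof.
move=> sd [_ dx] a0 bT xM; apply: ae_imp (ae_and dx (sd_full sd)) => t [+ Dt] /andP[at_ tb].
have t0 : 0 <= t by rewrite (le_trans a0)// ltW.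
rewrite t0 (lt_trans tb bT) => /(_ isT)[dxt H]; split => //.
have {}Dt := Dt t0.
have {}xM : `|x t| <= M%:R by apply: xM; rewrite !ltW.
apply: rv_norm_le => [|i]; first by rewrite (le_trans ler01)// (sd_K1 sd).
rewrite ler_norml; apply/andP; split.
  rewrite -dot_delta; apply: H => z Fz; rewrite dot_delta.
  have := le_trans (coord_le z i) (sd_bound sd Dt xM Fz).
  by rewrite ler_norml => /andP[].
rewrite -lerN2.
have -> : - 'D_1 x t ord0 i = dot (- delta_mx ord0 i) ('D_1 x t).
  by rewrite dotC dotN dotC dot_delta.
apply: H => z Fz; rewrite dotC dotN dotC dot_delta lerN2.
have := le_trans (coord_le z i) (sd_bound sd Dt xM Fz).
by rewrite ler_norml => /andP[].
Qed.

Lemma rs_increment D F K T x (M : nat) a b : std_data D F K -> relaxed_solution F T x ->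
  0 <= a -> a <= b -> b < T -> (forall t, a <= t <= b -> `|x t| <= M%:R) ->
  `|x b - x a| <= int a b (K M).
Proof.
move=> sd rs a0 ab bT xM; apply: solution_increment => //.
- exact: (rs_ac rs).
- exact: sd_Kinteg sd a0.
- exact: rs_bound sd rs a0 bT xM.
Qed.

Lemma dot_sqrD (e p : V) : dot (e + p) (e + p) = dot e e + 2 * dot e p + dot p p.
Proof. by rewrite dotD (dotC (e + p) e) (dotC (e + p) p) !dotD (dotC p e); ring. Qed.

Lemma dot_le_norm (z : V) : dot z z <= n%:R * `|z| ^+ 2.
Proof.
rewrite mulr_natl -[X in _ *+ X]card_ord -sumr_const; apply: ler_sum => i _.
by rewrite -expr2 -real_normK ?num_real// lerXn2r ?nnegrE// coord_le.
Qed.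

Lemma norm_le_dot (z : V) c : 0 <= c -> dot z z <= c ^+ 2 -> `|z| <= c.
Proof.
move=> c0 zc; apply: rv_norm_le => // i.
rewrite -(ler_pXn2r (ltn0Sn 1)) ?nnegrE//; apply: le_trans zc.
rewrite real_normK ?num_real// expr2 /dot (bigD1 i)//= lerDl.
by apply: sumr_ge0 => j _; rewrite -expr2 sqr_ge0.
Qed.

Lemma mfunv_le_if (E : set TR) (c : R) (u v : R -> V) : measurable E -> mfunv E u -> mfunv E v ->
  mfunv E (fun t => if t <= c then u t else v t).
Proof.
move=> mE mu_ mv i.
rewrite [X in measurable_fun _ X](_ : _ = fun t => if t <= c then u t ord0 i else v t ord0 i).
  apply: measurable_fun_if => //.
  - apply: measurable_fun_ler => //; exact: measurable_cst.
  - apply: measurable_funS (mu_ i) => //; exact: subIsetl.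
  - apply: measurable_funS (mv i) => //; exact: subIsetl.
by apply/funext => t; case: ifP.
Qed.

Lemma dot_vint a b (e : V) w : (forall i, integ a b (fun t => w t ord0 i)) ->
  integ a b (fun t => dot e (w t)) /\ dot e (vint a b w) = int a b (fun t => dot e (w t)).
Proof.
move=> iw; split; first by apply: integ_sum => i; exact: integZ.
rewrite int_sum => [|i]; last exact: integZ.
by apply: eq_bigr => i _; rewrite mxE intZ.
Qed.

(** The accumulated error e of the selection, normalised to vanish at [a]. *)
Definition drift x w a t := vint a t w - (x t - x a).

Let energy_step (s a b c N I J p q r : R) : q <= s * (b - a) ->
  p <= 2 * s * (a - c) + N * J -> r <= N * I ->
  p + 2 * q + r <= 2 * s * (b - c) + N * (J + I).
Proof.
move=> h1 h2 h3.
have -> : 2 * s * (b - c) + N * (J + I) =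
  (2 * s * (a - c) + N * J) + 2 * (s * (b - a)) + N * I by ring.
lra.
Qed.

(* Feedback: on each short piece the selection nearly minimises the inner
   product with the error made so far, so that the squared error only grows by
   second order terms. *)
Lemma sigma_delta D F K T x (M : nat) A B eps : std_data D F K -> relaxed_solution F T x ->
  0 <= A -> A <= B -> B < T -> (forall t, A <= t <= B -> `|x t| <= M%:R) -> 0 < eps ->
  exists w, [/\ mfunv (`[A, B]%classic : set TR) w,
    forall t, A <= t <= B -> D t -> F t (x t) (w t),
    forall t m, A <= t <= B -> `|x t| <= m%:R -> `|w t| <= K m t &
    forall t, A <= t <= B -> `|drift x w A t| <= eps].
Proof.
move=> sd rs A0 AB BT xM eps0.
pose kap := K M.
have kap0 t : 0 <= kap t by rewrite (le_trans ler01)// (sd_K1 sd).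
have ikap a b : 0 <= a -> integ a b kap by exact: sd_Kinteg sd.
pose c := int A B kap; have c0 : 0 <= c by exact: int_ge0.
(* The budget for the squared error at the nodes: half for the selection slack [s], half for the
   second order terms controlled by [eta]. The bound eta <= eps / 4 limits the motion inside one
   piece to eps / 2. *)
pose Q := (eps / 2) ^+ 2; have Q0 : 0 < Q by rewrite exprn_gt0// divr_gt0.
pose s := Q / (4 * (B - A + 1)).
have BA1 : 0 < B - A + 1 by lra.
have s0 : 0 < s by rewrite divr_gt0// mulr_gt0.
have nc1 : 0 < 8 * n%:R * c + 1 by rewrite ltr_wpDl// !mulr_ge0.
pose eta := Num.min (eps / 4) (Q / (8 * n%:R * c + 1)).
have eta0 : 0 < eta by rewrite lt_min !divr_gt0.
have sB : 2 * s * (B - A) <= Q / 2.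
  have : s * (4 * (B - A + 1)) = Q by rewrite divfK// gt_eqF// mulr_gt0.
  by rewrite !mulrDr; move: s0; move: (s * 4) => p; lra.
have etac : 4 * n%:R * eta * c <= Q / 2.
  have : eta * (8 * n%:R * c + 1) <= Q.
    by rewrite -ler_pdivlMr// ge_min lexx orbT.
  have : 0 <= eta * (8 * n%:R * c) by rewrite !mulr_ge0// ltW.
  have -> : eta * (8 * n%:R * c + 1) = 2 * (4 * n%:R * eta * c) + eta by ring.
  lra.
have [d d0 dP] := ac_on_small (int_ac (fun t _ => kap0 t) (ikap A B A0)) eta0.
have [N NP] : exists N : nat, (B - A) / N.+1%:R < d.
  exists (Num.truncn ((B - A) / d)); rewrite ltr_pdivrMr// mulrC -ltr_pdivrMr//.
  by rewrite truncnS_gt.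
pose h := (B - A) / N.+1%:R; have h0 : 0 <= h by rewrite divr_ge0 ?subr_ge0.
pose tau (k : nat) := A + k%:R * h.
have tauS k : tau k.+1 = tau k + h by rewrite /tau -natr1 mulrDl mul1r addrA.
have tauN : tau N.+1 = B by rewrite /tau mulrC divfK ?pnatr_eq0// subrKC.
have tauA k : A <= tau k by rewrite lerDl mulr_ge0.
have tauB k : (k <= N.+1)%N -> tau k <= B.
  by move=> kN; rewrite -tauN lerD2l ler_wpM2r// ler_nat.
pose D1 : set TR := D `&` `[A, B].
have mD1 : measurable D1 by apply: measurableI => //; exact: sd_measurable sd.
have D1D : D1 `<=` D by exact: subIsetl.
have mx : mfunv D1 x.
  have := ac_measurable (rs_ac rs A0 BT); apply: mfunv_sub => //; exact: subIsetr.
have mF1 : mmulti D1 (fun t => F t (x t)).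
  exact: (mmap_sub (sd_measurable sd) mD1 D1D (sd_mmap sd) mx).
pose good w := [/\ mfunv (`[A, B]%classic : set TR) w,
    forall t, A <= t <= B -> D t -> F t (x t) (w t) &
    forall t m, A <= t <= B -> `|x t| <= m%:R -> `|w t| <= K m t].
have good_kap w : good w -> forall t, A <= t <= B -> `|w t| <= kap t.
  by move=> [_ _ H] t tAB; apply: H => //; exact: xM.
have sel e : exists w, good w /\ forall t, D1 t -> forall z, F t (x t) z -> dot e (w t) <= dot e z + s.
  have [|t Dt|t Dt|w mw wP] := @selection_argmin R n D1 (fun t => F t (x t)) e s s0 mD1 mF1.
  - by move=> t [Dt _]; exact: sd_closed sd _ _ Dt.
  - by have [Dt' _] := Dt; exact: sd_nonempty sd _ _ Dt'.
  - have [Dt' tAB] := Dt; exists (kap t) => z Fz; apply: (sd_bound sd Dt' _ Fz).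
    by apply: xM; rewrite /= in_itv/= in tAB.
  exists (fun t => if t \in D1 then w t else 0); split; first split.
  - move=> i; rewrite [X in measurable_fun _ X](_ : _ = (fun t => w t ord0 i) \_ D1).
      by apply: measurable_patch => //; exact: subIsetr.
    by apply/funext => t; rewrite patchE; case: ifP; rewrite ?mxE.
  - move=> t tAB Dt; have D1t : D1 t by split => //=; rewrite in_itv.
    by rewrite mem_set//; have [] := wP t D1t.
  - move=> t m tAB xm; case: ifPn => [/set_mem D1t|_].
      have [Fw _] := wP t D1t; have [Dt _] := D1t.
      exact: (sd_bound sd Dt _ Fw).
    by rewrite normr0 (le_trans ler01)// (sd_K1 sd).
  - by move=> t D1t z Fz; rewrite mem_set//; have [_] := wP t D1t; exact.
have drift_step w a b : good w -> A <= a -> a <= b -> b <= B ->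
    `|vint a b w - (x b - x a)| <= 2 * int a b kap.
  move=> gw Aa ab bB; have wk := good_kap _ gw; have [mw _ _] := gw.
  have a0 := le_trans A0 Aa.
  rewrite mulr_natl mulr2n (le_trans (ler_normB _ _))// lerD//.
    apply: vint_le => [|t /andP[at_ tb]|]; last exact: ikap.
      apply: mfunv_sub mw => //; apply: subset_itv; rewrite bnd_simp//.
    by apply: wk; rewrite (le_trans Aa at_) (le_trans tb bB).
  apply: (rs_increment sd rs a0 ab (le_lt_trans bB BT)) => t /andP[at_ tb].
  by apply: xM; rewrite (le_trans Aa at_) (le_trans tb bB).
have drift_split w a b : good w -> A <= a -> a <= b -> b <= B ->
    drift x w A b = drift x w A a + (vint a b w - (x b - x a)).
  move=> gw Aa ab bB; have wk := good_kap _ gw; have [mw _ _] := gw.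
  rewrite /drift -(vint_increment mw wk (ikap A B A0) Aa ab bB).
  by apply/rowP => i; rewrite !mxE; ring.
(* The bound is linear in the elapsed time and in the integral of [kap], so its total does not
   depend on the number of pieces. *)
suff H k : (k <= N.+1)%N -> exists w, [/\ good w,
    dot (drift x w A (tau k)) (drift x w A (tau k)) <=
      2 * s * (tau k - A) + 4 * n%:R * eta * int A (tau k) kap &
    forall t, A <= t <= tau k -> `|drift x w A t| <= eps].
  have [w [gw _ wq]] := H N.+1 (leqnn _).
  by exists w; case: gw => *; split => //; rewrite -tauN.
elim: k => [_|k IH kN].
  have [w [gw _]] := sel 0; exists w.
  have dAA : drift x w A A = 0.
    by rewrite /drift subrr subr0; apply/rowP => i; rewrite !mxE intaa.
  rewrite /tau mul0r addr0 dAA subrr intaa !mulr0 addr0; split => //.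
    by rewrite /dot big1// => i _; rewrite mxE mul0r.
  move=> t /andP[h1 h2]; have -> : t = A by apply/eqP; rewrite eq_le h1 h2.
  by rewrite dAA normr0 ltW.
have [w [gw wq wt]] := IH (ltnW kN).
have kB := tauB _ (ltnW kN); have kB' := tauB _ kN.
have kk : tau k <= tau k.+1 by rewrite tauS lerDl.
set e := drift x w A (tau k) in wq.
have [w' [gw' w'e]] := sel e.
pose w2 t := if t <= tau k then w t else w' t.
have gw2 : good w2.
  case: gw gw' => [m1 F1 k1] [m2 F2 k2]; split.
  - exact: mfunv_le_if.
  - by move=> t tAB Dt; rewrite /w2; case: ifP => _; [exact: F1|exact: F2].
  - by move=> t m tAB xm; rewrite /w2; case: ifP => _; [exact: k1|exact: k2].
have old t : t <= tau k -> drift x w2 A t = drift x w A t.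
  move=> tk; rewrite /drift; congr (_ - _); apply/rowP => i; rewrite !mxE.
  by apply: eq_int => r /andP[_ rt]; rewrite /w2 (le_trans rt tk).
have dot_e : dot e e <= Q.
  apply: (le_trans wq); have -> : Q = Q / 2 + Q / 2 by rewrite -splitr.
  apply: lerD; first apply: le_trans sB.
    by rewrite ler_wpM2l ?lerD2r// mulr_ge0// ltW.
  apply: le_trans etac; rewrite ler_wpM2l//; first by rewrite !mulr_ge0// ltW.
  by apply: int_sub_le => //; exact: ikap.
have ne : `|e| <= eps / 2 by apply: norm_le_dot => //; rewrite divr_ge0// ltW.
have new t : tau k <= t -> t <= tau k.+1 -> exists p : V,
    [/\ drift x w2 A t = e + p, `|p| <= 2 * int (tau k) t kap,
      int (tau k) t kap < eta & dot e p <= s * (t - tau k)].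
  move=> kt tk; have tB := le_trans tk kB'.
  exists (vint (tau k) t w2 - (x t - x (tau k))); split.
  - by rewrite (drift_split _ _ _ gw2 (tauA k) kt tB) old.
  - exact: drift_step.
  - apply: dP => //; apply: (@le_lt_trans _ _ h) => //.
    by move: tk; rewrite tauS; lra.
  have tk0 := le_trans A0 (tauA k).
  have iw2 i : integ (tau k) t (fun r => w2 r ord0 i).
    have k2 := good_kap _ gw2; have [m2 _ _] := gw2; apply: (@integ_sub R A B) => //.
    by apply: vint_integ m2 k2 _; exact: ikap.
  have [id_ dE] := dot_vint e iw2.
  rewrite dotD dotN dE dotD dotN.
  have ic : integ (tau k) t (fun=> s) by exact: integ_cst.
  (* The first order term: since [w'] minimises up to [s], all values of [F] have inner product with
     [e] at least that of [w2] minus [s], and so has the relaxed velocity. *)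
  have := @ac_int_le R (tau k) t (fun r => dot e (x r)) (fun r => dot e (w2 r) - s) kt.
  move=> /(_ _ (integB id_ ic)).
  rewrite (intB id_ ic) int_cst// => H; rewrite lerBlDl -lerBlDr.
  apply: H.
    by apply: abs_continuous_dot; apply: (rs_ac rs) => //; exact: le_lt_trans BT.
  apply: ae_imp (ae_and (rs_der rs) (sd_full sd)) => r [+ Dr] /andP[kr rt].
  have Ar : A <= r by rewrite (le_trans (tauA k))// ltW.
  have rB : r <= B by rewrite (le_trans (ltW rt)).
  have r0 := le_trans A0 Ar.
  rewrite r0 (le_lt_trans rB BT) => /(_ isT)[dr dc].
  have [d1 ->] := is_derive_dot e dr; split => //.
  apply: dc => z Fz; rewrite lerBlDr.
  have -> : w2 r = w' r by rewrite /w2 leNgt kr.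
  by apply: w'e => //; split; [exact: Dr|rewrite /= in_itv/= Ar].
exists w2; split => // [|t /andP[At tk]].
  have [p [-> p1 p2 p3]] := new _ kk (lexx _).
  rewrite dot_sqrD.
  rewrite (@int_chasles R A (tau k.+1) (tau k) kap (tauA k) kk (ikap _ _ A0)).
  have I0 : 0 <= int (tau k) (tau k.+1) kap by exact: int_ge0.
  apply: energy_step p3 wq _.
  apply: (le_trans (dot_le_norm p)).
  apply: (@le_trans _ _ (n%:R * (2 * int (tau k) (tau k.+1) kap) ^+ 2)).
    by rewrite ler_wpM2l// lerXn2r ?nnegrE// (le_trans (normr_ge0 _) p1).
  move: (int _ _ _) I0 p2 => I I0 /ltW p2.
  (* One factor [I] is below [eta]; the other is the new part of the integral in the budget. *)
  have -> : n%:R * (2 * I) ^+ 2 = 4 * n%:R * I * I by ring.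
  by rewrite ler_wpM2r// ler_wpM2l// mulr_ge0.
have [tk'|tk'] := leP t (tau k).
  by rewrite old// wt// At.
have [p [-> p1 p2 _]] := new t (ltW tk') tk.
rewrite (le_trans (ler_normD _ _))//.
have : eta <= eps / 4 by rewrite ge_min lexx.
by move: ne p1 p2; move: (int _ _ _) `|e| `|p| => *; lra.
Qed.

End SigmaDelta.

(** * Dyadic times, improper integrals and the exponential weight *)

Section ImproperIntegrals.
Context {R : realType}.
Notation mu := (@lebesgue_measure R).
Local Notation TR := (measurableTypeR R).
Implicit Types (T : R) (g kap : R -> R).

Definition dyadic T (k : nat) : R := T - T * 2^-1 ^+ k.

Lemma dyadic0 T : dyadic T 0 = 0.
Proof. by rewrite /dyadic expr0 mulr1 subrr. Qed.

Lemma dyadic_lt T k : 0 < T -> dyadic T k < T.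
Proof. by move=> T0; rewrite gtrBl mulr_gt0// halfX_gt0. Qed.

Lemma dyadic_le T k : 0 < T -> dyadic T k <= dyadic T k.+1.
Proof.
move=> T0; rewrite lerD2l lerN2 ler_pM2l// exprS ger_pMl ?halfX_gt0//.
by rewrite invf_le1// ler1n.
Qed.

Lemma dyadic_homo T k m : 0 < T -> (k <= m)%N -> dyadic T k <= dyadic T m.
Proof.
move=> T0 /subnKC <-; elim: (m - k)%N => [|j IH]; first by rewrite addn0.
by rewrite addnS (le_trans IH)// dyadic_le.
Qed.

Lemma dyadic_ge0 T k : 0 < T -> 0 <= dyadic T k.
Proof. by move=> T0; rewrite -(dyadic0 T) dyadic_homo. Qed.

Lemma dyadic_ex T t : 0 < T -> t < T -> exists k, t < dyadic T k.
Proof.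
move=> T0 tT; have tT' : 0 < T - t by rewrite subr_gt0.
have [k /(_ k (leqnn k)) kP] := halfX_small T tT'; exists k.
by rewrite /dyadic; lra.
Qed.

Lemma dyadic_bigcup T : 0 < T -> `[0, T[%classic = \bigcup_k `[0, dyadic T k]%classic.
Proof.
move=> T0; apply/seteqP; split=> t /=.
  rewrite in_itv/= => /andP[t0 tT]; have [k kt] := dyadic_ex T0 tT.
  by exists k => //=; rewrite in_itv/= t0 ltW.
move=> [k _] /=; rewrite !in_itv/= => /andP[-> tk].
exact: le_lt_trans tk (dyadic_lt k T0).
Qed.

(** Monotone convergence along the dyadic intervals. *)
Lemma integ_improper T g c : 0 < T -> (forall t, 0 <= t < T -> 0 <= g t) -> 0 <= g T ->
  (forall s, 0 <= s -> s < T -> integ 0 s g /\ int 0 s g <= c) -> integ 0 T g.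
Proof.
move=> T0 g0 gT gs.
have mE k : measurable (`[0, dyadic T k]%classic : set TR) by [].
have mk k : measurable_fun (`[0, dyadic T k]%classic : set TR) (EFin \o g).
  by have [ig _] := gs _ (dyadic_ge0 k T0) (dyadic_lt k T0); case/integrableP : ig.
have mg : measurable_fun (`[0, T[%classic : set TR) (EFin \o g).
  by rewrite dyadic_bigcup//; apply/measurable_fun_bigcup.
have mgc : measurable_fun (`[0, T]%classic : set TR) (EFin \o g).
  exact/emeasurable_fun_itv_bndo_bndcP.
have g0' t : 0 <= t <= T -> 0 <= g t.
  by move=> /andP[t0]; rewrite le_eqVlt => /predU1P[->//|tT]; rewrite g0// t0.
apply/integrableP; split => //.
rewrite [X in (X < _)%E](_ : _ = \int[mu]_(x in `[0%R, T]) (EFin \o g) x)%E; last first.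
  by apply: eq_integral => t; rewrite inE/= in_itv/= => /g0' h; rewrite ger0_norm.
rewrite -integral_itv_bndo_bndc//.
have nd : nondecreasing_seq (fun k => `[0, dyadic T k]%classic : set TR).
  move=> k m km; rewrite subsetEset; apply: subset_itvl; rewrite bnd_simp.
  exact: dyadic_homo.
have pos k x : `[0, dyadic T k]%classic x -> (0 <= (EFin \o g) x)%E.
  rewrite /= in_itv/= lee_fin => /andP[x0 xk]; apply: g0; rewrite x0/=.
  exact: le_lt_trans xk (dyadic_lt k T0).
have := @ge0_nondecreasing_set_cvg_integral _ TR R (fun k => `[0, dyadic T k]%classic) (EFin \o g) mu nd mE mk pos.
rewrite -dyadic_bigcup// => gcvg.
apply: (@le_lt_trans _ _ c%:E); last exact: ltry.
rewrite -(cvg_lim _ gcvg)//; apply: lime_le; first by apply/cvg_ex; exists (\int[mu]_(x in `[0%R, T[) (EFin \o g) x)%E.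
apply: nearW => k; have [ig ic] := gs _ (dyadic_ge0 k T0) (dyadic_lt k T0).
rewrite -lee_fin in ic; apply: le_trans ic.
by rewrite /int /Rintegral fineK//; exact: (integrable_fin_num _ ig).
Qed.

Lemma int_improper_le T g c t : 0 <= t -> t < T -> (forall t, 0 <= t <= T -> 0 <= g t) ->
  integ 0 T g -> (forall s, t <= s -> s < T -> int t s g <= c) -> int t T g <= c.
Proof.
move=> t0 tT g0 ig gc; apply/ler_addgt0Pr => e e0.
have [d d0 dP] := ac_on_small (int_ac g0 ig) e0.
pose s := Num.max t (T - d / 2).
have ts : t <= s by rewrite le_max lexx.
have sT : s < T by rewrite gt_max tT/=; lra.
rewrite (@int_chasles R t T s)//; [|exact: ltW|exact: integ_sub ig].
apply: lerD; first exact: gc.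
apply/ltW; apply: (dP s T (le_trans t0 ts) (ltW sT) (lexx _)).
by rewrite ltrBlDl -ltrBlDr lt_max; apply/orP; right; lra.
Qed.

Lemma expRN_lip (p q : R) : 0 <= p -> p <= q -> `|expR (- q) - expR (- p)| <= q - p.
Proof.
move=> p0 pq; rewrite distrC ger0_norm; last by rewrite subr_ge0 ler_expR lerN2.
have e1 : expR (- p) <= 1 by rewrite -expR0 ler_expR oppr_le0.
have -> : - q = - p + (p - q) by lra.
rewrite expRD -{1}(mulr1 (expR (- p))) -mulrBr.
have h : 1 - expR (p - q) <= q - p by have := expR_ge1Dx (p - q); lra.
apply: (le_trans (ler_wpM2l (expR_ge0 _) h)).
by rewrite ler_piMl// subr_ge0.
Qed.

Let weight_lip (p q : R) : 0 <= p -> p <= q ->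
  `|- (expR (- (4 * q)) / 2) / 4 - - (expR (- (4 * p)) / 2) / 4| <= q - p.
Proof.
move=> p0 pq; have := @expRN_lip (4 * p) (4 * q).
rewrite mulr_ge0// ler_pM2l// pq => /(_ isT isT).
move: (expR _) (expR _) => b a.
have -> : - (a / 2) / 4 - - (b / 2) / 4 = - (1 / 8) * (a - b) by lra.
by rewrite normrM normrN (ger0_norm (_ : 0 <= 1 / 8)) //; lra.
Qed.

(** The solution of rho' = -4 kap rho with value 1/2 at 0. *)
Definition weight kap (t : R) : R := expR (- (4 * int 0 t kap)) / 2.

Lemma weight_gt0 kap t : 0 < weight kap t.
Proof. by rewrite divr_gt0// expR_gt0. Qed.

Lemma weight_le kap s t : (forall t, 0 <= kap t) -> 0 <= s -> s <= t -> integ 0 t kap ->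
  weight kap t <= weight kap s.
Proof.
move=> k0 s0 st ik; have : int 0 s kap <= int 0 t kap.
  by rewrite -subr_ge0 (int_increment ik)// int_ge0.
rewrite /weight; move: (int 0 s kap) (int 0 t kap) => p q pq.
by rewrite ler_pM2r ?invr_gt0// ler_expR lerN2 ler_pM2l.
Qed.

Lemma weight_le1 kap t : (forall t, 0 <= kap t) -> weight kap t <= 1 / 2.
Proof.
move=> k0; rewrite ler_pM2r ?invr_gt0// -expR0 ler_expR oppr_le0 mulr_ge0//.
exact: int_ge0.
Qed.

Lemma weight_measurable kap b : integ 0 b kap ->
  measurable_fun (`[0, b]%classic : set TR) (weight kap : TR -> R).
Proof.
move=> ik; apply: measurable_funM; last exact: measurable_cst.
apply: measurableT_comp; first exact: measurable_expR.
apply: measurableT_comp => //; apply: measurable_funM; first exact: measurable_cst.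
exact: int_measurable_r.
Qed.

(** The integrand is almost everywhere the derivative of -rho / 4. The bound stays finite as [s]
    increases even if the integral of [kap] diverges. *)
Lemma weight_int kap t s : (forall t, 0 <= kap t) -> 0 <= t -> t <= s -> integ 0 s kap ->
  integ 0 s (fun r => kap r * weight kap r) /\
  int t s (fun r => kap r * weight kap r) <= (weight kap t - weight kap s) / 4.
Proof.
move=> k0 t0 ts ik.
have ig : integ 0 s (fun r => kap r * weight kap r).
  apply: (@integ_le R 0 s _ kap) => // [|r _].
    apply: measurable_funM; last exact: weight_measurable.
    by case/integrableP : ik => /measurable_EFinP.
  have := weight_gt0 kap r; have := weight_le1 r k0; have := k0 r.
  move: (weight kap r) (kap r) => p q q0 p1 p0.
  by rewrite ger0_norm ?mulr_ge0 ?(ltW p0)// ler_piMr// (le_trans p1)//; lra.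
split => //.
have ikt : integ t s kap by exact: integ_sub ik.
pose phi r := - weight kap r / 4.
suff : int t s (fun r => kap r * weight kap r) <= phi s - phi t.
  rewrite /phi; move: (int _ _ _) (weight _ _) (weight _ _) => p q r0 h.
  by apply: (le_trans h); lra.
apply: ac_int_le => //.
- apply: (@ac_on_le R t s _ _ 1 _ _ (int_ac (fun r _ => k0 r) ikt)) => // u v tu uv vs.
  have u0 := le_trans t0 tu.
  rewrite mul1r -(int_increment ik u0 uv vs) /phi /weight.
  have iu : 0 <= int 0 u kap by exact: int_ge0.
  have iuv : int 0 u kap <= int 0 v kap.
    by rewrite -subr_ge0 (int_increment ik)// int_ge0.
  exact: weight_lip.
- exact: integ_sub ig.
apply: ae_imp (int_ftc ik) => r + /andP[tr rs].
rewrite (le_lt_trans t0 tr) rs => /(_ isT)[dr Dr].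
have dF : is_derive r (1 : R) (fun y => int 0 y kap) (kap r) by exact: DeriveDef.
have dG := is_deriveZ (- 4) dF.
have dE := is_derive1_comp (is_derive_expR _) dG.
have dP := is_deriveZ (- (1 / 8)) dE.
have E : phi = - (1 / 8) \*: (expR \o (- 4 \*: (fun y => int 0 y kap))).
  apply/funext => y; rewrite /phi /weight /=.
  have -> : - 4 *: int 0 y kap = - (4 * int 0 y kap) by rewrite [_ *: _]mulNr.
  by rewrite [RHS]mulNr; lra.
have {}dP : is_derive r (1 : R) phi (- (1 / 8) *: (expR (- 4 *: int 0 r kap) * (- 4 *: kap r))).
  by rewrite E.
split; first exact: ex_derive.
have -> : 'D_1 phi r = - (1 / 8) *: (expR (- 4 *: int 0 r kap) * (- 4 *: kap r)).
  exact: derive_val.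
rewrite /weight; have -> : - 4 *: int 0 r kap = - (4 * int 0 r kap) by rewrite [_ *: _]mulNr.
move: (expR _) (kap r) => p q.
have -> : - (1 / 8) *: (p * (- 4 *: q)) = - (1 / 8) * (p * (- 4 * q)) by [].
lra.
Qed.

End ImproperIntegrals.

(** * A global selection with prescribed decay of the error *)

Section GlobalSelection.
Context {R : realType} {n : nat}.
Notation mu := (@lebesgue_measure R).
Local Notation V := 'rV[R]_n.
Local Notation TR := (measurableTypeR R).
Implicit Types (D : set TR) (F G : R -> V -> set V) (K : nat -> R -> R) (x w : R -> V).

(** The limit is known already; summing again from [k] on gives a bound by the later increments
    alone. *)
Lemma limit_tail (a : nat -> V) l C c k : (forall k, `|a k - l| <= C * 2^-1 ^+ k) ->
  (forall i, `|a (k + i.+1)%N - a (k + i)%N| <= c * 2^-1 ^+ i) -> `|a k - l| <= 2 * c.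
Proof.
move=> al ac; have [l' l'P] := @geometric_cvg R n (fun i => a (k + i)%N) c ac.
apply/ler_addgt0Pr => e e0.
have [N NP] := halfX_small (`|C| + 2 * c) e0.
apply: (le_trans (ler_distD l' _ _)); apply: lerD.
  by have := l'P 0%N; rewrite addn0 expr0 mulr1.
apply: (le_trans (ler_distD (a (k + N)%N) _ _)); rewrite distrC.
apply: le_trans (ltW (NP N (leqnn N))); rewrite addrC mulrDl lerD//.
apply: (le_trans (al _)); apply: (le_trans (ler_wpM2r _ (ler_norm C))); first by rewrite ltW// halfX_gt0.
rewrite ler_wpM2l// exprD; apply: ler_piMl; first by rewrite ltW// halfX_gt0.
by rewrite exprn_ile1// ?invr_ge0// invf_le1// ler1n.
Qed.

(** At the right end of a window the selection already follows the next piece. *)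
Lemma eq_int_co a b (f g : R -> R) : integ a b f -> integ a b g ->
  (forall t, a <= t < b -> f t = g t) -> int a b f = int a b g.
Proof.
move=> fi gi fg; rewrite /int.
rewrite -[LHS]Rintegral_itv_bndo_bndc; last first.
  by apply: integrableS fi => //; apply: subset_itv; rewrite bnd_simp.
rewrite -[RHS]Rintegral_itv_bndo_bndc; last first.
  by apply: integrableS gi => //; apply: subset_itv; rewrite bnd_simp.
by apply: eq_Rintegral => t; rewrite inE/= in_itv/= => /fg.
Qed.

(** [q0] shifts the start by minus the limit of the drift at [T], so the error at [t] involves only
    the current and later windows. *)
Lemma global_selection D F K T x (rho : R -> R) : std_data D F K -> relaxed_solution F T x ->
  0 < T -> (forall t, 0 < rho t) -> (forall s t, 0 <= s -> s <= t -> t < T -> rho t <= rho s) ->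
  exists w q0, [/\ mfunv (`[0, T[%classic : set TR) w,
    forall t, 0 <= t < T -> D t -> F t (x t) (w t),
    forall t m, 0 <= t < T -> `|x t| <= m%:R -> `|w t| <= K m t &
    forall t, 0 <= t < T -> `|x 0 + q0 + vint 0 t w - x t| <= rho t].
Proof.
move=> sd rs T0 rho0 rhole.
pose tk := dyadic T.
have tk0 k : 0 <= tk k by exact: dyadic_ge0.
have tkT k : tk k < T by exact: dyadic_lt.
have tkS k : tk k <= tk k.+1 by exact: dyadic_le.
have bnd k : exists M : nat, forall t, 0 <= t <= tk k -> `|x t| <= M%:R.
  by apply: ac_bounded => //; exact: (rs_ac rs).
(* As rho decreases, the errors from window [k] on sum to at most twice [eps k]; with the current
   window this is at most 3/8 of rho at the right end of the window, hence below rho at [t]. *)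
pose eps k := 2^-1 ^+ k * rho (tk k.+1) / 8.
have eps0 k : 0 < eps k by rewrite divr_gt0// mulr_gt0// halfX_gt0.
have exw k : exists w, [/\ mfunv (`[tk k, tk k.+1]%classic : set TR) w,
    forall t, tk k <= t <= tk k.+1 -> D t -> F t (x t) (w t),
    forall t m, tk k <= t <= tk k.+1 -> `|x t| <= m%:R -> `|w t| <= K m t &
    forall t, tk k <= t <= tk k.+1 -> `|drift x w (tk k) t| <= eps k].
  have [M MP] := bnd k.+1.
  apply: (sigma_delta sd rs (tk0 k) (tkS k) (tkT _) (M := M)) => // t /andP[h1 h2].
  by apply: MP; rewrite h2 (le_trans (tk0 k)).
have [w_ w_P] := choice exw.
pose idx t := least (fun k => t < tk k.+1).
have idxP t : 0 <= t < T -> tk (idx t) <= t < tk (idx t).+1.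
  move=> /andP[t0 tT]; have [k kP] := dyadic_ex T0 tT.
  have kP' : t < tk k.+1 by apply: lt_le_trans (tkS k).
  have [h1 h2] := (least_eq kP' (idx t)).1 erefl.
  rewrite h1 andbT; case: (idx t) h2 => [_|j h2]; first by rewrite /tk dyadic0.
  by rewrite leNgt; apply/negP => h; exact: (h2 j).
have idxE k t : tk k <= t < tk k.+1 -> idx t = k.
  move=> /andP[kt tk']; apply/(least_eq (P := fun k => t < tk k.+1) tk'); split => // j jk.
  by apply/negP; rewrite -leNgt (le_trans _ kt)// /tk dyadic_homo.
pose W k t := if t \in (`[tk k, tk k.+1]%classic : set TR) then w_ k t else 0.
have mI : measurable (`[0, T[%classic : set TR) by [].
have mW k : mfunv (`[0, T[%classic : set TR) (W k).
  move=> i; rewrite [X in measurable_fun _ X](_ : _ =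
      (fun t => w_ k t ord0 i) \_ (`[tk k, tk k.+1]%classic : set TR)).
    apply: measurable_patch => //; last by have [m _ _ _] := w_P k; exact: m.
    move=> t /=; rewrite !in_itv/= => /andP[h1 h2].
    by rewrite (le_trans (tk0 k) h1) (le_lt_trans h2 (tkT _)).
  by apply/funext => t; rewrite patchE /W; case: ifP; rewrite ?mxE.
have cidx : countable_index (`[0, T[%classic : set TR) idx.
  apply: countable_index_least => // [t /=|k].
    rewrite in_itv/= => /idxP /andP[_ h]; by exists (idx t).
  have := measurableI _ _ mI (measurable_itv `]-oo, (tk k.+1)[).
  by congr measurable; apply/seteqP; split => t /=; rewrite !in_itv.
pose w t := W (idx t) t.
have wE t : 0 <= t < T -> w t = w_ (idx t) t.
  by move=> /idxP /andP[h1 h2]; rewrite /w /W mem_set//= in_itv/= h1 ltW.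
have mw : mfunv (`[0, T[%classic : set TR) w by exact: mfunv_index.
have wb t m : 0 <= t < T -> `|x t| <= m%:R -> `|w t| <= K m t.
  move=> tT; rewrite wE//; have [_ _ h _] := w_P (idx t); apply: h.
  by have /andP[h1 h2] := idxP _ tT; rewrite h1 ltW.
have mwb b : b < T -> mfunv (`[0, b]%classic : set TR) w.
  move=> bT; apply: mfunv_sub mw => // t /=; rewrite !in_itv/= => /andP[-> tb].
  exact: le_lt_trans bT.
pose a k := drift x w 0 (tk k).
have step k t : tk k <= t <= tk k.+1 ->
    `|drift x w 0 t - a k| <= eps k.
  move=> tkk; have /andP[kt tk1] := tkk; have [M MP] := bnd k.+1.
  have t0 := le_trans (tk0 k) kt.
  have tT := le_lt_trans tk1 (tkT _).
  have wM r : 0 <= r <= tk k.+1 -> `|w r| <= K M r.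
    by move=> rr; have /andP[r0 r1] := rr; apply: wb; [rewrite r0 (le_lt_trans r1)|exact: MP].
  have iK := sd_Kinteg M (tk k.+1) sd (lexx 0).
  have E : drift x w 0 t - a k = drift x (w_ k) (tk k) t.
    have vE : vint (tk k) t w = vint (tk k) t (w_ k).
      apply/rowP => i; rewrite !mxE; have [mk _ kb _] := w_P k.
      have iw : integ (tk k) t (fun s => w s ord0 i).
        apply: (@integ_sub R 0 (tk k.+1)) => //.
        by apply: vint_integ wM iK; exact: mwb.
      have iwk : integ (tk k) t (fun s => w_ k s ord0 i).
        apply: (@integ_sub R (tk k) (tk k.+1)) => //.
        apply: (@vint_integ R n _ _ _ (K M)) => // [r rk|].
          apply: kb => //; apply: MP; have /andP[h1 h2] := rk.
          by rewrite h2 (le_trans (tk0 k)).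
        exact: sd_Kinteg sd (tk0 k).
      apply: eq_int_co => // r /andP[kr rt]; rewrite wE; last first.
        by rewrite (le_trans (tk0 k) kr) (lt_trans rt tT).
      by rewrite (idxE k)// kr (lt_le_trans rt tk1).
    rewrite /a /drift -vE -(vint_increment (mwb _ (tkT k.+1)) wM iK (tk0 k) kt tk1).
    by apply/rowP => i; rewrite !mxE; ring.
  by rewrite E; have [_ _ _ h] := w_P k; exact: h.
have rho1 k : rho (tk k.+1) <= rho 0 by apply: rhole.
have astep k : `|a k.+1 - a k| <= eps k by apply: step; rewrite tkS lexx.
have [|l lP] := @geometric_cvg R n a (rho 0 / 8).
  move=> k; apply: (le_trans (astep k)).
  by rewrite /eps -mulrA mulrC ler_pM2r ?halfX_gt0// ler_pM2r ?invr_gt0.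
have tail k : `|a k - l| <= 2 * eps k.
  apply: (limit_tail lP) => i; rewrite addnS; apply: (le_trans (astep _)).
  have rk : rho (tk (k + i).+1) <= rho (tk k.+1).
    by rewrite rhole// /tk dyadic_homo// ltnS leq_addr.
  rewrite /eps exprD; move: (2^-1 ^+ k) (2^-1 ^+ i) (@halfX_gt0 R k) (@halfX_gt0 R i).
  move: (rho _) (rho _) rk => p q pq u v u0 v0.
  have -> : u * p / 8 * v = u * v * p / 8 by ring.
  by rewrite ler_pM2r ?invr_gt0// ler_pM2l// mulr_gt0.
exists w, (- l); split => //.
  move=> t tT Dt; rewrite wE//; have [_ h _ _] := w_P (idx t); apply: h => //.
  by have /andP[h1 h2] := idxP _ tT; rewrite h1 ltW.
move=> t tT; have /andP[h1 h2] := idxP _ tT; set k := idx t in h1 h2.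
have -> : x 0 - l + vint 0 t w - x t = (drift x w 0 t - a k) + (a k - l).
  by rewrite /drift; apply/rowP => i; rewrite !mxE; ring.
apply: (le_trans (ler_normD _ _)).
have s1 := step k t; rewrite h1 (ltW h2) in s1.
apply: (le_trans (lerD (s1 isT) (tail k))).
have rt : rho (tk k.+1) <= rho t by apply: rhole; [case/andP: tT|exact: ltW|].
apply: le_trans rt; rewrite /eps.
have : 2^-1 ^+ k <= 1 :> R by rewrite exprn_ile1// ?invr_ge0// invf_le1// ler1n.
have := rho0 (tk k.+1); move: (rho _) (2^-1 ^+ k) (@halfX_gt0 R k) => p q q0 p0 q1.
have : q * p <= p by rewrite ler_piMl// ltW.
have : 0 < q * p by rewrite mulr_gt0.
move: (q * p) => r; lra.
Qed.

End GlobalSelection.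

(** * Relaxation on a half-open interval *)

Section Relaxation.
Context {R : realType} {n : nat}.
Notation mu := (@lebesgue_measure R).
Local Notation V := 'rV[R]_n.
Local Notation TR := (measurableTypeR R).
Implicit Types (D : set TR) (F G : R -> V -> set V) (K : nat -> R -> R) (v w x : R -> V).

Lemma vintD a b v w : (forall i, integ a b (fun t => v t ord0 i)) ->
  (forall i, integ a b (fun t => w t ord0 i)) ->
  vint a b (fun t => v t + w t) = vint a b v + vint a b w.
Proof.
move=> iv iw; apply/rowP => i; rewrite !mxE -intD//.
by apply: eq_int => t _; rewrite mxE.
Qed.

Lemma vint_chasles a b c v : a <= c -> c <= b -> (forall i, integ a b (fun t => v t ord0 i)) ->
  vint a b v = vint a c v + vint c b v.
Proof. by move=> ac cb iv; apply/rowP => i; rewrite !mxE; exact: int_chasles. Qed.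

Lemma relaxation D F K T x : std_data D F K -> relaxed_solution F T x -> 0 < T ->
  exists y, [/\ forall a b, 0 <= a -> b < T -> abs_continuous a b y,
    {ae mu, forall t : R, 0 <= t < T -> derivable y t 1 /\ F t (y t) ('D_1 y t)} &
    forall t, 0 <= t < T -> `|y t - x t| <= 1].
Proof.
move=> sd rs T0.
have mI : measurable (`[0, T[%classic : set TR) by [].
have bnd b : 0 <= b -> b < T -> exists M : nat, forall t, 0 <= t <= b -> `|x t| <= M%:R.
  by move=> b0 bT; apply: ac_bounded => //; exact: (rs_ac rs).
have mx : mfunv (`[0, T[%classic : set TR) x.
  move=> i; rewrite dyadic_bigcup//; apply/measurable_fun_bigcup => // k.
  exact: (ac_measurable (rs_ac rs (lexx 0) (dyadic_lt k T0))).
(* The radius is chosen pointwise in time, as [x] may be unbounded towards [T]. *)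
pose m t := least (fun k => `|x t| + 1 <= k%:R).
have mex t : exists k : nat, `|x t| + 1 <= k%:R.
  by exists (Num.truncn (`|x t| + 1)).+1; rewrite ltW// truncnS_gt.
have mP t : `|x t| + 1 <= (m t)%:R.
  by have [k kP] := mex t; have [] := (leastP (P := fun k => `|x t| + 1 <= k%:R) kP).
have m_le t (M : nat) : `|x t| <= M%:R -> (m t <= M.+1)%N.
  move=> xM; have [k kP] := mex t.
  have [_] := (leastP (P := fun k => `|x t| + 1 <= k%:R) kP); apply.
  by rewrite -natr1 lerD2r.
have cm : countable_index (`[0, T[%classic : set TR) m.
  apply: countable_index_least => // k.
  have mn := measurable_funD (measurable_norm mI mx) (measurable_cst (1 : R)).
  have := mn mI _ (measurable_itv `]-oo, k%:R]).
  by congr measurable; apply/seteqP; split => t /=; rewrite !in_itv.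
pose kap t := K (m t) t.
have kap1 t : 1 <= kap t by exact: sd_K1 sd _ _.
have kap_gt0 t : 0 < kap t by exact: lt_le_trans (kap1 t).
have kap0 t : 0 <= kap t by exact: ltW.
have mkap : measurable_fun (`[0, T[%classic : set TR) (kap : TR -> R).
  by apply: measurable_fun_index => // k; apply: measurable_funTS; exact: (sd_Kmeas sd).
have sub b : b < T -> `[0, b]%classic `<=` (`[0, T[%classic : set TR).
  by move=> bT t /=; rewrite !in_itv/= => /andP[-> tb]; exact: le_lt_trans bT.
have kapM (M : nat) t : `|x t| <= M%:R -> kap t <= K M.+1 t.
  by move=> xM; exact: (sd_Kle t sd (m_le t M xM)).
have ikap b : 0 <= b -> b < T -> integ 0 b kap.
  move=> b0 bT; have [M MP] := bnd b b0 bT.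
  apply: (@integ_le R 0 b _ (K M.+1)); last exact: (sd_Kinteg _ _ sd).
    by apply: measurable_funS mkap => //; exact: sub.
  by move=> t /MP xM; rewrite ger0_norm// kapM.
pose rho := weight kap.
have rho0 t : 0 < rho t by exact: weight_gt0.
have rho1 t : rho t <= 1 / 2 by exact: weight_le1.
have rhole s t : 0 <= s -> s <= t -> t < T -> rho t <= rho s.
  by move=> s0 st tT; apply: weight_le => //; apply: ikap => //; exact: le_trans st.
have [w [q0 [mw wF wK yx]]] := global_selection sd rs T0 rho0 rhole.
pose y0 t := x 0 + q0 + vint 0 t w.
have xkap t : `|x t| <= (m t)%:R by rewrite (le_trans _ (mP t))// lerDl.
have wkap t : 0 <= t < T -> `|w t| <= kap t by move=> tT; apply: wK.
have mwb b : b < T -> mfunv (`[0, b]%classic : set TR) w.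
  by move=> bT; apply: mfunv_sub mw => //; exact: sub.
have wkb b t : b < T -> 0 <= t <= b -> `|w t| <= kap t.
  by move=> bT /andP[t0 tb]; apply: wkap; rewrite t0 (le_lt_trans tb).
have mrho : measurable_fun (`[0, T[%classic : set TR) (rho : TR -> R).
  rewrite dyadic_bigcup//; apply/measurable_fun_bigcup => // k.
  by apply: weight_measurable; apply: ikap; [exact: dyadic_ge0|exact: dyadic_lt].
pose g t := kap t * rho t.
have g_gt0 t : 0 < g t by rewrite mulr_gt0.
have g0 t : 0 <= g t by exact: ltW.
(* The integrals of g up to any time before [T] are at most rho(0) / 4, whatever the growth of
   [kap]. *)
have ig : integ 0 T g.
  apply: (@integ_improper R T g (rho 0 / 4)) => // s s0 sT.
  have [h1 h2] := weight_int kap0 (lexx 0) s0 (ikap s s0 sT); split => //.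
  apply: (le_trans h2); rewrite ler_pM2r ?invr_gt0// gerBl.
  by rewrite ltW// weight_gt0.
have gle t : 0 <= t -> t < T -> int t T g <= rho t / 4.
  move=> t0 tT; apply: int_improper_le => // s ts sT.
  have [_ h2] := weight_int kap0 t0 ts (ikap s (le_trans t0 ts) sT).
  apply: (le_trans h2); rewrite ler_pM2r ?invr_gt0// gerBl.
  by rewrite ltW// weight_gt0.
pose D' : set TR := D `&` `[0, T[.
have mD' : measurable D' by apply: measurableI => //; exact: sd_measurable sd.
have D'D : D' `<=` D by exact: subIsetl.
have D'I : D' `<=` `[0, T[ by exact: subIsetr.
have D't t : D' t -> 0 <= t < T by move=> [_ /=]; rewrite in_itv.
pose G := window F x.
have my0 : mfunv D' y0.
  apply: mfunvD; first exact: mfunv_cst.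
  apply: (@mfunv_sub _ _ (`[0, T[%classic : set TR)) => // i.
  rewrite dyadic_bigcup//; apply/measurable_fun_bigcup => // k.
  rewrite [X in measurable_fun _ X](_ : _ = fun t => int 0 t (fun s => w s ord0 i)).
    have kT := dyadic_lt k T0; apply: int_measurable_r.
    apply: (vint_integ _ (mwb _ kT)); first by move=> t; exact: wkb.
    by apply: ikap => //; exact: dyadic_ge0.
  by apply/funext => t; rewrite mxE.
have lG : lipschitz_map D' G kap by exact: (lipschitz_window sd D'D (fun t _ => mP t)).
have [|||||||||||||||||u [mu_ ub uG uI]] := @picard_int R n D' 0 T G kap rho id (cst T) (-1) w y0 mD'.
- by apply: subset_trans D'I _; apply: subset_itvl; rewrite bnd_simp.
- by apply: measurable_funS mkap.
- by apply: measurable_funS mrho.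
- by [].
- by [].
- apply: (mmap_sub mD' mD' (fun _ h => h)); apply: mmap_window.
    by apply: (mmap_sub _ mD' D'D (sd_mmap sd)); exact: sd_measurable sd.
  by apply: mfunv_sub mx.
- by move=> t xi [Dt _]; exact: sd_closed sd _ _ Dt.
- exact: lG.
- by move=> t _; exact: g0.
- exact: ig.
- by rewrite normrN1.
- by move=> t /D't /andP[? _] /=.
- move=> f fi; apply: measurable_funS (int_measurable_l fi) => //.
  by apply: subset_trans D'I _; apply: subset_itvl; rewrite bnd_simp.
- by move=> t /D't /andP[t0 tT]; exact: gle.
- by apply: mfunv_sub mw.
- exact: my0.
- move=> t tD'; have tT := D't t tD'; have [Dt _] := tD'.
  have Gw : G t (x t) (w t) by rewrite /G window_id ?subrr ?normr0//; exact: wF.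
  (* The initial defect: [w] is a velocity at [x], and [y0] is within rho of [x]. *)
  have [z Gz zw] := lG t (x t) (y0 t) (w t) tD' Gw; exists z => //.
  rewrite distrC; apply: (le_trans zw); rewrite /g ler_wpM2l// distrC.
  exact: yx.
have {}mu_ (E : set TR) : measurable E -> mfunv E u by move=> mE i; exact: measurable_funTS (mu_ i).
have ub' t : 0 <= t <= T -> `|u t| <= 4 * g t by exact: ub.
have ig4 : integ 0 T (fun t => 4 * g t) by exact: integZ.
have iu i : integ 0 T (fun t => u t ord0 i) by apply: vint_integ ub' ig4; exact: mu_.
(* The correction vanishes at [T]; seen from time 0 it changes the initial value to [yc]. *)
pose y t := y0 t - vint t T u.
have yy0 t : 0 <= t < T -> `|vint t T u| <= rho t.
  move=> /andP[t0 tT].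
  apply: (@le_trans _ _ (int t T (fun t => 4 * g t))).
    apply: vint_le; first exact: mu_.
      by move=> r /andP[tr rT]; apply: ub'; rewrite (le_trans t0).
    by apply: integ_sub ig4.
  rewrite intZ; last by apply: integ_sub ig.
  by have := gle t t0 tT; move: (int _ _ _) (rho _) => p q; lra.
have yx1 t : 0 <= t < T -> `|y t - x t| <= 1.
  move=> tT; rewrite /y addrAC (le_trans (ler_normB _ _))//.
  have := yx t tT; have := yy0 t tT; have := rho1 t; rewrite -/(y0 t).
  by move: `|_ - _| `|_| (rho t) => *; lra.
pose yc := x 0 + q0 - vint 0 T u.
have yE t : 0 <= t < T -> y t = yc + vint 0 t (fun s => w s + u s).
  move=> /andP[t0 tT]; rewrite vintD; last first.
  - by move=> i; apply: integ_sub (iu i) => //; exact: ltW.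
  - move=> i; apply: (vint_integ _ (mwb _ tT)); first by move=> r; exact: wkb.
    exact: ikap.
  rewrite /y /y0 /yc (vint_chasles t0 (ltW tT) iu).
  by apply/rowP => i; rewrite !mxE; ring.
have iwu b : 0 <= b -> b < T -> [/\ mfunv (`[0, b]%classic : set TR) (fun s => w s + u s),
    forall t, 0 <= t <= b -> `|w t + u t| <= kap t + 4 * g t &
    integ 0 b (fun t => kap t + 4 * g t)].
  move=> b0 bT; split.
  - by apply: mfunvD; [exact: mwb|exact: mu_].
  - move=> t tb; rewrite (le_trans (ler_normD _ _))// lerD ?(wkb b)//.
    by apply: ub'; have /andP[-> h] := tb; rewrite (le_trans h)// ltW.
  - by apply: integD; [exact: ikap|apply: integ_sub ig4 => //; exact: ltW].
exists y; split => //.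
- move=> a b a0 bT; have [ba|ab] := ltP b a.
    exact: (@ac_on_empty R a b (fun u v : R => enorm (y v - y u))).
  have b0 := le_trans a0 ab; have [h1 h2 h3] := iwu b b0 bT.
  apply: (@abs_continuous_le _ _ _ _ _ (fun s t : R => int s t (fun t => kap t + 4 * g t))).
    move=> r t ar rt tb; rewrite !yE; last 2 first.
    - by rewrite (le_trans a0 ar) (le_lt_trans rt)// (le_lt_trans tb).
    - by rewrite (le_trans a0 (le_trans ar rt)) (le_lt_trans tb).
    rewrite opprD addrACA subrr add0r.
    by apply: vint_increment_le h1 h2 h3 _ rt tb; exact: le_trans ar.
  apply: int_ac; last exact: integ_sub h3.
  by move=> t _; rewrite addr_ge0// mulr_ge0.
(* An integrable majorant of the velocity is available only on compact parts of [0, T), so the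
   countably many exceptional sets are united. *)
have aek k : {ae mu, forall t : R, 0 < t < dyadic T k ->
    derivable y t 1 /\ 'D_1 y t = w t + u t}.
  have kT := dyadic_lt k T0; have [h1 h2 h3] := iwu _ (dyadic_ge0 k T0) kT.
  apply: ae_imp (vint_ftc yc h1 h2 h3) => t + tk.
  move=> /(_ tk)[dv Dv]; have /andP[t0 tk'] := tk.
  have E : {near t, (fun t => yc + vint 0 t (fun s => w s + u s)) =1 y}.
    have e1 : \forall r \near t, r < dyadic T k by exact: lt_nbhsl.
    have e2 : \forall r \near t, 0 < r by exact: lt_nbhsr.
    apply: filterS2 e1 e2 => r rk r0; rewrite yE// (ltW r0)/=.
    exact: lt_trans kT.
  split; first exact: near_eq_derivable dv.
  by rewrite -(near_eq_derive _ E).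
have ne0 : {ae mu, forall t : R, t != 0}.
  exists [set 0]; split => //; first exact: lebesgue_measure_set1.
  by move=> t /= /negP; rewrite negbK => /eqP.
have aeall : {ae mu, forall t : R, forall k, 0 < t < dyadic T k ->
    derivable y t 1 /\ 'D_1 y t = w t + u t} by exact/ae_foralln.
apply: ae_imp (ae_and (ae_and aeall ne0) (sd_full sd)) => t [[H t_ne0] Dt] tT.
have /andP[t0 tT'] := tT.
have [k tk] := dyadic_ex T0 tT'.
have [|dy Dy] := H k; first by rewrite lt_neqAle eq_sym t_ne0 t0.
split => //; rewrite Dy.
have D't' : D' t by split; [exact: Dt|rewrite /= in_itv].
have := uG t D't'; rewrite scaleN1r -/(y t) /G window_id//.
exact: yx1.
Qed.

End Relaxation.

(** * Integrals against a pushforward measure *)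

Section Pushforward.
Context d d' (X : measurableType d) (Y : measurableType d') {R : realType}.

(** Meant for the identity from the completed to the Borel sigma-algebra, with a Borel [h] dominated
    by a merely Lebesgue measurable [g]. *)
Lemma pushforward_integral_lty (m : {measure set X -> \bar R}) (phi : X -> Y)
    (D : set Y) (g : X -> R) (h : Y -> R) :
  measurable_fun setT phi -> measurable D -> measurable_fun D h ->
  (forall y, 0 <= h y) -> (forall x, D (phi x) -> h (phi x) <= `|g x|) ->
  m.-integrable (phi @^-1` D) (EFin \o g) ->
  (\int[pushforward m phi]_(y in D) (h y)%:E < +oo)%E.
Proof.
move=> mphi mD mh h0 hg /integrableP[mg gfin].
have mD' : measurable (phi @^-1` D) by rewrite -[X in measurable X]setTI; exact: mphi.
rewrite ge0_integral_pushforward//; last 2 first.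
- exact/measurable_EFinP.
- by move=> y _; rewrite lee_fin.
apply: le_lt_trans gfin; apply: ge0_le_integral => //.
- by move=> x _; rewrite lee_fin.
- apply/measurable_EFinP; apply: (measurable_comp mD _ mh) => [y [x Dx <-] //|].
  exact: measurable_funTS.
- exact: measurableT_comp.
Qed.

End Pushforward.

(** * From Lebesgue to Borel measurability on the line *)

Section BorelReduction.
Context {R : realType}.
Notation mu := (@lebesgue_measure R).
Local Notation TR := (measurableTypeR R).
Implicit Types (A N : set TR) (k : R -> R).

Definition null N := measurable N /\ mu N = 0%E.

Lemma null0 : null set0.
Proof. by split => //; exact: measure0. Qed.

Lemma null_bigcup (I : countType) (N : I -> set TR) : (forall i, null (N i)) ->
  null (\bigcup_i N i).
Proof.
move=> nN; have mN : measurable (\bigcup_i N i).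
  by apply: countable_bigcupT_measurable => // i; exact: (nN i).1.
split=> //; apply/negligibleP => //.
pose M j := if unpickle j is Some i then N i else set0.
have NM : \bigcup_i N i `<=` \bigcup_j M j.
  by move=> t [i _ Nt]; exists (pickle i) => //; rewrite /M pickleK.
apply: negligibleS NM _.
apply: negligible_bigcup => j; rewrite /M.
case: (unpickle j) => [i|]; last exact: negligible_set0.
by apply/negligibleP; [exact: (nN i).1|exact: (nN i).2].
Qed.

Lemma nullU N N' : null N -> null N' -> null (N `|` N').
Proof.
move=> [mN N0] [mN' N'0]; split; first exact: measurableU.
by apply/negligibleP; [exact: measurableU|apply: negligibleU; apply/negligibleP].
Qed.

Lemma ae_null (P : R -> Prop) : {ae mu, forall t, P t} ->
  exists2 N, null N & forall t, ~ N t -> P t.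
Proof.
move=> [N [mN N0 PN]]; exists N => // t Nt; apply: contrapT => Pt.
by apply: Nt; exact: PN.
Qed.

Lemma null_ae N (P : R -> Prop) : null N -> (forall t, ~ N t -> P t) ->
  {ae mu, forall t, P t}.
Proof.
move=> [mN N0] NP; exists N; split => // t; apply: contra_notP => Nt.
exact: NP.
Qed.

(** The set is Borel up to a subset of a Borel null set; removing the latter leaves a Borel set. *)
Lemma caratheodory_borel (A : set R) :
  (wlength (R := R) idfun)^*%mu.-cara.-measurable A ->
  exists2 N, null N & measurable ((A : set TR) `\` N).
Proof.
rewrite -completed_caratheodory_measurable g_sigma_completed_algebra_genE.
move=> -[/= X mX] [N [M [mM M0 NM]]] <-; exists M => //.
rewrite (_ : _ `\` _ = X `\` M); first exact: measurableD.
apply/seteqP; split=> [t [[Xt|/NM]]|t [Xt Mt]] //; by split => //; left.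
Qed.

Notation cara := ((wlength (R := R) idfun)^*)%mu.

Lemma completed_integ S k (k' : R -> R) :
  measurable_fun setT (k' : TR -> R) -> (forall t, 0 <= k' t) ->
  (forall t, 0 <= t <= S -> k' t <= `|k t|) ->
  (@completed_lebesgue_measure R).-integrable `[0, S] (EFin \o k) ->
  integ 0 S k'.
Proof.
move=> mk k0 kk ik.
have mid : measurable_fun setT (id : caratheodory_type cara -> TR).
  by move=> _ Y mY; rewrite setTI; exact: sub_caratheodory.
have mS : measurable (`[0, S]%classic : set TR) by exact: measurable_itv.
have mkS : measurable_fun (`[0, S]%classic : set TR) (k' : TR -> R).
  exact: measurable_funTS.
have kkS t : (`[0, S]%classic : set TR) t -> k' t <= `|k t|.
  by rewrite /= in_itv/=; exact: kk.
have h := pushforward_integral_lty mid mS mkS k0 kkS ik.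
apply/integrableP; split; first exact/measurable_EFinP.
apply: le_lt_trans h.
under eq_integral do rewrite /= ger0_norm//.
by rewrite [leLHS](@eq_measure_integral _ _ _ _
  (pushforward (@completed_lebesgue_measure R) (id : caratheodory_type cara -> TR))).
Qed.

(** Sublevel sets at rational levels determine measurability, so countably many null sets are
    removed. *)
Lemma null_measurable_fun (E : set R) k : cara.-cara.-measurable E ->
  measurable_fun (E : set (caratheodory_type cara)) k ->
  exists2 N, null N &
    forall D : set TR, measurable D -> D `<=` E `\` N ->
      measurable_fun D (k : TR -> R).
Proof.
move=> mE mk.
have hq (q : rat) : exists N, null N /\
    measurable (((E `&` k @^-1` `]-oo, ratr q[) : set TR) `\` N).
  have [|N nN mN] := @caratheodory_borel (E `&` k @^-1` `]-oo, ratr q[).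
    exact: mk mE _ (measurable_itv _).
  by exists N.
have [N NP] := choice hq.
exists (\bigcup_q N q); first by apply: null_bigcup => q; exact: (NP q).1.
move=> D mD DE; apply: (measurability _ (RGenInftyO.measurableE R)) => _ [_ [x ->] <-].
rewrite (_ : _ `&` _ = \bigcup_(q in [set q : rat | ratr q < x])
    (D `&` ((E `&` k @^-1` `]-oo, ratr q[) `\` N q))).
  rewrite bigcup_mkcond; apply: countable_bigcupT_measurable => // q.
  case: ifP => // _; apply: measurableI => //; exact: (NP q).2.
apply/seteqP; split=> [t [Dt]|t [q /= qx [Dt [[Et]]]]]; rewrite /= !in_itv/=.
  move=> /rat_in_itvoo[q]; rewrite in_itv/= => /andP[kq qx].
  have [Et Nt] := DE _ Dt.
  exists q => //=; split => //; split; first by rewrite /= in_itv.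
  by move=> Nqt; apply: Nt; exists q.
by move=> kq _; split=> //; exact: lt_trans kq qx.
Qed.

(** The majorant is |k| cut off to nonnegative times outside a null set, collected from the
    intervals [0, j]. *)
Lemma L1loc_borel k : L1loc_ge0 k -> exists (k' : R -> R),
  [/\ measurable_fun setT (k' : TR -> R), forall t, 0 <= k' t,
      forall S, integ 0 S k' & {ae mu, forall t, 0 <= t -> k t <= k' t}].
Proof.
move=> Lk.
have ik (S : R) : (@completed_lebesgue_measure R).-integrable `[0, S] (EFin \o k).
  apply: Lk; last exact: segment_compact.
  by apply: subset_itv; rewrite bnd_simp.
have hj (j : nat) : exists N, null N /\ forall D : set TR, measurable D ->
    D `<=` `[0, j%:R] `\` N -> measurable_fun D (k : TR -> R).
  have [||N nN NP] := @null_measurable_fun `[0, j%:R] k.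
  - by apply: sub_caratheodory; exact: measurable_itv.
  - by apply/measurable_EFinP; exact: measurable_int (ik _).
  by exists N.
have [N_ NP] := choice hj; pose N := \bigcup_j N_ j.
have nN : null N by apply: null_bigcup => j; exact: (NP j).1.
pose D : set TR := `[0, +oo[ `\` N.
have mD : measurable D by apply: measurableD; [exact: measurable_itv|exact: nN.1].
have DE : D = \bigcup_j (`[0, j%:R] `\` N).
  apply/seteqP; split=> [t [t0 Nt]|t [j _ [tj Nt]]].
    move: t0; rewrite /= in_itv/= andbT => t0.
    exists (Num.bound t) => //; split=> //=; rewrite in_itv/= t0/=.
    exact/ltW/archi_boundP.
  split=> //; move: tj; rewrite /= !in_itv/= andbT.
  by case/andP.
have mk : measurable_fun D (k : TR -> R).
  have mDj (j : nat) : measurable (`[0, j%:R] `\` N : set TR).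
    by apply: measurableD; [exact: measurable_itv|exact: nN.1].
  rewrite DE; apply/measurable_fun_bigcup => // j.
  apply: (NP j).2 => // t [tj Nt]; split => // Njt; apply: Nt; exists j => //.
have mp : measurable_fun setT ((fun t => `|k t|) \_ D : TR -> R).
  by apply: measurable_patch => //; exact: measurableT_comp.
exists ((fun t => `|k t|) \_ D); split.
- exact: mp.
- by move=> t; rewrite /patch; case: ifP.
- move=> S; apply: completed_integ (ik S).
  + exact: mp.
  + by move=> t; rewrite /patch; case: ifP.
  + by move=> t _; rewrite /patch; case: ifP => _; rewrite ?normr_ge0.
- apply: (null_ae nN) => t Nt t0; rewrite /patch mem_set ?ler_norm//.
  by split=> //=; rewrite in_itv/= t0.
Qed.

End BorelReduction.

(** * Composition of the multifunction with measurable functions *)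

Section CompositionMeasurability.
Context {R : realType} {n : nat}.
Notation mu := (@lebesgue_measure R).
Local Notation V := 'rV[R]_n.
Local Notation TR := (measurableTypeR R).
Implicit Types (D N : set TR) (y : R -> V) (F : R -> V -> set V).

Lemma mfunv_borel D y (B : set V) : measurable D -> mfunv D y -> borel_sets B ->
  measurable (D `&` [set t | B (y t)]).
Proof.
move=> mD my; move: B; apply: smallest_sub; last first.
  by move=> O oO; exact: mfunv_open.
split=> [|B mB|B mB] /=.
- by rewrite (_ : [set t | _] = set0) ?setI0//; apply/seteqP; split.
- rewrite (_ : _ `&` _ = D `\` (D `&` [set t | B (y t)])); first exact: measurableD.
  by apply/seteqP; split=> [t [Dt [_ Bt]]|t [Dt Bt]]; split=> //; [case|split=> // ?; apply: Bt].
- rewrite (_ : _ `&` _ = \bigcup_i (D `&` [set t | B i (y t)])).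
    by apply: bigcupT_measurable => i; exact: mB.
  by apply/seteqP; split=> [t [Dt [i _ Bt]]|t [i _ [Dt Bt]]]; [exists i|split=> //; exists i].
Qed.

(** Sets with this property form a sigma-algebra containing the rectangles. The null set is chosen
    before [y], so one set of times serves all iterates. *)
Lemma prod_lebesgue_borel_section (E : set (R * V)) : prod_lebesgue_borel E ->
  exists2 N, null N & forall D y, measurable D -> D `<=` `[0, +oo[ `\` N ->
    mfunv D y -> measurable (D `&` [set t | E (t, y t)]).
Proof.
move: E; apply: smallest_sub.
  split=> [|E [N nN EN]|E hE] /=.
  - exists set0; first exact: null0.
    move=> D y mD _ _.
    by rewrite (_ : [set t | _] = set0) ?setI0//; apply/seteqP; split.
  - exists N => // D y mD DN my.
    rewrite (_ : _ `&` _ = D `\` (D `&` [set t | E (t, y t)])).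
      by apply: measurableD => //; exact: EN.
    apply/seteqP; split=> [t [Dt [_ Et]]|t [Dt Et]]; split=> //; first by case.
    split; last by move=> ?; apply: Et.
    by split=> //; exact: (DN _ Dt).1.
  - have [N NP] := choice (fun i => (exists2P _ _).1 (hE i)).
    exists (\bigcup_i N i); first by apply: null_bigcup => i; exact: (NP i).1.
    move=> D y mD DN my.
    rewrite (_ : _ `&` _ = \bigcup_i (D `&` [set t | E i (t, y t)])).
      apply: bigcupT_measurable => i; apply: (NP i).2 => // t /DN[t0 Nt].
      by split=> // Nit; apply: Nt; exists i.
    by apply/seteqP; split=> [t [Dt [i _ Bt]]|t [i _ [Dt Bt]]]; [exists i|split=> //; exists i].
move=> _ [A [B [[mA A0] mB ->]]] /=.
have [N nN mAN] := caratheodory_borel mA; exists N => // D y mD DN my.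
rewrite (_ : _ `&` _ = (D `&` (A `\` N)) `&` (D `&` [set t | B (y t)])).
  by apply: measurableI; [exact: measurableI|exact: mfunv_borel].
apply/seteqP; split=> [t [Dt [At Bt]]|t [[Dt [At _]] [_ Bt]]] //.
by split; split=> //; split=> //; exact: (DN _ Dt).2.
Qed.

(** One null set must serve all open sets, so it is collected over the countable base of rational
    balls. *)
Lemma measurable_multifunction_mmap F : measurable_multifunction F ->
  exists2 N, null N & forall D, measurable D -> D `<=` `[0, +oo[ `\` N -> mmap D F.
Proof.
move=> mF.
have hp (p : nat * nat) := prod_lebesgue_borel_section (mF _ (@rat_ball_open R n p.1 p.2)).
have [N NP] := choice (fun p => (exists2P _ _).1 (hp p)).
exists (\bigcup_p N p); first by apply: null_bigcup => p; exact: (NP p).1.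
move=> D mD DN y my O oO.
rewrite (_ : _ `&` _ = \bigcup_(p in [set p : nat * nat | @rat_ball R n p.1 p.2 `<=` O])
    (D `&` [set t | 0 <= t /\ F t (y t) `&` rat_ball p.1 p.2 !=set0])).
  rewrite bigcup_mkcond; apply: countable_bigcupT_measurable => // p.
  case: ifP => // _; apply: (NP p).2 => // t /DN[t0 Nt].
  by split=> // Npt; apply: Nt; exists p.
apply/seteqP; split=> [t [Dt [z [Fz Oz]]]|t [p pO [Dt [_ [z [Fz zp]]]]]]; last first.
  by split=> //; exists z; split=> //; exact: pO.
have [i [k [zik ikO]]] := open_rat_ball oO Oz.
exists (i, k) => //; split=> //=; split; last by exists z.
by have [] := DN _ Dt; rewrite /= in_itv/= andbT.
Qed.

End CompositionMeasurability.

(** * Reduction of the hypotheses to the standard form *)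

Section Reduction.
Context {R : realType} {n : nat}.
Notation mu := (@lebesgue_measure R).
Local Notation V := 'rV[R]_n.
Local Notation TR := (measurableTypeR R).
Implicit Types (F : R -> V -> set V) (A B : set V) (k : R -> R).

Lemma hausdorff_near A B (r c : R) z : (hausdorff_dist A B <= r%:E)%E -> A z ->
  r < c -> exists2 z', B z' & `|z - z'| <= c.
Proof.
move=> AB Az rc; have dz : (dist_set z B < c%:E)%E.
  apply: (@le_lt_trans _ _ r%:E); last by rewrite lte_fin.
  apply: le_trans AB; rewrite le_max; apply/orP; left.
  by apply: ereal_sup_ubound; exists z.
have [_ [z' Bz' <-]] := ereal_inf_lt dz; rewrite lte_fin => zz'.
by exists z' => //; apply: le_trans (le_enorm _) (ltW zz').
Qed.

(** The added 1 keeps the radius positive when [m] or [n] is 0. *)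
Lemma sup_ball_eball (xi : V) m : `|xi| <= m%:R -> eball (n%:R * m%:R + 1) xi.
Proof.
move=> xm; apply: (le_trans (enorm_le xi)).
have : n%:R * `|xi| <= n%:R * m%:R :> R by rewrite ler_wpM2l.
by move=> h; apply: (le_trans h); rewrite lerDl.
Qed.

(* The inequality on [c] is strict since a distance to a set is only an infimum. *)
Definition quasi_lipschitz m (l : R) (G : V -> set V) :=
  forall xi eta z c, `|xi| <= m%:R -> `|eta| <= m%:R -> G xi z ->
    l * (n%:R * `|xi - eta|) < c -> exists2 z', G eta z' & `|z - z'| <= c.

Lemma lipschitz_borel F :
  (forall r : R, 0 < r -> exists2 k : R -> R, L1loc_ge0 k &
    {ae mu, forall t : R, 0 <= t -> forall xi eta : V, eball r xi -> eball r eta ->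
      (hausdorff_dist (F t xi) (F t eta) <= (k t * enorm (xi - eta))%:E)%E}) ->
  forall m : nat, exists k : R -> R,
    [/\ measurable_fun setT (k : TR -> R), forall t, 0 <= k t,
        forall S, integ 0 S k &
        {ae mu, forall t, 0 <= t -> quasi_lipschitz m (k t) (F t)}].
Proof.
move=> hF m; have r0 : 0 < n%:R * m%:R + 1 :> R by rewrite ltr_wpDl// mulr_ge0.
have [k0 Lk0 hk0] := hF _ r0; have [k [mk k_ge0 ik kk]] := L1loc_borel Lk0.
exists k; split=> //; move: (ae_and hk0 kk); apply: ae_imp => t [h1 h2] t0.
move=> xi eta z c xm em Fz kc.
have := h1 t0 _ _ (sup_ball_eball xm) (sup_ball_eball em).
move=> /hausdorff_near; apply=> //; apply: le_lt_trans kc.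
have e0 : 0 <= enorm (xi - eta) by exact: sqrtr_ge0.
apply: (le_trans (ler_wpM2r e0 (h2 t0))).
by rewrite ler_wpM2l// enorm_le.
Qed.

(** The null set in the hypothesis depends on the state, so the bound is extracted at the origin;
    the Lipschitz estimate later carries it to all states off a common null set. *)
Lemma bounded_borel F :
  (forall r : R, 0 < r -> exists2 alpha : R -> R, L1loc_ge0 alpha &
    forall xi : V, eball r xi -> {ae mu, forall t : R, 0 <= t ->
      (ereal_sup [set (enorm zeta)%:E | zeta in F t xi] <= (alpha t)%:E)%E}) ->
  exists k : R -> R,
    [/\ measurable_fun setT (k : TR -> R), forall t, 0 <= k t,
        forall S, integ 0 S k &
        {ae mu, forall t, 0 <= t -> forall z, F t 0 z -> `|z| <= k t}].
Proof.
move=> hF; have [k0 Lk0 hk0] := hF _ ltr01.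
have [k [mk k_ge0 ik kk]] := L1loc_borel Lk0; exists k; split=> //.
have h0 : eball 1 (0 : V) by apply: (le_trans (enorm_le _)); rewrite normr0 mulr0.
move: (ae_and (hk0 _ h0) kk); apply: ae_imp => t [h1 h2] t0 z Fz.
apply: le_trans (h2 t0); apply: (le_trans (le_enorm z)).
rewrite -lee_fin; apply: le_trans (h1 t0).
by apply: ereal_sup_ubound; exists z.
Qed.

Lemma std_data_exists F :
  (forall t xi, 0 <= t -> F t xi !=set0 /\ closed (F t xi)) ->
  measurable_multifunction F ->
  (forall r : R, 0 < r -> exists2 k : R -> R, L1loc_ge0 k &
    {ae mu, forall t : R, 0 <= t -> forall xi eta : V, eball r xi -> eball r eta ->
      (hausdorff_dist (F t xi) (F t eta) <= (k t * enorm (xi - eta))%:E)%E}) ->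
  (forall r : R, 0 < r -> exists2 alpha : R -> R, L1loc_ge0 alpha &
    forall xi : V, eball r xi -> {ae mu, forall t : R, 0 <= t ->
      (ereal_sup [set (enorm zeta)%:E | zeta in F t xi] <= (alpha t)%:E)%E}) ->
  exists D K, std_data D F K.
Proof.
move=> F_values F_meas F_lip F_bd.
have [k hk] := choice (lipschitz_borel F_lip).
have [a [ma a0 ia ha]] := bounded_borel F_bd.
have [N0 nN0 mF] := measurable_multifunction_mmap F_meas.
have [N nN hN] : exists2 N, null N & forall t, ~ N t -> 0 <= t ->
    (forall z, F t 0 z -> `|z| <= a t) /\
    forall m, quasi_lipschitz m (k m t) (F t).
  have [N1 nN1 h1] := ae_null ha.
  have hm m : exists N, null N /\
      forall t, ~ N t -> 0 <= t -> quasi_lipschitz m (k m t) (F t).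
    by have [_ _ _ /ae_null[N nN hN]] := hk m; exists N.
  have [N2 N2P] := choice hm.
  exists (N1 `|` \bigcup_m N2 m).
    by apply: nullU => //; apply: null_bigcup => m; exact: (N2P m).1.
  move=> t Nt t0; split.
    by apply: h1 => // N1t; apply: Nt; left.
  by move=> m; apply: (N2P m).2 => // N2t; apply: Nt; right; exists m.
(* A velocity at a state of norm at most j is within the first summand of a velocity at the origin,
   which [a] bounds. The 1 added to n k provides the strict inequality in [quasi_lipschitz]; the sum
   in [K] makes the bounds monotone in the radius. *)
pose g j t := (1 + n%:R * k j t) * j.+1%:R + a t.
have k0 j t : 0 <= k j t by have [_ + _ _] := hk j.
have nk0 j t : 0 <= n%:R * k j t by rewrite mulr_ge0.
have g0 j t : 0 <= g j t by rewrite addr_ge0// mulr_ge0// addr_ge0.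
pose K m t := 1 + \sum_(j < m.+1) g j t.
have gK m t : g m t <= K m t.
  by rewrite /K big_ord_recr/= addrA lerDr addr_ge0// sumr_ge0.
exists (`[0, +oo[ `\` (N0 `|` N)), K.
have D_ge0 t : (`[0, +oo[ `\` (N0 `|` N) : set TR) t -> 0 <= t.
  by move=> [+ _]; rewrite /= in_itv/= andbT.
have nNN := nullU nN0 nN.
have DN t : (`[0, +oo[ `\` (N0 `|` N) : set TR) t -> ~ N t.
  by move=> [_ +] Nt; apply; right.
have mD : measurable (`[0, +oo[ `\` (N0 `|` N) : set TR).
  by apply: measurableD; [exact: measurable_itv|exact: nNN.1].
have kK m t : 1 + n%:R * k m t <= K m t.
  apply: le_trans (gK m t).
  rewrite (le_trans _ (_ : (1 + n%:R * k m t) * m.+1%:R <= _)) ?lerDl//.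
  by rewrite ler_peMr ?ler1n// addr_ge0.
split=> //.
- apply: (null_ae nNN) => t Nt t0; split => //=.
  by rewrite in_itv/= t0.
- move=> m; apply: measurable_funD => //; apply: measurable_sum => j.
  apply: measurable_funD => //; apply: measurable_funM => //.
  apply: measurable_funD => //; apply: measurable_funM => //.
  by have [] := hk j.
- by move=> m t; rewrite lerDl sumr_ge0.
- by move=> m t; rewrite /K lerD2l [leRHS]big_ord_recr/= lerDl.
- move=> m S; apply: integD; first exact: integ_cst.
  apply: integ_sum => j; apply: integD => //.
  have ikj : integ 0 S (k j) by have [] := hk j.
  have := integZ j.+1%:R (integD (integ_cst 0 S 1) (integZ n%:R ikj)).
  by apply: eq_integ => t _ /=; rewrite mulrC.
- by move=> t xi /D_ge0 t0; have [] := F_values t xi t0.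
- by move=> t xi /D_ge0 t0; have [] := F_values t xi t0.
- move=> m t xi z Dt xm Fz; have [h0 h] := hN t (DN _ Dt) (D_ge0 _ Dt).
  have [||z' Fz' zz'] := h m xi 0 z ((1 + n%:R * k m t) * m.+1%:R) xm _ Fz.
  + by rewrite normr0.
  + rewrite subr0 mulrA (mulrC (k m t)).
    apply: (@le_lt_trans _ _ (n%:R * k m t * m%:R)); first by rewrite ler_wpM2l.
    have := nk0 m t; rewrite -natr1; have : 0 <= m%:R :> R by [].
    by move: (n%:R * k m t) (m%:R) => p q; nra.
  + apply: le_trans (gK m t); rewrite /g.
    rewrite -(subrK z' z); apply: (le_trans (ler_normD _ _)).
    by rewrite lerD// h0.
- move=> m t xi eta z Dt xm em Fz; have [h0 h] := hN t (DN _ Dt) (D_ge0 _ Dt).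
  (* At equal states the strict inequality fails, and the velocity is its own witness. *)
  have [xe|xe] := eqVneq xi eta.
    by exists z; [rewrite -xe|rewrite !subrr xe subrr normr0 mulr0].
  have d0 : 0 < `|xi - eta| by rewrite normr_gt0 subr_eq0.
  apply: (h m) xm em Fz _; rewrite mulrA ltr_pM2r// (mulrC (k m t)).
  by apply: lt_le_trans (kK m t); rewrite ltrDr.
- apply: mF => // t [t0 Nt]; split=> // N0t; by apply: Nt; left.
Qed.

End Reduction.

(** * Forward completeness as boundedness, and the conclusion *)

Section ForwardCompleteness.
Context {R : realType} {n : nat}.
Notation mu := (@lebesgue_measure R).
Local Notation V := 'rV[R]_n.
Local Notation TR := (measurableTypeR R).
Implicit Types (D : set TR) (F G : R -> V -> set V) (K : nat -> R -> R) (A : set V).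
Implicit Types (x y : R -> V) (T : R).

Lemma sub_clco A : A `<=` clco A.
Proof. exact: sub_smallest. Qed.

(** The half-space is one of the closed convex sets whose intersection is the hull. *)
Lemma clco_dot A (e : V) c : (forall z, A z -> c <= dot e z) ->
  forall z, clco A z -> c <= dot e z.
Proof.
move=> Ac; apply: smallest_sub => //; split.
  apply: (@closed_comp _ _ (dot e) [set s | c <= s]) => [z _|]; last exact: closed_ge.
  rewrite /dot; elim: (index_enum _) => [|i s IH].
    rewrite (_ : (fun x : V => _) = cst 0); first exact: cst_continuous.
    by apply/funext => x; rewrite big_nil.
  rewrite (_ : (fun x : V => _) =
      fun x : V => e ord0 i * x ord0 i + \sum_(j <- s) e ord0 j * x ord0 j); last first.
    by apply/funext => x; rewrite big_cons.
  apply: (@continuousD _ _ _ (fun x : V => e ord0 i * x ord0 i)) => //.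
  apply: (@continuousM _ _ (cst (e ord0 i)) (fun x : V => x ord0 i)).
    exact: cst_continuous.
  exact: coord_continuous.
move=> z z' l; rewrite !inE /= => cz cz'.
rewrite dotD !dotZ.
have l0 : 0 <= l%:num by []; have l1 : l%:num <= 1 by [].
rewrite -[leLHS](subrK (l%:num * c)) addrC lerD ?ler_wpM2l//.
rewrite -[X in X - _]mul1r -mulrBl ler_wpM2l// subr_ge0//.
Qed.

Lemma clco_norm_le A c : 0 <= c -> (forall z, A z -> `|z| <= c) ->
  forall z, clco A z -> `|z| <= c.
Proof.
move=> c0 Ac z Az; apply: rv_norm_le => // i.
have Ac' z' : A z' -> `|z' ord0 i| <= c by move=> /Ac; exact/le_trans/coord_le.
rewrite ler_norml; apply/andP; split.
  rewrite -dot_delta; apply: clco_dot Az => z'.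
  by move=> /Ac'; rewrite dot_delta ler_norml => /andP[].
have dN z' : dot (- delta_mx ord0 i) z' = - z' ord0 i by rewrite dotC dotN dotC dot_delta.
rewrite -lerN2 -dN; apply: clco_dot Az => z' /Ac'.
by rewrite dN lerN2 ler_norml => /andP[].
Qed.

Lemma is_solution_sub F G I x : (forall t xi, I t -> F t xi `<=` G t xi) ->
  is_solution F I x -> is_solution G I x.
Proof.
move=> FG [acx dx]; split=> //; apply: ae_imp dx => t H It.
by have [? ?] := H It; split=> //; exact: FG.
Qed.

Definition bounded_until T x := exists M : nat, forall t, 0 <= t < T -> `|x t| <= M%:R.

(* A bounded solution extends past [T], whereas an unbounded one is maximal, as
   an extension to [0, Tp] would be bounded by compactness. *)
Lemma forward_complete_bounded D F K G : std_data D F K ->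
  (forall t xi, D t -> F t xi `<=` G t xi) ->
  (forall m t xi z, D t -> `|xi| <= m%:R -> G t xi z -> `|z| <= K m t) ->
  forward_complete G <-> forall T x, 0 < T ->
    is_solution G (horizon T%:E) x -> bounded_until T x.
Proof.
move=> sd FG bG; split=> [fc T x T0 solx|bd [T| |] x [T0 solx mx]] //; last first.
  have [M xM] := bd T x T0 solx; case: mx => // -[].
  exact: solution_extension sd (fun t xi z Dt => FG t xi Dt z) bG T0 solx xM.
apply: contrapT => unb; suff : T%:E = +oo%E by [].
apply: (fc _ x); split=> //; right => -[Tp [y [TTp soly yx]]]; apply: unb.
have Tp0 : 0 <= Tp by apply: ltW; apply: lt_trans T0 TTp.
have [M yM] := ac_bounded Tp0 (soly.1 0 Tp (@subset_refl _ _)).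
exists M => t /andP[t0 tT]; rewrite -yx; last by split.
by apply: yM; rewrite t0 ltW//; apply: lt_trans tT TTp.
Qed.

Lemma horizonP T t : horizon T%:E t <-> 0 <= t < T.
Proof. by rewrite /horizon/= lte_fin; split=> [[-> ->]|/andP[]]. Qed.

Lemma clco_relaxed_solution F T x :
  is_solution (fun t xi => clco (F t xi)) (horizon T%:E) x -> relaxed_solution F T x.
Proof.
move=> [acx dx]; split.
  move=> a b a0 bT; apply: acx => t /=; rewrite in_itv/= => /andP[at_ tb].
  by apply/horizonP; rewrite (le_trans a0 at_) (le_lt_trans tb bT).
apply: ae_imp dx => t H /horizonP/H[dxt Fx]; split=> // e c Fc.
exact: clco_dot Fx.
Qed.

(** Solutions for [F] solve the relaxed inclusion; conversely a relaxed solution inherits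
    boundedness from a solution for [F] within distance 1 on the same interval. *)
Lemma forward_complete_clco D F K : std_data D F K ->
  forward_complete F <-> forward_complete (fun t xi => clco (F t xi)).
Proof.
move=> sd.
have FF t xi : D t -> F t xi `<=` F t xi by move=> _ z.
have FG t xi : D t -> F t xi `<=` clco (F t xi) by move=> _; exact: sub_clco.
have bG m t xi z : D t -> `|xi| <= m%:R -> clco (F t xi) z -> `|z| <= K m t.
  move=> Dt xm; apply: clco_norm_le => [|z' Fz']; first by apply: le_trans (sd_K1 sd m t).
  exact: (sd_bound sd Dt xm Fz').
rewrite (forward_complete_bounded sd FF (sd_bound sd)).
rewrite (forward_complete_bounded sd FG bG); split=> bd T x T0 solx; last first.
  by apply: bd => //; apply: is_solution_sub solx => t xi _; exact: sub_clco.
have [y [acy dy yx]] := relaxation sd (clco_relaxed_solution solx) T0.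
have [|M yM] := bd T y T0.
  split=> [a b abT|]; last by apply: ae_imp dy => t H /horizonP.
  have [ba|ab] := ltP b a.
    exact: (@ac_on_empty R a b (fun u v : R => enorm (y v - y u))).
  have /horizonP/andP[a0 _] : horizon T%:E a by apply: abT; rewrite /= in_itv/= lexx.
  have /horizonP/andP[_ bT] : horizon T%:E b by apply: abT; rewrite /= in_itv/= lexx ab.
  exact: acy.
exists M.+1 => t tT; rewrite -(subKr (y t) (x t)) -natr1.
by apply: (le_trans (ler_normB _ _)); rewrite lerD ?yM ?yx.
Qed.

End ForwardCompleteness.

Theorem corollary3p4 (R : realType) (n : nat)
    (F : R -> 'rV[R]_n -> set 'rV[R]_n)
    (F_values : forall t xi, 0 <= t -> F t xi !=set0 /\ closed (F t xi))
    (F_compact : forall t xi, 0 <= t -> compact (F t xi))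
    (F_measurable : measurable_multifunction F)
    (F_lipschitz : forall r : R, 0 < r ->
       exists2 k : R -> R, L1loc_ge0 k &
         {ae (@lebesgue_measure R), forall t : R, 0 <= t ->
           forall xi eta : 'rV[R]_n, eball r xi -> eball r eta ->
             (hausdorff_dist (F t xi) (F t eta)
                <= (k t * enorm (xi - eta))%:E)%E})
    (F_bounded : forall r : R, 0 < r ->
       exists2 alpha : R -> R, L1loc_ge0 alpha &
         forall xi : 'rV[R]_n, eball r xi ->
           {ae (@lebesgue_measure R), forall t : R, 0 <= t ->
             (ereal_sup [set (enorm zeta)%:E | zeta in F t xi]
                <= (alpha t)%:E)%E}) :
  forward_complete F <-> forward_complete (fun t xi => clco (F t xi)).
Proof.
have [D [K sd]] := std_data_exists F_values F_measurable F_lipschitz F_bounded.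
exact: forward_complete_clco sd.
Qed.
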